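(* Let $\Omega\subset\mathbb{R}^d$ be a measurable set that $k$-tiles $\mathbb{R}^d$ by translations of the full lattice $\Lambda$, let $\vec a=(a_1,\dots,a_k)\in(\mathbb{R}^d)^k$, and let $J\subseteq Q$ be a full-measure subset (i.e. $J$ is measurable and $|I\setminus J|=0$). Then the following statements are equivalent: (i) The set $\{e_{a_j+h}: h\in H,\ j=1,\dots,k\}$ is a (structured) Riesz basis of exponentials of $L^2(\Omega)$. (ii) The determinant is different from zero at every point of $\overline{\varphi_{\vec a}(\Lambda_\Omega(J))}$, where the closure is taken in $\mathbb{T}^{k\times k}$.
   Context: $\Lambda=M\mathbb{Z}^d\subset\mathbb{R}^d$, $M\in GL_d(\mathbb{R})$, is a full lattice; $I=M([-\frac12,\frac12)^d)$ is its fundamental domain; $H=\{h\in\mathbb{R}^d:\langle h,\lambda\rangle\in\mathbb{Z}\ \text{for all }\lambda\in\Lambda\}$ is its dual lattice. Write $e_a(x)=e^{2\pi i a\cdot x}$ for $a,x\in\mathbb{R}^d$; $|\cdot|$ of a set is Lebesgue measure. A measurable set $\Omega\subset\mathbb{R}^d$ $k$-tiles $\mathbb{R}^d$ by translations of $\Lambda$ (with $k\in\mathbb{N}$, $k\geq 1$) if $\sum_{\lambda\in\Lambda}\chi_\Omega(\omega-\lambda)=k$ for a.e. $\omega\in\mathbb{R}^d$. Then $\Lambda_\omega=\{\lambda\in\Lambda:\lambda+\omega\in\Omega\}$ has exactly $k$ elements for a.e. $\omega\in I$; for simplicity it is assumed that this holds for every $\omega\in I$. Listing the elements of $\Lambda_\omega$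 in lexicographic order of $\mathbb{R}^d$ gives the vector $\vec\lambda(\omega)=(\lambda_1(\omega),\dots,\lambda_k(\omega))\in\Lambda^k\subset(\mathbb{R}^d)^k$. For $J\subseteq I$, $\Lambda_\Omega(J)=\{\vec\lambda(\omega):\omega\in J\}$. For $\vec v\in\Lambda^k$, $I_{\vec v}=\{\omega\in I:\vec\lambda(\omega)=\vec v\}$, and $Q=\bigcup\{I_{\vec v}:\vec v\in\Lambda^k,\ |I_{\vec v}|>0\}\subseteq I$; one has $|I\setminus Q|=0$. $\mathbb{T}=\{z\in\mathbb{C}:|z|=1\}$, and $\mathbb{T}^{k\times k}$ is the set of $k\times k$ matrices with entries in $\mathbb{T}$, with the topology inherited from $\mathbb{C}^{k\times k}$. The function $\varphi_{\vec a}:\Lambda^k\to\mathbb{T}^{k\times k}$ is defined by letting the $(m,j)$ entry of $\varphi_{\vec a}(\lambda_1,\dots,\lambda_k)$ be $e^{2\pi i a_j\cdot\lambda_m}$. The system $\{e_{a_j+h}\}_{h\in H,\,1\le j\le k}$ is a Riesz basis of $L^2(\Omega)$ if it is complete in $L^2(\Omega)$ and there are constants $A,B>0$ such that, for all $\{c_{j,h}\}\in\ell^2(\{1,\dots,k\}\times H)$, $A\sum_{j,h}|c_{j,h}|^2\le\|\sum_{j,h}c_{j,h}e_{a_j+h}\|_{L^2(\Omega)}^2\le B\sum_{j,h}|c_{j,h}|^2$. Such a Riesz basis is called structured. *)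

(* Defs.v *)
From HB Require Import structures.
From mathcomp Require Import all_boot all_order all_algebra.
From mathcomp Require Import finmap complex.
From mathcomp Require Import all_classical all_reals all_analysis.

Set Implicit Arguments.
Unset Strict Implicit.
Unset Printing Implicit Defensive.

Import Order.TTheory GRing.Theory Num.Theory.
Import numFieldNormedType.Exports.

Local Open Scope classical_set_scope.
Local Open Scope ring_scope.

(* Lebesgue measure on R^d (column vectors): the Caratheodory measure of the
   outer measure inf { sum_n vol(B_n) | A is covered by the boxes B_n }. A box
   is half-open and given by its two corners; [None] is the empty box, so that
   finite covers are allowed even when d = 0. *)
Section lebesgue_Rd.
Context (R : realType) (d : nat).

Definition box (B : option ('cV[R]_d * 'cV[R]_d)) : set 'cV[R]_d :=
  if B is Some (a, b) then [set x | forall i, a i 0 <= x i 0 < b i 0] else set0.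

Definition box_volume (B : option ('cV[R]_d * 'cV[R]_d)) : R :=
  if B is Some (a, b) then \prod_i Num.max 0 (b i 0 - a i 0) else 0.

Definition lebesgue_outer (A : set 'cV[R]_d) : \bar R :=
  ereal_inf [set (\sum_(n <oo) (box_volume (B n))%:E)%E
            | B in [set B | A `<=` \bigcup_n box (B n)]].

Local Open Scope ereal_scope.

Lemma box_volume_ge0 B : 0 <= (box_volume B)%:E.
Proof.
rewrite lee_fin; case: B => [[a b]|//=].
by apply: prodr_ge0 => i _; rewrite le_max lexx.
Qed.

Lemma lebesgue_outer_ge0 A : 0 <= lebesgue_outer A.
Proof.
apply: le_ereal_inf_tmp => x [B AB <-{x}].
by apply: nneseries_ge0 => n _ _; exact: box_volume_ge0.
Qed.

Lemma lebesgue_outer0 : lebesgue_outer set0 = 0.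
Proof.
apply/eqP; rewrite eq_le lebesgue_outer_ge0 andbT.
apply: ereal_inf_lbound; exists (fun=> None) => //.
by rewrite eseries0.
Qed.

Lemma le_lebesgue_outer : {homo lebesgue_outer : A B / A `<=` B >-> A <= B}.
Proof.
move=> A B AB; apply/ereal_inf_le_tmp => x [C BC <-{x}].
by exists C => //; exact: subset_trans AB BC.
Qed.

Lemma lebesgue_outer_sigma_subadditive : sigma_subadditive lebesgue_outer.
Proof.
move=> A; have [[i ioo]|] := pselect (exists i, lebesgue_outer (A i) = +oo).
  rewrite (eseries_pinfty _ _ ioo) ?leey// => n _.
  by rewrite -ltNye (lt_le_trans _ (lebesgue_outer_ge0 _)).
rewrite -forallNE => Aoo.
suff add2e (e : {posnum R}) : lebesgue_outer (\bigcup_n A n) <=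
    \sum_(i <oo) lebesgue_outer (A i) + e%:num%:E.
  by apply/lee_addgt0Pr => _/posnumP[].
rewrite (le_trans _ (epsilon_trick _ _ _))//; last first.
  by move=> n; exact: lebesgue_outer_ge0.
pose vol B := (box_volume B)%:E.
pose P n (B : nat -> option ('cV[R]_d * 'cV[R]_d)) :=
  A n `<=` \bigcup_m box (B m) /\
  \sum_(k <oo) vol (B k) <= lebesgue_outer (A n) + (e%:num / (2 ^ n.+1)%:R)%:E.
have [G PG] : {G : nat -> nat -> _ & forall n, P n (G n)}.
  apply: (@choice _ _ P) => n; rewrite /P /lebesgue_outer.
  set S := (X in ereal_inf X); move infS : (ereal_inf S) => iS.
  case: iS infS => [r Sr|Soo|Soo].
  - have en1 : (0 < e%:num / (2 ^ n.+1)%:R)%R by [].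
    have /(lb_ereal_inf_adherent en1) : ereal_inf S \is a fin_num by rewrite Sr.
    by move=> [x [B AnB muBx] xS]; exists B; split => //; rewrite muBx -Sr ltW.
  - by have := Aoo n; rewrite /lebesgue_outer Soo.
  - suff : lbound S 0 by move/le_ereal_inf_tmp; rewrite Soo.
    move=> /= _ [B AnB <-].
    by apply: nneseries_ge0 => m _ _; exact: box_volume_ge0.
have volG_ge0 x : 0 <= (vol \o uncurry G) x by exact: box_volume_ge0.
apply: (@le_trans _ _ (\esum_(i in setT) (vol \o uncurry G) i)).
  apply: ereal_inf_lbound => /=.
  have /card_esym/ppcard_eqP[f] := card_nat2.
  exists (uncurry G \o f).
    move=> t [i _ /(PG i).1 [j _ Gij]]; exists (f^-1%FUN (i, j)) => //=.
    by rewrite invK ?inE.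
  rewrite -(esum_pred_image (vol \o uncurry G) _ xpredT) ?[fun=> _]set_true//.
  by rewrite image_eq.
rewrite (_ : esum _ _ = \sum_(i <oo) \sum_(j <oo) vol (G i j)); last first.
  pose J : nat -> set (nat * nat) := fun i => [set (i, j) | j in setT].
  rewrite (_ : setT = \bigcup_k J k); last first.
    by rewrite predeqE => -[a b]; split => // _; exists a => //; exists b.
  rewrite esum_bigcupT /=; last 2 first.
    - apply/trivIsetP => i j _ _ ij.
      rewrite predeqE => -[n m] /=; split => //= -[] [_] _ [<-{n} _].
      by move=> [m' _] [] /esym/eqP; rewrite (negbTE ij).
    - by [].
  rewrite -(image_id [set: nat]) -fun_true esum_pred_image//; last first.
    by move=> n _; apply: esum_ge0 => x _; exact: volG_ge0.
  apply: eq_eseriesr => /= j _.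
  rewrite -(esum_pred_image (vol \o uncurry G) (pair j) predT)//=; last 2 first.
  - by move=> n _; exact: box_volume_ge0.
  - by move=> ? ? _ _; exact: (@can_inj _ _ _ snd).
  by congr esum; rewrite predeqE => -[a b]; split; move=> [i _ <-]; exists i.
apply: lee_nneseries => [i _ _|n _]; last exact: (PG n).2.
by apply: nneseries_ge0 => j _ _; exact: box_volume_ge0.
Qed.

HB.instance Definition _ := isOuterMeasure.Build R _ lebesgue_outer
  lebesgue_outer0 lebesgue_outer_ge0 le_lebesgue_outer
  lebesgue_outer_sigma_subadditive.

Definition Rd := caratheodory_type lebesgue_outer.
HB.instance Definition _ := Measurable.on Rd.

Definition lebesgue : set Rd -> \bar R := lebesgue_outer.
HB.instance Definition _ := isMeasure.Build _ Rd R lebesgue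
  (@caratheodory_measure0 _ _ lebesgue_outer)
  (@caratheodory_measure_ge0 _ _ lebesgue_outer)
  (@caratheodory_measure_sigma_additive _ _ lebesgue_outer).

End lebesgue_Rd.
Arguments lebesgue : clear implicits.

Section lattices.
Context (R : realType) (d : nat).
Implicit Types (M : 'M[R]_d) (L : set 'cV[R]_d).

Definition dotv (x y : 'cV[R]_d) : R := \sum_i x i 0 * y i 0.

Definition lattice M : set 'cV[R]_d :=
  [set M *m map_mx intr z | z in [set: 'cV[int]_d]].

Definition fundamental_domain M : set 'cV[R]_d :=
  [set M *m u | u in [set u : 'cV[R]_d | forall i, - 2^-1 <= u i 0 < 2^-1]].

Definition dual_lattice L : set 'cV[R]_d :=
  [set h | forall l, L l -> dotv h l \is a Num.int].

Definition tiles (k : nat) L (Omega : set (Rd R d)) :=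
  {ae lebesgue R d, forall w : Rd R d,
    (\esum_(l in L) (\1_Omega (w - l : 'cV[R]_d) : R)%:E = k%:R%:E)%E}.

Definition lex_le (x y : 'cV[R]_d) : bool :=
  ([tuple x i 0 | i < d] <= [tuple y i 0 | i < d] :> d.-tuplelexi R)%O.

Definition lattice_slice L (Omega : set 'cV[R]_d) (w : 'cV[R]_d) :=
  [set l | L l /\ Omega (l + w)].

(* The elements of the slice in increasing lexicographic order; meaningful
   when the slice has exactly k elements. *)
Definition slice_vec (k : nat) L Omega w : 'I_k -> 'cV[R]_d :=
  fun j => nth 0 (sort lex_le (fset_set (lattice_slice L Omega w))) j.
Arguments slice_vec : clear implicits.

Definition slice_cell (k : nat) M Omega (v : 'I_k -> 'cV[R]_d) : set (Rd R d) :=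
  [set w | fundamental_domain M w /\ slice_vec k (lattice M) Omega w = v].

(* The set Q: almost all of the fundamental domain. *)
Definition essential_domain (k : nat) M Omega : set (Rd R d) :=
  \bigcup_(v in [set v : 'I_k -> 'cV[R]_d | (forall m, lattice M (v m)) /\
                   (0 < lebesgue R d (slice_cell M Omega v))%E])
    slice_cell M Omega v.

End lattices.
Arguments slice_vec {R d} k L Omega w _.
Arguments essential_domain {R d} k M Omega.

Section exponentials.
Context (R : realType) (d : nat).

Definition expi (t : R) : R[i] := (cos t +i* sin t)%C.

Definition expo (a x : 'cV[R]_d) : R[i] := expi (2 * pi * dotv a x).

Definition exponential_system (k : nat) (H : set 'cV[R]_d)
    (a : 'I_k -> 'cV[R]_d) (p : 'I_k * H) : 'cV[R]_d -> R[i] :=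
  expo (a p.1 + val p.2).

(* The alias R[i]^o carries the topology of the complex norm, and matrices over
   it the entrywise topology; R[i] itself has no topology in the library. *)
Definition phi (k : nat) (a v : 'I_k -> 'cV[R]_d) : 'M[R[i]^o]_k :=
  \matrix_(m, j) expo (a j) (v m).

Definition torus_mx (k : nat) : set 'M[R[i]^o]_k :=
  [set A | forall m j, `|A m j| = 1].

End exponentials.
Arguments torus_mx : clear implicits.

Section riesz_basis.
Context (R : realType) (d : nat) (Omega : set (Rd R d)).
Local Notation normc := ComplexField.Normc.normc.

Definition sqnormL2 (f : Rd R d -> R[i]) : \bar R :=
  (\int[lebesgue R d]_(x in Omega) (normc (f x) ^+ 2)%:E)%E.

Definition inL2 (f : Rd R d -> R[i]) :=
  [/\ measurable_fun Omega (fun x => complex.Re (f x)),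
      measurable_fun Omega (fun x => complex.Im (f x)) &
      (sqnormL2 f < +oo)%E].

Context (I : choiceType) (g : I -> Rd R d -> R[i]).

Definition lincomb (c : I -> R[i]) (F : {fset I}) (x : Rd R d) : R[i] :=
  \sum_(p <- F) c p * g p x.

Definition completeL2 := forall f, inL2 f -> forall e : R, 0 < e ->
  exists (c : I -> R[i]) (F : {fset I}),
    (sqnormL2 (fun x => f x - lincomb c F x)%R < e%:E)%E.

Definition sqnorml2 (c : I -> R[i]) : \bar R :=
  (\esum_(p in [set: I]) (normc (c p) ^+ 2)%:E)%E.

(* f is the unconditional sum in L^2(Omega) of the series with terms c p * g p *)
Definition sumL2 (c : I -> R[i]) (f : Rd R d -> R[i]) :=
  inL2 f /\ forall e : R, 0 < e -> exists F0 : {fset I}, forall F : {fset I},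
    (F0 `<=` F)%fset -> (sqnormL2 (fun x => f x - lincomb c F x)%R < e%:E)%E.

Definition riesz_basis := completeL2 /\
  exists A B : R, [/\ 0 < A, 0 < B &
    forall c : I -> R[i], (sqnorml2 c < +oo)%E -> exists2 f, sumL2 c f &
      (A%:E * sqnorml2 c <= sqnormL2 f <= B%:E * sqnorml2 c)%E].

End riesz_basis.

(* Main.v *)
Require Import Defs.
From HB Require Import structures.
From mathcomp Require Import all_boot all_order all_algebra.
From mathcomp Require Import finmap complex.
From mathcomp Require Import all_classical all_reals all_analysis.
From mathcomp Require Import measurable_realfun perm zify ring lra.

(* For w in the fundamental domain I and a finite sum f of exponentials, the k
   values of f on the slice of Omega over w are Phi(w) D(w) p(w), where Phi(w) is
   the matrix phi_a evaluated at the slice vector, D(w) is a diagonal unitary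
   matrix, and p_j is the trigonometric polynomial with frequencies in H built
   from the coefficients of the e_(a_j + h). Unfolding the integral along the
   slices and Parseval on I reduce (i) to uniform invertibility of Phi(w) for
   almost every w. The entries of Phi(w) have modulus one, so Phi(w)^-1 is
   uniformly bounded as soon as |det Phi(w)| is bounded below, which by compactness
   is (ii). Conversely, if B in the closure has B x = 0 with x != 0, a cell of
   positive measure on which Phi is close to B carries a vector function which
   violates the lower Riesz bound.

   The exponentials with frequencies in H are complete in L^2(I) because the sets
   whose indicators are L^2-limits of trigonometric polynomials form a
   sigma-algebra which contains the boxes. *)

Set Implicit Arguments.
Unset Strict Implicit.
Unset Printing Implicit Defensive.

Import Order.TTheory GRing.Theory Num.Theory.
Import numFieldNormedType.Exports.

Local Open Scope classical_set_scope.
Local Open Scope ring_scope.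

(** There may be infinitely many slice vectors, so determinants that are nonzero at each of them can
    still tend to zero; only the closure sees this. In the other direction, [J] lies in
    [essential_domain], so the matrix of each slice vector over [J] is attained on a set of positive
    measure, and a nearly singular value at one point is felt in L2. Riesz inequalities are handled
    on finite sums. Norms are compared through |z + w|^2 <= 2 |z|^2 + 2 |w|^2, whose factors of 2
    are harmless because only the existence of positive constants is asked. The passage to infinite
    series rests on the completeness of L2(Omega). The measure comes from covers by boxes. Its
    translation invariance replaces integration coordinate by coordinate, both in the unfolding
    along the lattice and in the orthogonality of exponentials, which follows from a shift by half a
    period. *)

Section measure_Rd.
Context (R : realType) (d : nat).
Implicit Types (A : set 'cV[R]_d) (t x : 'cV[R]_d) (i : 'I_d).
Local Notation mu := (lebesgue R d).

Lemma lebesgue_outer_le_series A B : A `<=` \bigcup_n box (B n) ->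
  (lebesgue_outer A <= \sum_(n <oo) (box_volume (B n))%:E)%E.
Proof. by move=> AB; apply: ereal_inf_lbound; exists B. Qed.

Lemma lebesgue_outer_box B :
  (lebesgue_outer (box B : set 'cV[R]_d) <= (box_volume B)%:E)%E.
Proof.
pose C (n : nat) : option ('cV[R]_d * 'cV[R]_d) := if n is 0%N then B else None.
apply: (@le_trans _ _ (\sum_(n <oo) (box_volume (C n))%:E)%E).
  by apply: lebesgue_outer_le_series => x Bx; exists 0%N.
rewrite nneseries_recl//; last by move=> n _; exact: box_volume_ge0.
by rewrite eseries_cond /= eseries0 ?adde0// => -[|n].
Qed.

Lemma lebesgue_outer_approx A (e : R) : 0 < e -> (lebesgue_outer A < +oo)%E ->
  exists2 B, A `<=` \bigcup_n box (B n) &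
    (\sum_(n <oo) (box_volume (B n))%:E <= lebesgue_outer A + e%:E)%E.
Proof.
move=> e0 Aoo.
have Afin : lebesgue_outer A \is a fin_num.
  by rewrite ge0_fin_numE// lebesgue_outer_ge0.
have [x [B AB <-] /ltW h] := lb_ereal_inf_adherent e0 Afin.
by exists B.
Qed.

(** * Translation invariance of Lebesgue measure *)

Lemma lebesgue_outer_shift_le A t :
  (lebesgue_outer [set x | A (x + t)%R] <= lebesgue_outer A)%E.
Proof.
apply: le_ereal_inf_tmp => _ [B AB <-].
pose C n := if B n is Some (a, b) then Some (a - t, b - t) else None.
have -> : (\sum_(n <oo) (box_volume (B n))%:E =
           \sum_(n <oo) (box_volume (C n))%:E)%E.
  apply: eq_eseriesr => n _; rewrite /C; case: (B n) => [[a b]|//] /=.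
  congr EFin; apply: eq_bigr => i _; rewrite !mxE.
  by congr Num.max; ring.
apply: lebesgue_outer_le_series => x /AB [n _ Bn]; exists n => //.
rewrite /C; case: (B n) Bn => [[a b]|//] /= h i.
by move: (h i); rewrite !mxE lerBlDr ltrBrDr.
Qed.

Lemma lebesgue_outer_shift A t :
  lebesgue_outer [set x | A (x + t)] = lebesgue_outer A.
Proof.
apply/eqP; rewrite eq_le lebesgue_outer_shift_le/=.
have := lebesgue_outer_shift_le [set x | A (x + t)] (- t).
by rewrite /=; under eq_set do rewrite subrK.
Qed.

Definition shift_Rd t : Rd R d -> Rd R d := fun x => x + t.

(** The Caratheodory condition for the preimage at a test set [X] is the condition for [A] at a
    translate of [X], since the outer measure is invariant. *)
Lemma measurable_shift_set (A : set (Rd R d)) t :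
  measurable A -> measurable (shift_Rd t @^-1` A).
Proof.
move=> mA; have {}mA : (@lebesgue_outer R d).-caratheodory A by exact: mA.
suff : (@lebesgue_outer R d).-caratheodory (shift_Rd t @^-1` A) by [].
move=> X; rewrite -[LHS](lebesgue_outer_shift X (- t)) mA -(lebesgue_outer_shift _ t).
rewrite -(lebesgue_outer_shift (_ `&` ~` _) t).
have h Y : X `&` (shift_Rd t @^-1` Y) =
    [set x | ([set x | X (x - t)] `&` Y) (x + t)].
  by rewrite predeqE /shift_Rd => x; rewrite /= addrK.
by rewrite -h -h.
Qed.

Lemma measurable_shift t : measurable_fun [set: Rd R d] (shift_Rd t).
Proof. by move=> _ Y mY; rewrite setTI; exact: measurable_shift_set. Qed.

Lemma lebesgue_shift (A : set (Rd R d)) t : mu (shift_Rd t @^-1` A) = mu A.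
Proof. exact: lebesgue_outer_shift. Qed.

Lemma ge0_integral_shift (D : set (Rd R d)) t (f : Rd R d -> \bar R) :
  measurable D -> measurable_fun D f -> (forall x, D x -> (0 <= f x)%E) ->
  (\int[mu]_(x in D) f x = \int[mu]_(x in shift_Rd t @^-1` D) f (x + t)%R)%E.
Proof.
move=> mD mf f0.
have mt := measurable_shift t.
rewrite -(ge0_integral_pushforward mt mu mD mf); last first.
  by move=> x /[!inE]; exact: f0.
apply: eq_measure_integral => A mA _ /=.
exact: esym (lebesgue_shift A t).
Qed.

(** * Measurability of half-spaces, coordinates and boxes *)

Definition cut_above i (c : R) (B : option ('cV[R]_d * 'cV[R]_d)) :=
  if B is Some (a, b) then
    Some (a, \col_j (if j == i then Num.min (b j 0) c else b j 0))
  else None.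

Definition cut_below i (c : R) (B : option ('cV[R]_d * 'cV[R]_d)) :=
  if B is Some (a, b) then
    Some (\col_j (if j == i then Num.max (a j 0) c else a j 0), b)
  else None.

Lemma box_volume_cut i c B :
  box_volume (cut_above i c B) + box_volume (cut_below i c B) = box_volume B.
Proof.
case: B => [[a b]|/=]; last by rewrite addr0.
rewrite /= (bigD1 i)//= [X in _ + X](bigD1 i)//= [RHS](bigD1 i)//= !mxE eqxx.
rewrite (eq_bigr (fun j => Num.max 0 (b j 0 - a j 0))); last first.
  by move=> j ji; rewrite mxE (negbTE ji).
rewrite [X in _ + _ * X](eq_bigr (fun j => Num.max 0 (b j 0 - a j 0))); last first.
  by move=> j ji; rewrite mxE (negbTE ji).
rewrite -mulrDl; congr (_ * _).
(* The truncations at 0 keep the identity true when [c] lies outside the side of the box or the box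
   is empty. *)
by rewrite /Num.max /Num.min; repeat case: ifPn; rewrite -?leNgt => *; lra.
Qed.

(** Cutting each box of a cover of [X] along the hyperplane gives covers of the two parts of [X]
    with the same total volume; the infimum over covers yields the Caratheodory inequality. *)
Lemma measurable_coord_lt i c : measurable [set x : Rd R d | x i 0 < c].
Proof.
apply: le_caratheodory_measurable => X /=.
apply: le_ereal_inf_tmp => _ [B XB <-].
have -> : (\sum_(n <oo) (box_volume (B n))%:E =
  \sum_(n <oo) (box_volume (cut_above i c (B n)))%:E +
  \sum_(n <oo) (box_volume (cut_below i c (B n)))%:E)%E.
  rewrite -nneseriesD; last 2 first.
  - by move=> n _ _; exact: box_volume_ge0.
  - by move=> n _ _; exact: box_volume_ge0.
  by apply: eq_eseriesr => n _; rewrite -EFinD box_volume_cut.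
apply: leeD; apply: lebesgue_outer_le_series => x [/XB[n _ Bn] xc]; exists n => //.
- case: (B n) Bn => [[a b]|//] /= h j; rewrite mxE.
  by case: eqP => [->|_]; rewrite ?lt_min ?xc ?andbT h.
- case: (B n) Bn => [[a b]|//] /= h j; rewrite mxE.
  case: eqP => [->|_]; last exact: h.
  by rewrite ge_max; move/negP: xc; rewrite -leNgt => ->; rewrite andbT h.
Qed.

Lemma measurable_fun_coord i : measurable_fun [set: Rd R d] (fun x => x i 0).
Proof.
apply: (measurability _ (RGenInftyO.measurableE R)) => _ [_ [c ->] <-].
rewrite setTI (_ : _ @^-1` _ = [set x : Rd R d | x i 0 < c]).
  exact: measurable_coord_lt.
by rewrite predeqE => x /=; rewrite in_itv.
Qed.

Lemma measurable_fun_dotv h : measurable_fun [set: Rd R d] (fun x => dotv h x).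
Proof.
apply: measurable_sum => i; apply: measurable_funM.
  exact: measurable_cst.
exact: measurable_fun_coord.
Qed.

Lemma measurable_fun_mulmx_coord (N : 'M[R]_d) i :
  measurable_fun [set: Rd R d] (fun x => (N *m (x : 'cV[R]_d)) i 0).
Proof.
apply: (eq_measurable_fun (fun x : Rd R d => dotv (row i N)^T x)).
  by move=> x _; rewrite /dotv mxE; apply: eq_bigr => j _; rewrite !mxE.
exact: measurable_fun_dotv.
Qed.

Lemma measurable_fun_cos_dotv h :
  measurable_fun [set: Rd R d] (fun x => cos (2 * pi * dotv h x)).
Proof.
apply: measurableT_comp.
  by apply: continuous_measurable_fun; exact: continuous_cos.
by apply: measurable_funM; [exact: measurable_cst|exact: measurable_fun_dotv].
Qed.

Lemma measurable_fun_sin_dotv h :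
  measurable_fun [set: Rd R d] (fun x => sin (2 * pi * dotv h x)).
Proof.
apply: measurableT_comp.
  by apply: continuous_measurable_fun; exact: continuous_sin.
by apply: measurable_funM; [exact: measurable_cst|exact: measurable_fun_dotv].
Qed.

Lemma measurable_box B : measurable (box B : set (Rd R d)).
Proof.
case: B => [[a b]|]; last exact: measurable0.
rewrite (_ : box _ = \big[setI/setT]_(i < d) [set x : Rd R d | a i 0 <= x i 0 < b i 0]).
  apply: bigsetI_measurable => i _.
  rewrite (_ : [set x | _] = setT `&` (fun x : Rd R d => x i 0) @^-1` `[a i 0, b i 0[%classic).
    exact: measurable_fun_coord.
  by rewrite setTI predeqE => x /=; rewrite in_itv.
rewrite predeqE => x; split => [h|h i].
  by rewrite -bigcap_seq => i _; exact: h.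
by move: h; rewrite -bigcap_seq => /(_ i); apply; rewrite /= mem_index_enum.
Qed.

End measure_Rd.

(* Integrating the slices of a cover over the last free coordinate reduces the
   dimension by one. *)
Lemma unit_cube_le_series (R : realType) (d : nat)
    (B : nat -> option ('cV[R]_d * 'cV[R]_d)) :
  [set x : 'cV[R]_d | forall i, 0 <= x i 0 < 1] `<=` \bigcup_n box (B n) ->
  (1 <= \sum_(n <oo) (box_volume (B n))%:E)%E.
Proof.
elim: d B => [|d IH] B cover.
  (* In dimension zero the cube is one point; the box that contains it is not [None], so its volume
     is the empty product 1. *)
  have [|n _ Bn] := cover 0; first by case.
  rewrite (nneseriesD1 (n := n))//; last by move=> m _; exact: box_volume_ge0.
  rewrite -[leLHS]adde0; apply: leeD.
    by case: (B n) Bn => [[a b]|//] _; rewrite /= big_ord0.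
  by apply: nneseries_ge0 => m _ _; exact: box_volume_ge0.
pose tl (a : 'cV[R]_d.+1) : 'cV[R]_d := \col_i a (lift ord0 i) 0.
pose A n : set R := if B n is Some (a, b) then `[a 0 0, b 0 0[%classic else set0.
pose v n : R := if B n is Some (a, b) then box_volume (Some (tl a, tl b)) else 0.
have v0 n : 0 <= v n.
  rewrite /v; case: (B n) => [[a b]|//].
  by have := box_volume_ge0 (Some (tl a, tl b)); rewrite lee_fin.
have mA n : (R.-ocitv.-measurable).-sigma.-measurable (A n) by rewrite /A; case: (B n) => [[a b]|].
(* The boxes whose first side contains [t] cover the slice of the cube at [t], so the induction
   hypothesis bounds the total of their remaining volumes [v n]. *)
have slice (t : R) : 0 <= t < 1 -> (1 <= \sum_(n <oo) ((v n)%:E * (\1_(A n) t)%:E))%E.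
  move=> t01.
  pose C n := if B n is Some (a, b) then
    if a 0 0 <= t < b 0 0 then Some (tl a, tl b) else None else None.
  rewrite (eq_eseriesr (g := fun n => (box_volume (C n))%:E)); last first.
    move=> n _; rewrite -EFinM; congr EFin; rewrite /v /C /A.
    case: (B n) => [[a b]|]; last by rewrite mul0r.
    rewrite indicE mem_setE in_itv /=.
    by case: ifPn => _; rewrite ?mulr1 ?mulr0.
  apply: IH => x x01.
  have [|n _ Bn] := cover (\col_i (if unlift ord0 i is Some j then x j 0 else t)).
    by move=> i; rewrite mxE; case: unliftP => [j _|_].
  exists n => //; rewrite /C; case: (B n) Bn => [[a b]|//] /= h.
  have := h 0; rewrite mxE unlift_none => -> i.
  by have := h (lift ord0 i); rewrite !mxE liftK.
have -> : 1%E = (\int[lebesgue_measure]_(t in `[0%R, 1%R[%classic) (1%:E : \bar R))%E.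
  by rewrite integral_cst//= lebesgue_measure_itv/= lte_fin ltr01 sube0 mul1e.
apply: (@le_trans _ _ (\int[lebesgue_measure]_(t in `[0%R, 1%R[%classic)
   (\sum_(n <oo) ((v n)%:E * (\1_(A n) t)%:E)))%E).
  apply: ge0_le_integral => //.
  apply: ge0_emeasurable_sum => [n t _ _|n _].
    by rewrite -EFinM lee_fin mulr_ge0.
  apply: measurable_funeM; apply/measurable_EFinP.
  exact: measurable_indic.
rewrite integral_nneseries//; last 2 first.
- move=> n; apply: measurable_funeM; apply/measurable_EFinP.
  exact: measurable_indic.
- by move=> n t _; rewrite -EFinM lee_fin mulr_ge0.
apply: lee_nneseries => [n _ _|n _].
  by apply: integral_ge0 => t _; rewrite -EFinM lee_fin mulr_ge0.
rewrite ge0_integralZl//; last 2 first.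
- by apply/measurable_EFinP; exact: measurable_indic.
- by rewrite lee_fin.
rewrite integral_indic//.
apply: (@le_trans _ _ ((v n)%:E * lebesgue_measure (A n))%E).
  by apply: lee_wpmul2l; [rewrite lee_fin|apply: measureIl].
rewrite /v /A; case: (B n) => [[a b]|]; last by rewrite mul0e.
rewrite lebesgue_measure_itv/= lte_fin big_ord_recl mulrC EFinM /tl.
under eq_bigr do rewrite !mxE.
apply: lee_wpmul2l; first by rewrite lee_fin prodr_ge0// => i _; rewrite le_max lexx.
by case: ltP => h; rewrite -?EFinB lee_fin le_max ?lexx ?orbT.
Qed.

(** * Measurability and finite measure of the fundamental domain *)

Section fundamental_domain_measure.
Context (R : realType) (d : nat).
Local Notation mu := (lebesgue R d).

Lemma fundamental_domainE (M : 'M[R]_d) x : M \in unitmx ->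
  fundamental_domain M x <-> forall i, - 2^-1 <= (invmx M *m x) i 0 < 2^-1.
Proof.
move=> uM; split=> [[u hu <-] i|h]; first by rewrite mulKmx.
by exists (invmx M *m x) => //; rewrite mulKVmx.
Qed.

Lemma measurable_fundamental_domain (M : 'M[R]_d) : M \in unitmx ->
  measurable (fundamental_domain M : set (Rd R d)).
Proof.
move=> uM; rewrite (_ : fundamental_domain M = \big[setI/setT]_(i < d)
   [set x : Rd R d | - 2^-1 <= (invmx M *m (x : 'cV[R]_d)) i 0 < 2^-1]).
  apply: bigsetI_measurable => i _.
  rewrite (_ : [set x | _] = setT `&`
    (fun x : Rd R d => (invmx M *m (x : 'cV[R]_d)) i 0) @^-1` `[- 2^-1, 2^-1[%classic).
    exact: measurable_fun_mulmx_coord.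
  by rewrite setTI predeqE => x /=; rewrite in_itv.
rewrite predeqE => x; rewrite fundamental_domainE//; split => [h|h i].
  by rewrite -bigcap_seq => i _; exact: h.
by move: h; rewrite -bigcap_seq => /(_ i); apply; rewrite /= mem_index_enum.
Qed.

Lemma fundamental_domain_lty (M : 'M[R]_d) : (mu (fundamental_domain M) < +oo)%E.
Proof.
(* The coordinates of [u] are at most 1 in modulus, so the row sums of [M] bound the image; the
   extra 1 makes the bound strict, as the half-open box requires. *)
pose b : 'cV[R]_d := \col_i (1 + \sum_j `|M i j|).
apply: (@le_lt_trans _ _ (mu (box (Some (- b, b))))).
  apply: le_lebesgue_outer => _ [u hu <-] i.
  have : `|(M *m u) i 0| < b i 0.
    rewrite mxE; apply: (@le_lt_trans _ _ (\sum_j `|M i j|)).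
      apply: (le_trans (ler_norm_sum _ _ _)); apply: ler_sum => j _.
      rewrite normrM ler_piMr//.
      by have /andP[h1 h2] := hu j; rewrite ler_norml; apply/andP; split; lra.
    by rewrite mxE ltrDr.
  by rewrite ltr_norml => /andP[/ltW h1 h2]; rewrite mxE; apply/andP.
exact: (le_lt_trans (lebesgue_outer_box _)) (ltry _).
Qed.

End fundamental_domain_measure.

(** * Tiling of space by the fundamental domain, and unfolding of integrals *)

Section lattice_tiling.
Context (R : realType) (d : nat) (M : 'M[R]_d) (M_unit : M \in unitmx).
Local Notation mu := (lebesgue R d).
Local Notation unrank := (@pickle_inv ('cV[int]_d : countType)).
Local Notation I0 := (fundamental_domain M : set (Rd R d)).

Definition lattice_point (z : 'cV[int]_d) : 'cV[R]_d := M *m map_mx intr z.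

Lemma lattice_pointP z : lattice M (lattice_point z).
Proof. by exists z. Qed.

Lemma lattice_point_inj : injective lattice_point.
Proof.
move=> z z' /(congr1 (mulmx (invmx M))); rewrite !mulKmx// => /matrixP h.
by apply/matrixP => i j; have := h i j; rewrite !mxE; exact: intr_inj.
Qed.

Lemma lattice_opp l : lattice M l -> lattice M (- l).
Proof. by move=> [z _ <-]; exists (- z) => //; rewrite map_mxN mulmxN. Qed.

Lemma fundamental_domain_translate (x : 'cV[R]_d) :
  exists z, fundamental_domain M (x - lattice_point z).
Proof.
exists (\col_i Num.floor ((invmx M *m x) i 0 + 2^-1)).
rewrite fundamental_domainE// => i; rewrite mulmxBr mulKmx// !mxE.
set u := \sum_ _ _.
have /andP[] := floor_itv (u + 2^-1).
by rewrite intrD => h1 h2; apply/andP; split; lra.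
Qed.

Lemma fundamental_domain_translate_inj (x : 'cV[R]_d) z z' :
  fundamental_domain M (x - lattice_point z) ->
  fundamental_domain M (x - lattice_point z') -> z = z'.
Proof.
rewrite !fundamental_domainE// => h h'; apply/matrixP => i j; rewrite ord1.
move: (h i) (h' i); rewrite !mulmxBr !mulKmx// !mxE.
set u := \sum_ _ _; move=> /andP[h1 h2] /andP[h3 h4].
have : ((z i 0 - z' i 0)%:~R : R) < 1 by rewrite intrB; lra.
have : -1 < ((z i 0 - z' i 0)%:~R : R) by rewrite intrB; lra.
rewrite -[-1]/((-1)%:~R) -[X in _ -> _ < X -> _]/(1%:~R) !ltr_int.
lia.
Qed.

(** The translate of [I0] by the lattice point with code [n]; codes of no integer vector give the
    empty set, so that the [F n] partition the space. *)
Let F (n : nat) : set (Rd R d) :=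
  if unrank n is Some z
  then shift_Rd (- lattice_point z) @^-1` I0 else set0.

Let mF n : measurable (F n).
Proof.
rewrite /F; case: pickle_inv => [z|//]; apply: measurable_shift_set.
exact: measurable_fundamental_domain.
Qed.

Let F_cover : \bigcup_n F n = setT.
Proof.
rewrite predeqE => x; split => // _.
have [z zx] := fundamental_domain_translate x.
by exists (choice.pickle z) => //; rewrite /F pickleK_inv.
Qed.

Let F_triv : trivIset setT F.
Proof.
move=> i j _ _ [x []]; rewrite /F.
case zi : (unrank i) => [z|//]; case zj : (unrank j) => [z'|//] h h'.
have zz' := fundamental_domain_translate_inj h h'; rewrite zz' in zi.
have := @pickle_invK ('cV[int]_d : countType) i; rewrite zi /= => <-.
by have := @pickle_invK ('cV[int]_d : countType) j; rewrite zj.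
Qed.

Lemma esum_lattice (g : 'cV[R]_d -> \bar R) : (forall l, 0 <= g l)%E ->
  (\esum_(l in lattice M) g l =
   \sum_(n <oo) (if unrank n is Some z
                 then g (lattice_point z) else 0))%E.
Proof.
move=> g0.
pose e n := odflt 0 (omap lattice_point (unrank n)).
rewrite (reindex_esum [set n | unrank n] (lattice M) e); last first.
  split.
  - by move=> n /=; rewrite /e; case: pickle_inv => //= z _; exact: lattice_pointP.
  - move=> i j /set_mem + /set_mem; rewrite /= /e.
    case zi : (unrank i) => [z|//]; case zj : (unrank j) => [z'|//] _ _.
    move=> /= /lattice_point_inj zz'; rewrite zz' in zi.
    have := @pickle_invK ('cV[int]_d : countType) i; rewrite zi /= => <-.
    by have := @pickle_invK ('cV[int]_d : countType) j; rewrite zj.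
  - by move=> _ [z _ <-]; exists (choice.pickle z); rewrite /= ?/e pickleK_inv.
rewrite -nneseries_esum; last by move=> n _.
rewrite eseries_mkcond; apply: eq_eseriesr => n _.
by rewrite /e; case: pickle_inv.
Qed.

(** The integral splits over the partition [F]; translation invariance moves each piece back to
    [I0], and nonnegativity allows the exchange of sum and integral. *)
Lemma integral_unfold (f : Rd R d -> \bar R) :
  measurable_fun setT f -> (forall x, 0 <= f x)%E ->
  (\int[mu]_x f x =
   \int[mu]_(w in I0) \esum_(l in lattice M) f ((w : 'cV[R]_d) + l)%R)%E.
Proof.
move=> mf f0.
under [RHS]eq_integral do rewrite esum_lattice//.
rewrite integral_nneseries; last 3 first.
- exact: measurable_fundamental_domain.
- move=> n; case: pickle_inv => [z|]; last exact: measurable_cst.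
  by apply: measurable_funTS; apply: (measurableT_comp mf); exact: measurable_shift.
- by move=> n x _; case: pickle_inv.
rewrite -F_cover ge0_integral_bigcup//; last exact: measurable_funTS.
apply: eq_eseriesr => n _; rewrite /F; case: pickle_inv => [z|]; last first.
  by rewrite integral_set0 integral0.
rewrite (ge0_integral_shift (lattice_point z))//; last 2 first.
- by apply: measurable_shift_set; exact: measurable_fundamental_domain.
- exact: measurable_funTS.
congr (integral _ _ _).
by rewrite predeqE => x /=; rewrite /shift_Rd addrK.
Qed.

(** If [I0] were null, its countably many translates would make the whole space null; but every
    cover of the unit cube by boxes has total volume at least 1. *)
Lemma fundamental_domain_gt0 : (0 < mu I0)%E.
Proof.
rewrite lt0e measure_ge0 andbT; apply/eqP => I00.
pose C : set (Rd R d) := [set x | forall i, 0 <= x i 0 < 1].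
have : (1 <= mu C)%E.
  apply: le_ereal_inf_tmp => _ [B CB <-]; exact: unit_cube_le_series.
rewrite leNgt => /negP; apply; apply: (@le_lt_trans _ _ 0%E); last exact: lte01.
apply: (@le_trans _ _ (mu (\bigcup_n F n))).
  by apply: le_lebesgue_outer => x _; rewrite F_cover.
apply: (le_trans (lebesgue_outer_sigma_subadditive _)).
rewrite eseries0// => n _ _; rewrite /F; case: pickle_inv => [z|]; last exact: lebesgue_outer0.
by rewrite -[LHS]/(mu _) lebesgue_shift.
Qed.

(** The translate [P] of [I0] by [t] also meets every coset of the lattice exactly once. Unfolding
    the integral over [P] onto [I0] therefore leaves a single term for each [w], equal to [f w] by
    periodicity. *)
Lemma integral_periodic_shift (f : Rd R d -> \bar R) t :
  measurable_fun setT f -> (forall x, 0 <= f x)%E ->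
  (forall x l, lattice M l -> f ((x : 'cV[R]_d) + l) = f x) ->
  (\int[mu]_(x in I0) f ((x : 'cV[R]_d) + t)%R = \int[mu]_(x in I0) f x)%E.
Proof.
move=> mf f0 fper.
pose P : set (Rd R d) := shift_Rd (- t) @^-1` I0.
have mP : measurable P.
  by apply: measurable_shift_set; exact: measurable_fundamental_domain.
transitivity (\int[mu]_(x in P) f x)%E.
  rewrite [RHS](ge0_integral_shift t)//; last exact: measurable_funTS.
  congr (integral _ _ _).
  by rewrite predeqE => x /=; rewrite /P /= /shift_Rd addrK.
rewrite integral_mkcond integral_unfold; last 2 first.
- by apply/(measurable_restrictT f mP); exact: measurable_funTS.
- by move=> x; rewrite /patch; case: ifP.
apply: eq_integral => w _.
have [z zw] := fundamental_domain_translate ((w : 'cV[R]_d) - t).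
have key l : lattice M l -> P (w + l) -> l = - lattice_point z.
  move=> [z' _ <-]; rewrite /P /= /shift_Rd => h.
  have -> : - lattice_point z = lattice_point (- z) by rewrite /lattice_point map_mxN mulmxN.
  congr lattice_point; apply/eqP; rewrite -eqr_oppLR; apply/eqP.
  apply: (fundamental_domain_translate_inj (x := w - t)) => //.
  by rewrite /lattice_point map_mxN mulmxN opprK addrAC.
rewrite (eq_esum (b := fun l =>
    if l \in [set - lattice_point z] then f w else 0%E)); last first.
  move=> l Ll; rewrite /patch; case: ifPn => [/[!inE] Pl|Pl].
      by rewrite ifT ?fper//; apply/mem_set; exact: key.
  rewrite ifF//; apply/negbTE; apply: contra Pl; rewrite !inE => ->.
  by rewrite /P /= /shift_Rd addrAC.
rewrite -esum_mkcondr (_ : _ `&` _ = [set - lattice_point z]).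
  by rewrite esum_set1.
rewrite predeqE => l; split=> [[]//|->]; split=> //.
by apply: lattice_opp; exact: lattice_pointP.
Qed.

End lattice_tiling.

(** * Slices of Omega over the fundamental domain, and their cells *)

Section slices.
Context (R : realType) (d k : nat) (M : 'M[R]_d) (M_unit : M \in unitmx).
Context (Omega : set (Rd R d)) (mOmega : measurable Omega).
Hypothesis Omega_slices : forall w, fundamental_domain M w ->
  (lattice_slice (lattice M) Omega w #= `I_k)%card.
Local Notation mu := (lebesgue R d).
Local Notation I0 := (fundamental_domain M : set (Rd R d)).
Local Notation slice := (lattice_slice (lattice M) Omega).
Local Notation svec := (slice_vec k (lattice M) Omega).
Local Notation cell := (@slice_cell R d k M Omega).

Let slice_seq w := sort (@lex_le R d) (fset_set (slice w)).

Lemma slice_finite w : I0 w -> finite_set (slice w).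
Proof. by move=> /Omega_slices h; apply/finite_setP; exists k. Qed.

Lemma size_slice_seq w : I0 w -> size (slice_seq w) = k.
Proof.
by move=> Iw; rewrite size_sort; exact: (card_fset_set (Omega_slices Iw)).
Qed.

Lemma mem_slice_seq w x : I0 w -> (x \in slice_seq w) = (x \in slice w).
Proof. by move=> Iw; rewrite mem_sort in_fset_set//; exact: slice_finite. Qed.

Lemma slice_vecP w m : I0 w -> lattice M (svec w m) /\ Omega (svec w m + w).
Proof.
move=> Iw; have : svec w m \in slice w.
  by rewrite -mem_slice_seq// mem_nth// size_slice_seq.
by rewrite inE.
Qed.

Lemma slice_vec_surj w x : I0 w -> slice w x -> exists m, svec w m = x.
Proof.
move=> Iw xw; have xs : x \in slice_seq w by rewrite mem_slice_seq// inE.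
have ltk : (index x (slice_seq w) < k)%N by rewrite -(size_slice_seq Iw) index_mem.
by exists (Ordinal ltk); rewrite /slice_vec/= nth_index.
Qed.

Lemma esum_slice w (g : 'cV[R]_d -> \bar R) : I0 w -> (forall x, 0 <= g x)%E ->
  (\esum_(l in slice w) g l = \sum_(m < k) g (svec w m))%E.
Proof.
move=> Iw g0; rewrite (esum_fset (slice_finite Iw))//.
rewrite fsbig_finite; last exact: slice_finite.
rewrite (perm_big (slice_seq w))/=; last by rewrite perm_sym perm_sort.
by rewrite (big_nth 0) size_slice_seq// big_mkord.
Qed.

(** After unfolding the extension of [f] by zero, only the lattice points in the slice over [w]
    contribute. *)
Lemma integral_slices (f : Rd R d -> \bar R) : measurable_fun Omega f ->
  (forall x, Omega x -> 0 <= f x)%E ->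
  (\int[mu]_(x in Omega) f x =
   \int[mu]_(w in I0) \sum_(m < k) f ((w : 'cV[R]_d) + svec w m)%R)%E.
Proof.
move=> mf f0.
have fO0 x : (0 <= (f \_ Omega) x)%E.
  by rewrite /patch; case: ifPn => [/set_mem/f0//|].
rewrite integral_mkcond (integral_unfold M_unit)//; last first.
  by apply/(measurable_restrictT f mOmega).
apply: eq_integral => w /set_mem Iw.
transitivity (\esum_(l in slice w) (f \_ Omega) ((w : 'cV[R]_d) + l)%R)%E.
  rewrite (_ : slice w = lattice M `&` [set l | Omega (l + w)])//.
  rewrite esum_mkcondr; apply: eq_esum => l _.
  case: ifPn => // h; rewrite /patch ifF//; apply/negbTE; apply: contra h.
  by rewrite !inE addrC.
rewrite esum_slice//; apply: eq_bigr => m _; rewrite /patch ifT//.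
by apply/mem_set; rewrite addrC; exact: (slice_vecP m Iw).2.
Qed.

(** A slice has exactly [k] elements, so it has no room for others once it contains the [k] points
    of [v]. Membership in a nonempty cell thus becomes a finite conjunction of conditions on
    [Omega], which makes cells measurable. *)
Lemma slice_cellE v w0 w : cell v w0 ->
  cell v w <-> I0 w /\ forall m, Omega (v m + w).
Proof.
move=> [Iw0 <-{v}]; split=> [[Iw e]|[Iw h]].
  by split=> // m; rewrite -e; exact: (slice_vecP m Iw).2.
split=> //; apply/funext => m; rewrite /slice_vec.
suff -> : fset_set (slice w) = fset_set (slice w0) by [].
apply/esym/eqP; rewrite eqEfcard; apply/andP; split; last first.
  by rewrite (card_fset_set (Omega_slices Iw)) (card_fset_set (Omega_slices Iw0)).
apply/fsubsetP => x; rewrite !in_fset_set; [|exact: slice_finite..].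
move=> /set_mem xw0; apply/mem_set; have [m' <-] := slice_vec_surj Iw0 xw0.
by split; [exact: (slice_vecP m' Iw0).1|exact: h].
Qed.

Lemma measurable_slice_cell v : measurable (cell v).
Proof.
have [->|/set0P[w0 w0v]] := eqVneq (cell v) set0; first exact: measurable0.
rewrite (_ : cell v = I0 `&` \big[setI/setT]_(m < k) (shift_Rd (v m) @^-1` Omega)).
  apply: measurableI; first exact: measurable_fundamental_domain.
  by apply: bigsetI_measurable => m _; exact: measurable_shift_set.
rewrite predeqE => w; rewrite (slice_cellE w w0v).
rewrite -bigcap_seq; split=> -[Iw h]; split=> //.
  by move=> m _ /=; rewrite /shift_Rd addrC.
by move=> m; have := h m; rewrite /= /shift_Rd addrC; apply; rewrite mem_index_enum.
Qed.

(** The lattice is countable, so countably many cells cover [I0] and measurability can be checked on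
    each, where the slice vector is constant. *)
Lemma measurable_fun_slices d' (T : measurableType d') G :
  (forall v, measurable_fun (cell v) (G v : Rd R d -> T)) ->
  measurable_fun I0 (fun w => G (svec w) w).
Proof.
move=> mG.
pose lp (z : {ffun 'I_k -> 'cV[int]_d}) m := lattice_point M (z m).
pose C n := if choice.unpickle n is Some z then cell (lp z) else set0.
have mC n : measurable (C n).
  by rewrite /C; case: choice.unpickle => [z|//]; exact: measurable_slice_cell.
have -> : I0 = \bigcup_n C n.
  rewrite predeqE => w; split=> [Iw|[n _]]; last first.
    by rewrite /C; case: choice.unpickle => [z []|].
  have h m : exists z, svec w m = lattice_point M z.
    by have [[z _ <-] _] := slice_vecP m Iw; exists z.
  have /choice[z hz] := h.
  exists (choice.pickle [ffun m => z m]) => //; rewrite /C choice.pickleK; split=> //.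
  by apply/funext => m; rewrite /lp ffunE.
apply: (measurable_fun_bigcup _ mC).2 => n.
rewrite /C; case: choice.unpickle => [z|]; last exact: measurable_fun_set0.
apply: (eq_measurable_fun (G (lp z))); last exact: mG.
by move=> w /set_mem [_ ->].
Qed.

End slices.

(** * Complex moduli, exponentials and the dual lattice *)

Section complex_norm.
Context (R : realType).
Implicit Types z w : R[i].
Local Notation Re := complex.Re.
Local Notation Im := complex.Im.
Local Notation normc := ComplexField.Normc.normc.
Local Notation sqn z := (normc z ^+ 2).

Lemma sqnormcE z : sqn z = Re z ^+ 2 + Im z ^+ 2.
Proof. by case: z => a b /=; rewrite sqr_sqrtr// addr_ge0// sqr_ge0. Qed.

Lemma sqnormc_ge0 z : 0 <= sqn z. Proof. exact: sqr_ge0. Qed.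

Lemma sqnormcM z w : sqn (z * w) = sqn z * sqn w.
Proof. by rewrite ComplexField.Normc.normcM exprMn. Qed.

Lemma sqnormcN z : sqn (- z) = sqn z.
Proof. by rewrite normcN. Qed.

Lemma sqnormcJ z : sqn z^*%C = sqn z.
Proof. by rewrite !sqnormcE; case: z => a b /=; rewrite sqrrN. Qed.

Lemma conjcM z w : (z * w)^*%C = z^*%C * w^*%C.
Proof. exact: rmorphM. Qed.

Lemma sqnormc_eq0 z : (sqn z == 0) = (z == 0).
Proof.
rewrite sqrf_eq0; apply/eqP/eqP => [/ComplexField.Normc.eq0_normc//|->].
exact: ComplexField.Normc.normc0.
Qed.

Lemma cReD z w : Re (z + w) = Re z + Re w. Proof. by case: z w => [a b] []. Qed.
Lemma cImD z w : Im (z + w) = Im z + Im w. Proof. by case: z w => [a b] []. Qed.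
Lemma cReN z : Re (- z) = - Re z. Proof. by case: z. Qed.
Lemma cImN z : Im (- z) = - Im z. Proof. by case: z. Qed.
Lemma cReM z w : Re (z * w) = Re z * Re w - Im z * Im w.
Proof. by case: z w => [a b] []. Qed.
Lemma cImM z w : Im (z * w) = Re z * Im w + Im z * Re w.
Proof. by case: z w => [a b] [] c e /=; rewrite [b * c]mulrC. Qed.

Lemma sqnormcD z w : sqn (z + w) = sqn z + sqn w + 2 * Re (z * w^*%C).
Proof.
rewrite !sqnormcE cReD cImD cReM; case: w => c e /=; ring.
Qed.

Lemma sqnormcD_le z w : sqn (z + w) <= 2 * sqn z + 2 * sqn w.
Proof.
rewrite !sqnormcE cReD cImD; set a := Re z; set b := Re w; set c := Im z.
set e := Im w; have := sqr_ge0 (a - b); have := sqr_ge0 (c - e); nra.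
Qed.

Lemma sqnormcB_le z w : sqn (z - w) <= 2 * sqn z + 2 * sqn w.
Proof. by rewrite -(sqnormcN w) sqnormcD_le. Qed.

Lemma sqnormc_sum_le (n : nat) (z : 'I_n -> R[i]) :
  sqn (\sum_i z i) <= n%:R * \sum_i sqn (z i).
Proof.
elim: n z => [|n IH] z.
  by rewrite !big_ord0 mul0r ComplexField.Normc.normc0 expr0n.
rewrite !big_ord_recl.
set S := \sum_i z (lift ord0 i); set T := \sum_i sqn (z (lift ord0 i)).
have h : sqn S <= n%:R * T by exact: IH.
(* The weights below contain the inverse of the number of terms of [S], so an empty [S] is treated
   apart. *)
case: n IH z @S @T h => [|n] IH z S T h.
  by rewrite /S /T !big_ord0 !addr0 mul1r.
rewrite -[n.+2%:R]natr1; set N := n.+1%:R : R.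
have N0 : 0 < N by rewrite ltr0n.
(* weighted AM-GM: |a + S|^2 <= (1 + N) |a|^2 + (1 + 1/N) |S|^2 *)
have key : sqn (z ord0 + S) <= (1 + N) * sqn (z ord0) + (1 + N^-1) * sqn S.
  rewrite !sqnormcE cReD cImD; set a := Re _; set b := Re S; set c := Im _.
  set e := Im S.
  have h1 x y : 2 * (x * y) <= N * x ^+ 2 + N^-1 * y ^+ 2.
    rewrite -subr_ge0 (_ : _ - _ = N^-1 * (N * x - y) ^+ 2); last first.
      by field; rewrite gt_eqF.
    by rewrite mulr_ge0 ?invr_ge0 ?sqr_ge0// ltW.
  move: {h1}(h1 a b) (h1 c e); move: (N^-1) => Ni; nra.
apply: (le_trans key); rewrite (mulrDr (N + 1)) (addrC N); apply: lerD => //.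
rewrite (_ : 1 + N^-1 = (1 + N) / N); last by field; rewrite gt_eqF.
rewrite -mulrA ler_pM2l; last by rewrite addr_gt0.
by rewrite mulrC ler_pdivrMr// mulrC.
Qed.

Lemma expiD (s t : R) : expi (s + t) = expi s * expi t.
Proof.
rewrite /expi cosD sinD; apply/eqP; rewrite eq_complex /=.
by rewrite eqxx/= [sin s * _]mulrC addrC [_ * sin s]mulrC eqxx.
Qed.

Lemma expi0 : expi (0 : R) = 1.
Proof. by rewrite /expi cos0 sin0. Qed.

Lemma expiN (t : R) : expi (- t) = (expi t)^*%C.
Proof. by rewrite /expi cosN sinN. Qed.

Lemma sqnormc_expi (t : R) : sqn (expi t) = 1.
Proof. by rewrite sqnormcE /= cos2Dsin2. Qed.

Lemma expi_int (t : R) : t \is a Num.int -> expi (2 * pi * t) = 1.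
Proof.
have expi_nat (n : nat) : expi (2 * pi * n%:R : R) = 1.
  elim: n => [|n IH]; first by rewrite mulr0 expi0.
  rewrite -natr1 (_ : _ * _ = 2 * pi * n%:R + pi *+ 2); last by ring.
  rewrite expiD IH mul1r.
  by rewrite /expi cos2pi sin2pi.
move=> /intrP[[n|n] ->]; first exact: expi_nat.
by rewrite NegzE rmorphN/= mulrN expiN expi_nat conjc1.
Qed.

Variable d : nat.
Implicit Types (a x : 'cV[R]_d).

Lemma dotvDl a b x : dotv (a + b) x = dotv a x + dotv b x.
Proof. by rewrite -big_split; apply: eq_bigr => i _; rewrite mxE mulrDl. Qed.

Lemma dotvC a x : dotv a x = dotv x a.
Proof. by apply: eq_bigr => i _; rewrite mulrC. Qed.

Lemma dotvDr a x y : dotv a (x + y) = dotv a x + dotv a y.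
Proof. by rewrite ![dotv a _]dotvC dotvDl. Qed.

Lemma dotvNl a x : dotv (- a) x = - dotv a x.
Proof. by rewrite -sumrN; apply: eq_bigr => i _; rewrite mxE mulNr. Qed.

Lemma dotvZr (c : R) a x : dotv a (c *: x) = c * dotv a x.
Proof. by rewrite mulr_sumr; apply: eq_bigr => i _; rewrite mxE mulrCA. Qed.

Lemma dotv_eq0 a : (dotv a a == 0) = (a == 0).
Proof.
apply/idP/eqP => [|->]; last by rewrite /dotv big1// => i _; rewrite mxE mul0r.
rewrite psumr_eq0 => [/allP h|i _]; last by rewrite -expr2 sqr_ge0.
apply/matrixP => i j; rewrite ord1 mxE; apply/eqP.
by have := h i (mem_index_enum i); rewrite -expr2 sqrf_eq0.
Qed.

Lemma expoDl a b x : expo (a + b) x = expo a x * expo b x.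
Proof. by rewrite /expo dotvDl mulrDr expiD. Qed.

Lemma expoDr a x y : expo a (x + y) = expo a x * expo a y.
Proof. by rewrite /expo dotvDr mulrDr expiD. Qed.

Lemma expoN a x : expo (- a) x = (expo a x)^*%C.
Proof. by rewrite /expo dotvNl mulrN expiN. Qed.

Lemma sqnormc_expo a x : sqn (expo a x) = 1.
Proof. exact: sqnormc_expi. Qed.

Lemma expo_dual (L : set 'cV[R]_d) h l : dual_lattice L h -> L l -> expo h l = 1.
Proof. by move=> Lh Ll; apply: expi_int; exact: Lh. Qed.

Lemma dual_latticeD (L : set 'cV[R]_d) h h' :
  dual_lattice L h -> dual_lattice L h' -> dual_lattice L (h + h').
Proof. by move=> Hh Hh' l Ll; rewrite dotvDl rpredD ?Hh ?Hh'. Qed.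

Lemma dual_latticeN (L : set 'cV[R]_d) h :
  dual_lattice L h -> dual_lattice L (- h).
Proof. by move=> Hh l Ll; rewrite dotvNl rpredN Hh. Qed.

Lemma dual_lattice0 (L : set 'cV[R]_d) : dual_lattice L 0.
Proof.
by move=> l _; rewrite /dotv big1 ?rpred0// => i _; rewrite mxE mul0r.
Qed.

Lemma expo0 x : expo 0 x = 1.
Proof.
rewrite /expo (_ : dotv 0 x = 0) ?mulr0 ?expi0//.
by rewrite /dotv big1// => i _; rewrite mxE mul0r.
Qed.

End complex_norm.

(** * Measurable complex functions and squared L2 norms *)

Section complex_measurable.
Context (R : realType) (d : nat).
Local Notation mu := (lebesgue R d).
Local Notation normc := ComplexField.Normc.normc.
Local Notation sqn z := (normc z ^+ 2).
Implicit Types (D : set (Rd R d)) (f g : Rd R d -> R[i]).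

Definition cmeasurable D f :=
  measurable_fun D (fun x => complex.Re (f x)) /\
  measurable_fun D (fun x => complex.Im (f x)).

Lemma eq_cmeasurable D f g : {in D, f =1 g} -> cmeasurable D f -> cmeasurable D g.
Proof.
move=> fg [h1 h2]; split.
  by apply: eq_measurable_fun h1 => x xD; rewrite fg.
by apply: eq_measurable_fun h2 => x xD; rewrite fg.
Qed.

Lemma cmeasurable_cst D (c : R[i]) : cmeasurable D (fun=> c).
Proof. by split; exact: measurable_cst. Qed.

Lemma cmeasurableD D f g : cmeasurable D f -> cmeasurable D g ->
  cmeasurable D (fun x => f x + g x).
Proof.
move=> [f1 f2] [g1 g2]; split.
  by under eq_fun do rewrite cReD; exact: measurable_funD.
by under eq_fun do rewrite cImD; exact: measurable_funD.
Qed.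

Lemma cmeasurableN D f : cmeasurable D f -> cmeasurable D (fun x => - f x).
Proof.
move=> [f1 f2]; split.
  by under eq_fun do rewrite cReN; exact: measurable_funN.
by under eq_fun do rewrite cImN; exact: measurable_funN.
Qed.

Lemma cmeasurableB D f g : cmeasurable D f -> cmeasurable D g ->
  cmeasurable D (fun x => f x - g x).
Proof. by move=> mf mg; exact: (cmeasurableD mf (cmeasurableN mg)). Qed.

Lemma cmeasurableM D f g : cmeasurable D f -> cmeasurable D g ->
  cmeasurable D (fun x => f x * g x).
Proof.
move=> [f1 f2] [g1 g2]; split.
  under eq_fun do rewrite cReM.
  by apply: measurable_funB; exact: measurable_funM.
under eq_fun do rewrite cImM.
by apply: measurable_funD; exact: measurable_funM.
Qed.

Lemma cmeasurable_sum D (T : Type) (s : seq T) (P : pred T) (f : T -> Rd R d -> R[i]) :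
  (forall t, cmeasurable D (f t)) ->
  cmeasurable D (fun x => \sum_(t <- s | P t) f t x).
Proof.
move=> mf; elim: s => [|t s IH].
  by under eq_fun do rewrite big_nil; exact: cmeasurable_cst.
under eq_fun do rewrite big_cons.
by case: (P t); [exact: (cmeasurableD (mf t) IH)|exact: IH].
Qed.

Lemma cmeasurable_expo D a : cmeasurable D (expo a).
Proof.
split; apply: measurable_funTS => /=.
  exact: measurable_fun_cos_dotv.
exact: measurable_fun_sin_dotv.
Qed.

Lemma cmeasurable_real D (f : Rd R d -> R) : measurable_fun D f ->
  cmeasurable D (fun x => (f x)%:C%C).
Proof. by move=> mf; split => //=; exact: measurable_cst. Qed.

Lemma measurable_sqnormc D f : cmeasurable D f ->
  measurable_fun D (fun x => (sqn (f x))%:E).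
Proof.
move=> [f1 f2]; apply/measurable_EFinP.
under eq_fun do rewrite sqnormcE.
by apply: measurable_funD; exact: measurable_funX.
Qed.

Variables (D : set (Rd R d)) (mD : measurable D).

Lemma sqnormL2_ge0 f : (0 <= sqnormL2 D f)%E.
Proof. by apply: integral_ge0 => x _; rewrite lee_fin sqnormc_ge0. Qed.

Lemma eq_sqnormL2 f g : {in D, f =1 g} -> sqnormL2 D f = sqnormL2 D g.
Proof. by move=> fg; apply: eq_integral => x xD; rewrite fg. Qed.

Let sqn_ge0 f x : D x -> (0 <= (sqn (f x))%:E)%E.
Proof. by move=> _; rewrite lee_fin sqnormc_ge0. Qed.

Let sqnZ_ge0 (C : R) f x : 0 <= C -> D x -> (0 <= C%:E * (sqn (f x))%:E)%E.
Proof. by move=> C0 _; rewrite -EFinM lee_fin mulr_ge0// sqnormc_ge0. Qed.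

Let measurable_sqnZ (C : R) f : cmeasurable D f ->
  measurable_fun D (fun x => (C%:E * (sqn (f x))%:E)%E).
Proof. by move=> mf; apply: measurable_funeM; exact: measurable_sqnormc. Qed.

Lemma sqnormL2Z (C : R) f : 0 <= C -> cmeasurable D f ->
  (\int[mu]_(x in D) (C%:E * (sqn (f x))%:E) = C%:E * sqnormL2 D f)%E.
Proof.
by move=> C0 mf; exact: (ge0_integralZl_EFin mu mD (@sqn_ge0 f)
  (measurable_sqnormc mf) C0).
Qed.

Lemma sqnormL2_scale_le (C : R) f g : 0 <= C -> cmeasurable D f -> cmeasurable D g ->
  (forall x, D x -> sqn (f x) <= C * sqn (g x)) ->
  (sqnormL2 D f <= C%:E * sqnormL2 D g)%E.
Proof.
move=> C0 mf mg h; rewrite -sqnormL2Z//.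
apply: (ge0_le_integral mu mD (@sqn_ge0 f) (measurable_sqnormc mf)
  (measurable_sqnZ C mg)).
by move=> x Dx; rewrite -EFinM lee_fin h.
Qed.

Lemma sqnormL2D_le f g : cmeasurable D f -> cmeasurable D g ->
  (sqnormL2 D (fun x => f x + g x)%R <= 2%:E * sqnormL2 D f + 2%:E * sqnormL2 D g)%E.
Proof.
move=> mf mg; rewrite -!sqnormL2Z// -(ge0_integralD mu mD (fun x => sqnZ_ge0 _ (ler0n _ 2))
  (measurable_sqnZ 2 mf) (fun x => sqnZ_ge0 _ (ler0n _ 2)) (measurable_sqnZ 2 mg)).
apply: (ge0_le_integral mu mD (@sqn_ge0 _) (measurable_sqnormc (cmeasurableD mf mg))
  (emeasurable_funD (measurable_sqnZ 2 mf) (measurable_sqnZ 2 mg))).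
by move=> x _; rewrite -!EFinM -EFinD lee_fin sqnormcD_le.
Qed.

Lemma sqnormL2N f : sqnormL2 D (fun x => - f x) = sqnormL2 D f.
Proof. by rewrite /sqnormL2; apply: eq_integral => x _; rewrite sqnormcN. Qed.

Lemma sqnormL2_triangle f g h : cmeasurable D f -> cmeasurable D g -> cmeasurable D h ->
  (sqnormL2 D (fun x => f x - h x)%R <= 2%:E * sqnormL2 D (fun x => f x - g x)%R +
     2%:E * sqnormL2 D (fun x => g x - h x)%R)%E.
Proof.
move=> mf mg mh.
rewrite (@eq_sqnormL2 (fun x => f x - h x) (fun x => (f x - g x) + (g x - h x))).
  exact: (sqnormL2D_le (cmeasurableB mf mg) (cmeasurableB mg mh)).
by move=> x _; rewrite addrA subrK.
Qed.

Lemma sqnormL2_le_triangle f g : cmeasurable D f -> cmeasurable D g ->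
  (sqnormL2 D f <= 2%:E * sqnormL2 D (fun x => f x - g x)%R + 2%:E * sqnormL2 D g)%E.
Proof.
move=> mf mg.
rewrite [leLHS](@eq_sqnormL2 f (fun x => (f x - g x) + g x)).
  exact: (sqnormL2D_le (cmeasurableB mf mg) mg).
by move=> x _; rewrite subrK.
Qed.

Lemma sqnormL2_subC f g :
  sqnormL2 D (fun x => f x - g x) = sqnormL2 D (fun x => g x - f x).
Proof.
rewrite -[RHS]sqnormL2N; apply: eq_sqnormL2 => x _.
by rewrite opprB.
Qed.

End complex_measurable.

(** * Orthogonality of the exponentials on the fundamental domain, and Parseval *)

Section parseval.
Context (R : realType) (d : nat) (M : 'M[R]_d) (M_unit : M \in unitmx).
Local Notation mu := (lebesgue R d).
Local Notation I0 := (fundamental_domain M : set (Rd R d)).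
Local Notation normc := ComplexField.Normc.normc.
Local Notation sqn z := (normc z ^+ 2).
Local Notation Re := complex.Re.

Let mI0 : measurable I0 := measurable_fundamental_domain M_unit.

Let Re_expo (c : R[i]) (h : 'cV[R]_d) (x : Rd R d) := Re (c * expo h x).

Let measurable_Re_expo D c h : measurable_fun D (Re_expo c h).
Proof. exact: (cmeasurableM (cmeasurable_cst D c) (cmeasurable_expo D h)).1. Qed.

Let integrable_Re_expo c h : mu.-integrable I0 (EFin \o Re_expo c h).
Proof.
apply: measurable_bounded_integrable.
- exact: mI0.
- exact: fundamental_domain_lty.
- exact: measurable_Re_expo.
(* The bound uses |t| <= 1 + t^2, which avoids a square root. *)
exists (1 + sqn c); split; first exact: num_real.
move=> r cr x _; apply: le_trans (ltW cr).
have : Re (c * expo h x) ^+ 2 <= sqn c.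
  by rewrite -[leRHS]mulr1 -(sqnormc_expo h x) -sqnormcM sqnormcE lerDl sqr_ge0.
rewrite /Re_expo; set t := Re _ => ht; rewrite ler_norml; apply/andP; split.
  by have := sqr_ge0 (t + 1); nra.
by have := sqr_ge0 (t - 1); nra.
Qed.

(** The vector [t] is half a period: [dotv h t] is 1/2, so translation by [t] changes the sign of
    the integrand. Hence its positive and negative parts are translates of each other and have the
    same finite integral over [I0]. *)
Lemma integral_Re_expo c h : dual_lattice (lattice M) h -> h != 0 ->
  (\int[mu]_(x in I0) (Re (c * expo h x))%:E = 0)%E.
Proof.
move=> Hh h0; pose f x := (Re_expo c h x)%:E.
pose t := (2 * dotv h h)^-1 *: h.
have et : expo h t = -1.
  have hh0 : dotv h h != 0 by rewrite dotv_eq0.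
  rewrite /expo dotvZr (_ : 2 * pi * _ = pi); last by field.
  by rewrite /expi cospi sinpi; apply/eqP; rewrite eq_complex /= oppr0 !eqxx.
have ft x : f (x + t) = (- f x)%E.
  by rewrite /f /Re_expo expoDr et mulrN1 mulrN cReN EFinN.
have fper x l : lattice M l -> f (x + l) = f x.
  by move=> Ll; rewrite /f /Re_expo expoDr (expo_dual Hh Ll) mulr1.
have mf : measurable_fun setT f by apply/measurable_EFinP; exact: measurable_Re_expo.
rewrite -[LHS]/(\int[mu]_(x in I0) f x)%E integralE.
rewrite (eq_integral (fun x : Rd R d => f^\+ ((x : 'cV[R]_d) + t)%R)%E (f^\-)%E); last first.
  by move=> x _; rewrite funeposE funenegE ft.
rewrite integral_periodic_shift//; last 2 first.
- exact: measurable_funepos.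
- by move=> x l Ll; rewrite !funeposE fper.
rewrite subee// ge0_fin_numE; last by apply: integral_ge0 => x _; exact: funepos_ge0.
exact: (integral_funepos_lt_pinfty mI0 (integrable_Re_expo c h)).
Qed.

Let trig (T : Type) (s : seq T) c (h : T -> 'cV[R]_d) (x : Rd R d) : R[i] :=
  \sum_(p <- s) c p * expo (h p) x.

Lemma sqnormL2_trig (T : eqType) (s : seq T) c (h : T -> 'cV[R]_d) :
  uniq (map h s) -> (forall p, p \in s -> dual_lattice (lattice M) (h p)) ->
  sqnormL2 I0 (fun x => \sum_(p <- s) c p * expo (h p) x) =
  (mu I0 * (\sum_(p <- s) sqn (c p))%:E)%E.
Proof.
have mtrig s' : cmeasurable I0 (trig s' c h).
  apply: cmeasurable_sum => p.
  exact: cmeasurableM (cmeasurable_cst _ _) (cmeasurable_expo _ _).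
elim: s => [_ _|p s IH /= /andP[ps us] Hs].
  rewrite big_nil mule0 /sqnormL2; under eq_integral do
    rewrite big_nil ComplexField.Normc.normc0 expr0n/=.
  by rewrite integral0.
have Hs' q : q \in s -> dual_lattice (lattice M) (h q).
  by move=> qs; apply: Hs; rewrite in_cons qs orbT.
have {}IH := IH us Hs'.
(* [g q] is the cross term of the new exponential with the one of [q]. Its frequency is nonzero
   because the frequencies are distinct, so its integral vanishes. *)
pose g q x := Re_expo (2%:R * (c p * (c q)^*%C)) (h p - h q) x.
have E x : sqn (\sum_(q <- p :: s) c q * expo (h q) x) =
    sqn (c p) + sqn (trig s c h x) + \sum_(q <- s) g q x.
  rewrite big_cons sqnormcD sqnormcM sqnormc_expo mulr1; congr (_ + _).
  rewrite (raddf_sum (@conjc R)) /= mulr_sumr.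
  rewrite (big_morph (@complex.Re R) (@cReD R) (erefl _ : Re (0 : R[i]) = 0)) mulr_sumr.
  apply: eq_bigr => q _; rewrite /g /Re_expo expoDl expoN conjcM.
  rewrite (_ : 2%:R * (c p * (c q)^*%C) * _ =
    (2 : R)%:C%C * (c p * expo (h p) x * ((c q)^*%C * (expo (h q) x)^*%C))); last first.
    by rewrite (_ : (2 : R)%:C%C = 2%:R); [ring|rewrite rmorph_nat].
  by rewrite cReM /= mul0r subr0.
rewrite /sqnormL2; under eq_integral do rewrite E EFinD.
have ig q : mu.-integrable I0 (EFin \o g q) by exact: integrable_Re_expo.
have isum : mu.-integrable I0 (fun x => (\sum_(q <- s) g q x)%:E).
  apply: (eq_integrable _ (fun x => \sum_(q <- s) (EFin \o g q) x)%E) => //.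
    by move=> x _ /=; rewrite sumEFin.
  exact: integrable_sum.
have i1 : mu.-integrable I0 (fun x => (sqn (c p) + sqn (trig s c h x))%:E).
  apply/integrableP; split.
    apply/measurable_EFinP; apply: measurable_funD; first exact: measurable_cst.
    by apply/measurable_EFinP; exact: measurable_sqnormc.
  under eq_integral do rewrite gee0_abs ?lee_fin ?addr_ge0 ?sqnormc_ge0// EFinD.
  rewrite ge0_integralD//; last 3 first.
  - by move=> x _; rewrite lee_fin sqnormc_ge0.
  - by move=> x _; rewrite lee_fin sqnormc_ge0.
  - exact: measurable_sqnormc.
  rewrite integral_cst// -[X in (_ + X)%E]/(sqnormL2 I0 (trig s c h)) IH.
  rewrite ltey_eq; apply/orP; left; rewrite fin_numD !fin_numM//.
  - by rewrite ge0_fin_numE// fundamental_domain_lty.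
  - by rewrite ge0_fin_numE// fundamental_domain_lty.
rewrite integralD//.
under eq_integral do rewrite EFinD.
rewrite ge0_integralD//; last 3 first.
- by move=> x _; rewrite lee_fin sqnormc_ge0.
- by move=> x _; rewrite lee_fin sqnormc_ge0.
- exact: measurable_sqnormc.
rewrite integral_cst// -[X in (_ + X + _)%E]/(sqnormL2 I0 (trig s c h)) IH.
rewrite (eq_integral (fun x => \sum_(q <- s) (EFin \o g q) x)%E); last first.
  by move=> x _; rewrite sumEFin.
rewrite integral_sum// [X in (_ + X)%E = _]big1_seq ?adde0.
  have S0 : 0 <= \sum_(q <- s) sqn (c q) by apply: sumr_ge0 => q _; exact: sqnormc_ge0.
  rewrite big_cons EFinD ge0_muleDr ?lee_fin ?sqnormc_ge0//.
  by rewrite [X in (X + _ = _)%E]muleC.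
move=> q /andP[_ qs]; apply: integral_Re_expo.
  apply: dual_latticeD; first exact: Hs (mem_head _ _).
  by apply: dual_latticeN; exact: Hs'.
by rewrite subr_eq0; apply: contra ps => /eqP ->; exact: map_f.
Qed.

End parseval.

(** * Density of trigonometric polynomials in L2 of the fundamental domain *)

Section trigonometric_density.
Context (R : realType) (d : nat) (M : 'M[R]_d) (M_unit : M \in unitmx).
Local Notation mu := (lebesgue R d).
Local Notation I0 := (fundamental_domain M : set (Rd R d)).
Local Notation normc := ComplexField.Normc.normc.
Local Notation sqn z := (normc z ^+ 2).
Implicit Types (f g : Rd R d -> R[i]) (s : seq (R[i] * 'cV[R]_d)).

Let mI0 : measurable I0 := measurable_fundamental_domain M_unit.

(** A list may repeat a frequency, so that addition is concatenation; repetitions are merged only in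
    [trig_sum_lincomb]. *)
Definition trig_sum s (x : Rd R d) : R[i] := \sum_(p <- s) p.1 * expo p.2 x.

Definition dual_freqs s := forall p, p \in s -> dual_lattice (lattice M) p.2.

Lemma cmeasurable_trig_sum D s : cmeasurable D (trig_sum s).
Proof.
apply: cmeasurable_sum => p.
exact: cmeasurableM (cmeasurable_cst _ _) (cmeasurable_expo _ _).
Qed.

Definition trig_approx f := cmeasurable I0 f /\ forall e : R, 0 < e ->
  exists2 s, dual_freqs s & (sqnormL2 I0 (fun x => f x - trig_sum s x)%R < e%:E)%E.

Lemma trig_approx_lim f : cmeasurable I0 f ->
  (forall e : R, 0 < e -> exists2 g, trig_approx g &
     (sqnormL2 I0 (fun x => f x - g x)%R < e%:E)%E) -> trig_approx f.
Proof.
move=> mf h; split=> // e e0.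
have e4 : 0 < e / 4 by rewrite divr_gt0.
have [g [mg ag] fg] := h _ e4; have [s Hs gs] := ag _ e4.
exists s => //.
apply: (le_lt_trans (sqnormL2_triangle mI0 mf mg (cmeasurable_trig_sum I0 s))).
apply: (@lt_le_trans _ _ (2%:E * (e / 4)%:E + 2%:E * (e / 4)%:E)%E).
  by apply: lteD; rewrite lte_pmul2l.
by rewrite -!EFinM -EFinD lee_fin; lra.
Qed.

Lemma eq_trig_approx f g : {in I0, f =1 g} -> trig_approx f -> trig_approx g.
Proof.
move=> fg [mf af]; split; first exact: eq_cmeasurable mf.
move=> e /af[s Hs h]; exists s => //.
by rewrite -(@eq_sqnormL2 _ _ _ (fun x => f x - trig_sum s x))// => x xI; rewrite fg.
Qed.

Lemma trig_approx_trig s : dual_freqs s -> trig_approx (trig_sum s).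
Proof.
move=> Hs; split=> [|e e0]; first exact: cmeasurable_trig_sum.
exists s => //; rewrite /sqnormL2; under eq_integral do
  rewrite subrr ComplexField.Normc.normc0 expr0n/=.
by rewrite integral0 lte_fin.
Qed.

Lemma trig_sum_cat s1 s2 x : trig_sum (s1 ++ s2) x = trig_sum s1 x + trig_sum s2 x.
Proof. by rewrite /trig_sum big_cat. Qed.

Lemma trig_approxD f g : trig_approx f -> trig_approx g ->
  trig_approx (fun x => f x + g x).
Proof.
move=> [mf af] [mg ag]; split=> [|e e0]; first exact: (cmeasurableD mf mg).
have e4 : 0 < e / 4 by rewrite divr_gt0.
have [s1 H1 h1] := af _ e4; have [s2 H2 h2] := ag _ e4.
exists (s1 ++ s2); first by move=> p; rewrite mem_cat => /orP[/H1|/H2].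
rewrite (@eq_sqnormL2 _ _ _ _ (fun x => (f x - trig_sum s1 x) + (g x - trig_sum s2 x))).
  apply: (le_lt_trans (sqnormL2D_le mI0
    (cmeasurableB mf (cmeasurable_trig_sum I0 s1)) (cmeasurableB mg (cmeasurable_trig_sum I0 s2)))).
  apply: (@lt_le_trans _ _ (2%:E * (e / 4)%:E + 2%:E * (e / 4)%:E)%E).
    by apply: lteD; rewrite lte_pmul2l.
  by rewrite -!EFinM -EFinD lee_fin; lra.
by move=> x _; rewrite trig_sum_cat; ring.
Qed.

(** Multiplication by a bounded [h] is continuous in L2, so products with trigonometric polynomials
    are enough. *)
Lemma trig_approx_sqnM f h (C : R) : 0 < C -> cmeasurable I0 h ->
  (forall x, I0 x -> sqn (h x) <= C) ->
  (forall s, dual_freqs s -> trig_approx (fun x => h x * trig_sum s x)) ->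
  trig_approx f -> trig_approx (fun x => h x * f x).
Proof.
move=> C0 mh hC hs [mf af]; apply: trig_approx_lim; first exact: (cmeasurableM mh mf).
move=> e e0; have eC : 0 < e / C by rewrite divr_gt0.
have [s Hs fs] := af _ eC.
exists (fun x => h x * trig_sum s x); first exact: hs.
apply: (@le_lt_trans _ _ (C%:E * sqnormL2 I0 (fun x => f x - trig_sum s x)%R)%E).
  apply: (sqnormL2_scale_le mI0 (ltW C0)).
  - exact: (cmeasurableB (cmeasurableM mh mf) (cmeasurableM mh (cmeasurable_trig_sum _ _))).
  - exact: (cmeasurableB mf (cmeasurable_trig_sum _ _)).
  - by move=> x Ix; rewrite -mulrBr sqnormcM ler_wpM2r ?sqnormc_ge0 ?hC.
apply: (@lt_le_trans _ _ (C%:E * (e / C)%:E)%E); first by rewrite lte_pmul2l.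
by rewrite -EFinM mulrC divfK ?gt_eqF.
Qed.

Lemma trig_approx_mono (c : R[i]) a f : dual_lattice (lattice M) a ->
  trig_approx f -> trig_approx (fun x => c * expo a x * f x).
Proof.
move=> Ha; apply: (@trig_approx_sqnM _ _ (sqn c + 1)).
- by rewrite ltr_wpDl ?sqnormc_ge0.
- exact: cmeasurableM (cmeasurable_cst _ _) (cmeasurable_expo _ _).
- by move=> x _; rewrite sqnormcM sqnormc_expo mulr1 lerDl.
move=> s Hs.
apply: (@eq_trig_approx (trig_sum [seq (c * p.1, a + p.2) | p <- s])).
  move=> x _; rewrite /trig_sum big_map mulr_sumr; apply: eq_bigr => p _ /=.
  by rewrite expoDl; ring.
apply: trig_approx_trig => _ /mapP[p ps ->]; apply: dual_latticeD => //.
exact: Hs.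
Qed.

Lemma trig_approx_cst (c : R[i]) : trig_approx (fun=> c).
Proof.
apply: (@eq_trig_approx (trig_sum [:: (c, 0)])).
  by move=> x _; rewrite /trig_sum big_seq1 /= expo0 mulr1.
by apply: trig_approx_trig => p; rewrite inE => /eqP ->; exact: dual_lattice0.
Qed.

Lemma trig_approxZ (c : R[i]) f : trig_approx f -> trig_approx (fun x => c * f x).
Proof.
move=> /(trig_approx_mono c (dual_lattice0 (L := lattice M))).
by apply: eq_trig_approx => x _; rewrite expo0 mulr1.
Qed.

Lemma trig_approx_sum (T : Type) (r : seq T) (F : T -> Rd R d -> R[i]) :
  (forall t, trig_approx (F t)) -> trig_approx (fun x => \sum_(t <- r) F t x).
Proof.
move=> aF; elim: r => [|t r IH].
  by apply: eq_trig_approx (trig_approx_cst 0) => x _; rewrite big_nil.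
by apply: eq_trig_approx (trig_approxD (aF t) IH) => x _; rewrite big_cons.
Qed.

Lemma trig_approxM f g (C : R) : (forall x, I0 x -> sqn (f x) <= C) ->
  trig_approx f -> trig_approx g -> trig_approx (fun x => f x * g x).
Proof.
move=> fC af; apply: (@trig_approx_sqnM _ _ (`|C| + 1)).
- by rewrite ltr_wpDl.
- exact: af.1.
- by move=> x /fC h; rewrite (le_trans h)// (le_trans (ler_norm _))// lerDl.
move=> s Hs.
(* The guard makes the summand approximable for every pair, also for those outside [s], whose
   frequency need not lie in the dual lattice. *)
apply: (@eq_trig_approx (fun x => \sum_(p <- s)
  (if p \in s then p.1 * expo p.2 x * f x else 0))).
  move=> x _; rewrite /trig_sum mulr_sumr [RHS]big_seq -[LHS]big_mkcond/= big_seq_cond.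
  by apply: eq_big => [p|p _]; rewrite ?andbb// mulrC.
apply: trig_approx_sum => p; case: (boolP (p \in s)) => ps; last exact: trig_approx_cst.
by apply: trig_approx_mono => //; exact: Hs.
Qed.

Definition rtrig_approx (u : Rd R d -> R) := trig_approx (fun x => (u x)%:C%C).

Lemma sqnormc_real (t : R) : sqn (t%:C%C) = t ^+ 2.
Proof. by rewrite sqnormcE /= expr0n addr0. Qed.

Lemma eq_rtrig_approx u v : {in I0, u =1 v} -> rtrig_approx u -> rtrig_approx v.
Proof. by move=> uv; apply: eq_trig_approx => x xI; rewrite uv. Qed.

Lemma rtrig_approx_cst c : rtrig_approx (fun=> c).
Proof. exact: trig_approx_cst. Qed.

Lemma rtrig_approxD u v : rtrig_approx u -> rtrig_approx v ->
  rtrig_approx (fun x => u x + v x).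
Proof.
by move=> au av; apply: eq_trig_approx (trig_approxD au av) => x _; rewrite rmorphD.
Qed.

Lemma rtrig_approxZ c u : rtrig_approx u -> rtrig_approx (fun x => c * u x).
Proof.
by move=> au; apply: eq_trig_approx (trig_approxZ c%:C%C au) => x _; rewrite rmorphM.
Qed.

Lemma rtrig_approxM u v (C : R) : (forall x, I0 x -> u x ^+ 2 <= C) ->
  rtrig_approx u -> rtrig_approx v -> rtrig_approx (fun x => u x * v x).
Proof.
move=> uC au av; apply: eq_trig_approx (trig_approxM _ au av) => [x _|x Ix].
  by rewrite rmorphM.
by rewrite sqnormc_real; exact: uC.
Qed.

Lemma rtrig_approx_sum (T : Type) (r : seq T) (F : T -> Rd R d -> R) :
  (forall t, rtrig_approx (F t)) -> rtrig_approx (fun x => \sum_(t <- r) F t x).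
Proof.
move=> aF; apply: eq_trig_approx (trig_approx_sum r aF) => x _.
by rewrite rmorph_sum.
Qed.

Lemma rtrig_approx_measurable u : rtrig_approx u -> measurable_fun I0 u.
Proof. by move=> [[]]. Qed.

(** Dominated convergence turns pointwise convergence into L2 convergence, with [h] as a bound of
    the squared errors. *)
Lemma rtrig_approx_lim (u : Rd R d -> R) (v : nat -> Rd R d -> R)
    (h : Rd R d -> \bar R) :
  (forall n, rtrig_approx (v n)) -> mu.-integrable I0 h ->
  (forall n x, I0 x -> (((u x - v n x) ^+ 2)%:E <= h x)%E) ->
  (forall x, I0 x -> v n x @[n --> \oo] --> u x) ->
  rtrig_approx u.
Proof.
move=> av ih uvh cv.
have mv n := rtrig_approx_measurable (av n).
have mX : measurable_fun I0 u by exact: (measurable_fun_cvg mv cv).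
apply: trig_approx_lim; first exact: cmeasurable_real.
pose w n x := ((u x - v n x) ^+ 2)%:E.
have mw n : measurable_fun I0 (w n).
  by apply/measurable_EFinP; apply: measurable_funX; exact: (measurable_funB mX (mv n)).
have w0 : {ae mu, forall x, I0 x -> w ^~ x @ \oo --> (cst 0%E x : \bar R)}.
  apply: aeW => x Ix; apply: cvg_EFin; first exact: nearW.
  rewrite -[0]/(fine 0%E) /= -[X in _ --> X](expr0n R 2) -(subrr (u x)) /w /=.
  apply: (@cvg_comp _ _ _ (fun n => u x - v n x) (fun t => t ^+ 2)).
    by apply: cvgB; [exact: cvg_cst|exact: cv].
  exact: exprn_continuous.
have wh : {ae mu, forall x n, I0 x -> (`|w n x| <= h x)%E}.
  by apply: aeW => x n Ix; rewrite gee0_abs ?lee_fin ?sqr_ge0// uvh.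
have [_ _] := dominated_convergence mI0 mw (measurable_cst _) w0 ih wh.
rewrite integral0 => cw e e0.
have [n _ /(_ n (leqnn n)) hn] := cw _ (nbhs_open_ereal_lt (f := fun=> e) e0).
exists (fun x => (v n x)%:C%C); first exact: av.
rewrite /sqnormL2; under eq_integral do rewrite -rmorphB sqnormc_real.
exact: hn.
Qed.

Let integrable_cst (c : R) : mu.-integrable I0 (EFin \o cst c).
Proof.
apply: measurable_bounded_integrable.
- exact: mI0.
- exact: fundamental_domain_lty.
- exact: measurable_cst.
exists `|c|; split; first exact: num_real.
by move=> r cr x _; exact: ltW.
Qed.

Lemma rtrig_approx_lim_itv (u : Rd R d -> R) (v : nat -> Rd R d -> R) :
  (forall n, rtrig_approx (v n)) -> (forall n x, I0 x -> 0 <= v n x <= 1) ->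
  (forall x, I0 x -> 0 <= u x <= 1) ->
  (forall x, I0 x -> v n x @[n --> \oo] --> u x) -> rtrig_approx u.
Proof.
move=> av v01 u01; apply: (rtrig_approx_lim av (integrable_cst 1)) => n x Ix.
rewrite lee_fin /=; have /andP[u0 u1] := u01 _ Ix.
by have /andP[v0 v1] := v01 n _ Ix; nra.
Qed.

(* Iterates of the smoothstep polynomial converge to 0 below 1/2 and to 1 above,
   which turns an approximable function into approximable superlevel sets. *)
Definition smoothstep (t : R) := 3 * t ^+ 2 - 2 * t ^+ 3.

Lemma smoothstep_itv t : 0 <= t <= 1 -> 0 <= smoothstep t <= 1.
Proof.
move=> /andP[t0 t1]; rewrite /smoothstep; apply/andP; split; last first.
  rewrite -subr_ge0 (_ : _ - _ = (1 - t) ^+ 2 * (1 + 2 * t)); [|ring].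
  by rewrite mulr_ge0 ?sqr_ge0//; lra.
rewrite (_ : _ - _ = t ^+ 2 * (3 - 2 * t)); [|ring].
by rewrite mulr_ge0 ?sqr_ge0//; lra.
Qed.

Lemma iter_smoothstep_itv t n : 0 <= t <= 1 -> 0 <= iter n smoothstep t <= 1.
Proof. by move=> t01; elim: n => //= n; exact: smoothstep_itv. Qed.

Lemma iter_smoothstep_lt t : 0 <= t < 2^-1 ->
  iter n smoothstep t @[n --> \oo] --> 0.
Proof.
(* One step multiplies [s] by [s * (3 - 2 * s)], which is at most [r] for [s] in [0, t]; [r] is
   below 1 because 1 - r = (1 - 2t)(1 - t). *)
move=> /andP[t0 t1]; pose r := t * (3 - 2 * t).
have r01 : 0 <= r < 1 by apply/andP; split; rewrite /r; nra.
have h n : 0 <= iter n smoothstep t <= t * r ^+ n /\ iter n smoothstep t <= t.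
  elim: n => [|n [/andP[a0 a1] a2]]; first by rewrite expr0 mulr1 t0 !lexx.
  rewrite iterS; set s := iter n smoothstep t in a0 a1 a2 *.
  have sE : smoothstep s = s * (s * (3 - 2 * s)) by rewrite /smoothstep; ring.
  have sr : s * (3 - 2 * s) <= r by rewrite /r; nra.
  have s0 : 0 <= s * (3 - 2 * s) by nra.
  have /andP[r0 r1] := r01.
  rewrite sE exprSr (mulrA t); split.
    by rewrite mulr_ge0//= ler_pM.
  by rewrite (le_trans _ a2)// ler_piMr// (le_trans sr)// ltW.
apply: (@squeeze_cvgr _ _ _ _ (cst 0) (geometric t r)).
- by apply: nearW => n; have [/andP[-> ->]] := h n.
- exact: cvg_cst.
- by apply: cvg_geometric; rewrite ger0_norm; case/andP: r01.
Qed.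

Definition smoothstep_lim (t : R) : R :=
  if t < 2^-1 then 0 else if t == 2^-1 then 2^-1 else 1.

Lemma iter_smoothstep_cvg t : 0 <= t <= 1 ->
  iter n smoothstep t @[n --> \oo] --> smoothstep_lim t.
Proof.
move=> /andP[t0 t1]; rewrite /smoothstep_lim; case: ltP => [t2|].
  by apply: iter_smoothstep_lt; rewrite t0.
rewrite le_eqVlt eq_sym; case: eqP => [-> _|_ /= t2].
  apply: cvg_near_cst; apply: nearW => n; elim: n => //= n ->.
  by rewrite /smoothstep; field.
(* The smoothstep is symmetric about 1/2, which reduces values above 1/2 to values below it. *)
have E n : iter n smoothstep t = 1 - iter n smoothstep (1 - t).
  elim: n => [|n IH] /=; first by rewrite opprB addrC subrK.
  by rewrite IH; set s := iter _ _ _; rewrite /smoothstep; ring.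
rewrite -[X in _ --> X]subr0 (funext E); apply: cvgB; first exact: cvg_cst.
by apply: iter_smoothstep_lt; apply/andP; split; lra.
Qed.

Lemma rtrig_approx_smoothstep u : (forall x, I0 x -> 0 <= u x <= 1) ->
  rtrig_approx u -> rtrig_approx (fun x => smoothstep (u x)).
Proof.
move=> u01 au; have u1 x : I0 x -> u x ^+ 2 <= 1.
  by move=> /u01/andP[h1 h2]; rewrite expr_le1.
have a2 := rtrig_approxM u1 au au; have a3 := rtrig_approxM u1 au a2.
apply: eq_rtrig_approx (rtrig_approxD (rtrig_approxZ 3 a2) (rtrig_approxZ (- 2) a3)).
by move=> x _; rewrite /smoothstep; ring.
Qed.

Definition trig_set (E : set (Rd R d)) := rtrig_approx \1_E.

Lemma eq_trig_set E F : (forall x, I0 x -> E x <-> F x) -> trig_set E -> trig_set F.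
Proof.
move=> EF; apply: eq_rtrig_approx => x /set_mem/EF EFx.
by rewrite !indicE; congr (nat_of_bool _)%:R; apply/idP/idP => /set_mem/EFx/mem_set.
Qed.

Lemma trig_set_gt_half u : (forall x, I0 x -> 0 <= u x <= 1) ->
  rtrig_approx u -> trig_set [set x | 2^-1 < u x].
Proof.
move=> u01 au.
have aL : rtrig_approx (fun x => smoothstep_lim (u x)).
  apply: (@rtrig_approx_lim_itv _ (fun n x => iter n smoothstep (u x))).
  - elim=> [//|n IH]; apply: rtrig_approx_smoothstep IH => x Ix.
    exact: iter_smoothstep_itv (u01 _ Ix).
  - by move=> n x Ix; exact: iter_smoothstep_itv (u01 _ Ix).
  - by move=> x _; rewrite /smoothstep_lim; case: ifP => _; [|case: ifP => _]; lra.
  - by move=> x Ix; exact: iter_smoothstep_cvg (u01 _ Ix).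
have L1 x : I0 x -> smoothstep_lim (u x) ^+ 2 <= 1.
  by move=> _; rewrite /smoothstep_lim; case: ifP => _; [|case: ifP => _]; nra.
(* The polynomial 2 L^2 - L sends the limit values 0, 1/2, 1 to 0, 0, 1, so the level 1/2 itself is
   excluded. *)
apply: eq_rtrig_approx
  (rtrig_approxD (rtrig_approxZ 2 (rtrig_approxM L1 aL aL)) (rtrig_approxZ (- 1) aL)).
move=> x _; rewrite indicE (_ : (x \in _) = (2^-1 < u x)); last first.
  by apply/idP/idP => [/set_mem//|h]; exact/mem_set.
rewrite /smoothstep_lim.
by case: (ltgtP (u x) 2^-1) => _ /=; field.
Qed.

Lemma trig_setC E : trig_set E -> trig_set (~` E).
Proof.
move=> aE; apply: eq_rtrig_approx
  (rtrig_approxD (rtrig_approx_cst 1) (rtrig_approxZ (- 1) aE)) => x _.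
by rewrite indicC indicE; case: (x \in E); rewrite /=; ring.
Qed.

Lemma trig_setI E F : trig_set E -> trig_set F -> trig_set (E `&` F).
Proof.
move=> aE aF; have E1 (x : Rd R d) : I0 x -> (\1_E x : R) ^+ 2 <= 1.
  by move=> _; rewrite indicE; case: (x \in E); rewrite /= ?expr0n ?expr1n.
by apply: eq_rtrig_approx (rtrig_approxM E1 aE aF) => x _; rewrite indicI.
Qed.

Lemma trig_setU E F : trig_set E -> trig_set F -> trig_set (E `|` F).
Proof.
move=> aE aF; rewrite -[_ `|` _]setCK setCU.
exact: (trig_setC (trig_setI (trig_setC aE) (trig_setC aF))).
Qed.

Lemma trig_set0 : trig_set set0.
Proof. by rewrite /trig_set indic0; exact: rtrig_approx_cst. Qed.

Lemma trig_set_bigcup (E : nat -> set (Rd R d)) : (forall n, trig_set (E n)) ->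
  trig_set (\bigcup_n E n).
Proof.
move=> aE.
have ind01 (A : set (Rd R d)) x : 0 <= (\1_A x : R) <= 1.
  by rewrite indicE; case: (x \in A); rewrite /= ?lexx ?ler01.
apply: (@rtrig_approx_lim_itv _ (fun n => \1_(\big[setU/set0]_(i < n) E i))).
- move=> n; elim: n => [|n IH]; first by rewrite big_ord0; exact: trig_set0.
  by rewrite big_ord_recr; exact: trig_setU.
- by move=> n x _; exact: ind01.
- by move=> x _; exact: ind01.
move=> x _; have [[k _ Ekx]|nE] := pselect ((\bigcup_n E n) x).
  apply: cvg_near_cst; exists k.+1 => // n /= kn.
  have h1 : (\bigcup_n E n) x by exists k.
  have h2 : (\big[setU/set0]_(i < n) E i) x by rewrite -bigcup_mkord; exists k.
  by rewrite !indicE (mem_set h1) (mem_set h2).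
apply: cvg_near_cst; apply: nearW => n; rewrite !indicE !memNset//.
by rewrite -bigcup_mkord => -[k _ Ekx]; apply: nE; exists k.
Qed.

Lemma sigma_algebra_trig_set : sigma_algebra setT trig_set.
Proof.
split; first exact: trig_set0.
- by move=> A aA; rewrite setTD; exact: trig_setC.
- exact: trig_set_bigcup.
Qed.

(** The [u_ i] are the coordinates in the lattice basis; the rows [h_ i] of the inverse matrix form
    the dual basis, hence are admissible frequencies. *)
Let u_ (i : 'I_d) (x : Rd R d) : R := (invmx M *m (x : 'cV[R]_d)) i 0.
Let h_ (i : 'I_d) : 'cV[R]_d := (row i (invmx M))^T.

Let dotv_h i x : dotv (h_ i) x = u_ i x.
Proof. by rewrite /dotv /u_ mxE; apply: eq_bigr => j _; rewrite !mxE. Qed.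

Let dual_h i : dual_lattice (lattice M) (h_ i).
Proof.
by move=> _ [z _ <-]; rewrite dotv_h /u_ mulKmx// mxE; exact: intr_int.
Qed.

Let two_pi_u_itv i x : I0 x -> - pi <= 2 * pi * u_ i x < pi.
Proof.
move=> /(fundamental_domainE _ M_unit)/(_ i)/andP[].
rewrite -/(u_ i x) => h1 h2; have pi0 := pi_gt0 R; apply/andP; split; nra.
Qed.

Lemma rtrig_approx_cos i : rtrig_approx (fun x => cos (2 * pi * u_ i x)).
Proof.
apply: (@eq_trig_approx (trig_sum [:: ((2^-1)%:C%C, h_ i); ((2^-1)%:C%C, - h_ i)])).
  move=> x _; rewrite /trig_sum !big_cons big_nil addr0 /= expoN /expo dotv_h /expi.
  by apply/eqP; rewrite eq_complex /=; apply/andP; split; apply/eqP; field.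
apply: trig_approx_trig => p; rewrite !inE => /orP[] /eqP -> //=.
exact: dual_latticeN.
Qed.

Lemma rtrig_approx_sin i : rtrig_approx (fun x => sin (2 * pi * u_ i x)).
Proof.
apply: (@eq_trig_approx (trig_sum [:: ((0 -i* (2^-1))%C, h_ i); ((0 +i* (2^-1))%C, - h_ i)])).
  move=> x _; rewrite /trig_sum !big_cons big_nil addr0 /= expoN /expo dotv_h /expi.
  by apply/eqP; rewrite eq_complex /=; apply/andP; split; apply/eqP; field.
apply: trig_approx_trig => p; rewrite !inE => /orP[] /eqP -> //=.
exact: dual_latticeN.
Qed.

Let trig_setT : trig_set setT.
Proof. by have := trig_setC trig_set0; rewrite setC0. Qed.

Lemma trig_set_gt (u : Rd R d -> R) c : (forall x, I0 x -> -1 <= u x <= 1) ->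
  rtrig_approx u -> trig_set [set x | c < u x].
Proof.
move=> u1 au; have [c1|c1] := ltP c (-1).
  apply: eq_trig_set trig_setT => x /u1/andP[h1 h2]; split=> // _ /=.
  exact: lt_le_trans c1 h1.
have [c2|c2] := ltP 1 c.
  apply: eq_trig_set trig_set0 => x /u1/andP[h1 h2]; split=> //= cu.
  by have := lt_trans c2 (lt_le_trans cu h2); rewrite ltxx.
(* This affine map brings the threshold [c] to 1/2 and, as [u] and [c] both lie in [-1, 1], takes
   values in [0, 1]. *)
apply: (@eq_trig_set [set x | 2^-1 < 4^-1 * u x + (2^-1 - 4^-1 * c)]).
  by move=> x _ /=; split=> h; lra.
apply: trig_set_gt_half.
  by move=> x /u1/andP[h1 h2]; apply/andP; split; lra.
by apply: rtrig_approxD; [exact: rtrig_approxZ|exact: rtrig_approx_cst].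
Qed.

(** Taking the approximable sets as the measurable sets of a space lets sums, products and
    compositions of measurable functions do the closure arguments. *)
Let Sp := g_sigma_algebraType trig_set.

Let measurable_Sp (u : Rd R d -> R) :
  (forall x, -1 <= u x <= 1) -> rtrig_approx u ->
  measurable_fun [set: Sp] (u : Sp -> R).
Proof.
move=> u1 au; apply: (measurability _ (RGenOInfty.measurableE R)) => _ [_ [c ->] <-].
apply: sub_sigma_algebra; rewrite setTI.
apply: (@eq_trig_set [set x | c < u x]) (trig_set_gt c (fun x _ => u1 x) au).
by move=> x _; rewrite /= in_itv /= andbT.
Qed.

(** Clipping extends the arc cosine from [-1, 1] to a nonincreasing, hence measurable, function on
    the line. *)
Let clip (t : R) : R := Num.max (-1) (Num.min t 1).

Let clip_itv t : clip t \in `[(-1), 1].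
Proof. by rewrite in_itv/= /clip le_max lexx ge_max ge_min lexx orbT andbT; lra. Qed.

Let acos' t : R := acos (clip t).

Let measurable_acos' : measurable_fun setT acos'.
Proof.
apply: nonincreasing_measurable => // x y xy; rewrite /acos'.
have cxy : clip x <= clip y.
  by rewrite /clip /Num.max /Num.min; repeat case: ifPn; rewrite -?leNgt => *; lra.
rewrite leNgt; apply/negP => h; move: cxy; rewrite leNgt => /negP; apply.
have ci t : acos (clip t) \in `[0, pi].
  by have := clip_itv t; rewrite !in_itv/= => ht; rewrite acos_ge0 ?acos_lepi.
by rewrite -[ltLHS](acosK (clip_itv y)) -[ltRHS](acosK (clip_itv x)) ltr_cos.
Qed.

(* On the fundamental domain, [U_ i] recovers the lattice coordinate [u_ i] from
   its cosine and sine, which are approximable; hence it is measurable for the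
   sigma-algebra of approximable sets. *)
Let U_ (i : 'I_d) (x : Sp) : R :=
  let a := (2 * pi)^-1 * acos' (cos (2 * pi * u_ i x)) in
  if 0 < sin (2 * pi * u_ i x) then a else - a.

Let measurable_U i : measurable_fun [set: Sp] (U_ i).
Proof.
have mc : measurable_fun [set: Sp] (fun x : Sp => cos (2 * pi * u_ i x) : R).
  apply: measurable_Sp (rtrig_approx_cos i) => x.
  by rewrite cos_geN1 cos_le1.
have ms : measurable_fun [set: Sp] (fun x : Sp => sin (2 * pi * u_ i x) : R).
  apply: measurable_Sp (rtrig_approx_sin i) => x.
  by rewrite sin_geN1 sin_le1.
have ma : measurable_fun [set: Sp]
    (fun x : Sp => (2 * pi)^-1 * acos' (cos (2 * pi * u_ i x)) : R).
  apply: measurable_funM; first exact: measurable_cst.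
  exact: (measurableT_comp measurable_acos' mc).
apply: measurable_fun_ifT => //; last exact: measurable_funN.
by apply: measurable_fun_ltr => //; exact: measurable_cst.
Qed.

Let U_E i x : I0 x -> U_ i x = u_ i x.
Proof.
move=> Ix; have /andP[h1 h2] := two_pi_u_itv i Ix; rewrite /U_.
have pi0 : pi != 0 :> R by rewrite gt_eqF// pi_gt0.
have -> : acos' (cos (2 * pi * u_ i x)) = acos (cos (2 * pi * u_ i x)).
  by rewrite /acos' /clip min_l ?cos_le1// max_r// cos_geN1.
(* At [u_ i x] = -1/2 the sine vanishes and the angle is -pi; as [I0] contains this face and not the
   opposite one, a zero sine belongs to the negative branch. *)
case: ifPn => s0.
  rewrite cosK; first by rewrite mulKf// mulf_neq0.
  rewrite in_itv/= (ltW h2) andbT leNgt; apply/negP => u0.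
  move: s0; rewrite ltNge => /negP; apply.
  rewrite -[X in sin X]opprK sinN oppr_le0; apply: sin_ge0_pi.
  by rewrite oppr_ge0 (ltW u0)/= lerNl.
rewrite cosKN; first by rewrite mulrN opprK mulKf// mulf_neq0.
rewrite h1/= leNgt; apply: contra s0 => u0.
by apply: sin_gt0_pi; rewrite u0.
Qed.

(** On [I0] the standard coordinates are linear combinations of the [U_ j], so a box agrees there
    with a measurable set of [Sp]. *)
Lemma trig_set_box B : trig_set (box B).
Proof.
case: B => [[a b]|]; last exact: trig_set0.
pose X i (x : Sp) : R := \sum_j M i j * U_ j x.
have mX i : measurable_fun [set: Sp] (X i).
  apply: measurable_sum => j; apply: measurable_funM; first exact: measurable_cst.
  exact: measurable_U.
pose E : set Sp := \big[setI/setT]_(i < d) (setT `&` X i @^-1` `[a i 0, b i 0[%classic).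
have mE : measurable E.
  by apply: bigsetI_measurable => i _; exact: mX.
have aE : trig_set E.
  by rewrite -(sigma_algebra_id sigma_algebra_trig_set).
apply: eq_trig_set aE => x Ix.
have XE i : X i x = (x : 'cV[R]_d) i 0.
  rewrite /X -[RHS](congr1 (fun y : 'cV[R]_d => y i 0) (mulKVmx M_unit x)) mxE.
  by apply: eq_bigr => j _; rewrite U_E.
rewrite /E -bigcap_seq; split=> [h i|h i _].
  by have := h i (mem_index_enum i); rewrite setTI /= in_itv /= XE.
by rewrite setTI /= in_itv /= XE; exact: h.
Qed.

(** By definition of the outer measure, [E] within [I0] is covered by a countable union of boxes of
    nearly the same measure; the squared L2 distance of the indicators is at most the excess. *)
Lemma trig_set_measurable (E : set (Rd R d)) : measurable E -> trig_set E.
Proof.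
move=> mE; have mEI : measurable (E `&` I0) by exact: measurableI.
apply: (@eq_trig_set (E `&` I0)); first by move=> x Ix; split=> [[]|].
apply: trig_approx_lim => [|e e0].
  by apply: cmeasurable_real; exact: measurable_indic.
have Eoo : (lebesgue_outer (E `&` I0) < +oo)%E.
  by apply: (le_lt_trans _ (fundamental_domain_lty M)); apply: le_lebesgue_outer.
have e2 : 0 < e / 2 by rewrite divr_gt0.
have [B EB Bv] := lebesgue_outer_approx e2 Eoo.
pose G : set (Rd R d) := \bigcup_n box (B n).
have mG : measurable G by apply: bigcupT_measurable => n; exact: measurable_box.
have aG : trig_set G by apply: trig_set_bigcup => n; exact: trig_set_box.
exists (fun x => (\1_G x)%:C%C); first exact: aG.
have Gle : (mu G <= mu (E `&` I0) + (e / 2)%:E)%E.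
  apply: (le_trans _ Bv); apply: (le_trans (lebesgue_outer_sigma_subadditive _)).
  apply: lee_nneseries => n _; first by move=> _; exact: lebesgue_outer_ge0.
  exact: lebesgue_outer_box.
have mGE : measurable (G `\` (E `&` I0)) by exact: measurableD.
apply: (@le_lt_trans _ _ (mu (G `\` (E `&` I0)))).
  rewrite /sqnormL2.
  rewrite (eq_integral (fun x => (\1_(G `\` (E `&` I0)) x)%:E)); last first.
    move=> x /set_mem Ix; rewrite -rmorphB sqnormc_real !indicE; congr EFin.
    case: (boolP (x \in E `&` I0)) => [/set_mem h|h].
      by rewrite (mem_set (EB _ h)) memNset ?subrr ?expr0n// => -[].
    case: (boolP (x \in G)) => [/set_mem Gx|Gx].
      rewrite sub0r sqrrN expr1n mem_set//; split => //.
      by move=> hx; move/negP: h; apply; exact/mem_set.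
    by rewrite subrr expr0n memNset// => -[/mem_set]; rewrite (negbTE Gx).
  rewrite integral_indic//; exact: measureIl.
rewrite measureD//; last by apply: (le_lt_trans Gle); rewrite lte_add_pinfty// ltry.
rewrite (_ : G `&` (E `&` I0) = E `&` I0); last by apply/setIidPr.
have Efin : mu (E `&` I0) \is a fin_num by rewrite ge0_fin_numE.
rewrite lteBlDl//; apply: (le_lt_trans Gle).
by rewrite lteD2lE// lte_fin; lra.
Qed.

Import HBNNSimple.

(** Simple functions increase to [u], and the squared errors are dominated by the integrable
    [u ^ 2]. *)
Lemma rtrig_approx_nonneg (u : Rd R d -> R) : measurable_fun I0 u ->
  (forall x, 0 <= u x) -> (\int[mu]_(x in I0) (u x ^+ 2)%:E < +oo)%E ->
  rtrig_approx u.
Proof.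
move=> mX u0 uoo.
have mEu : measurable_fun I0 (EFin \o u) by exact/measurable_EFinP.
have Eu0 x : I0 x -> (0 <= (EFin \o u) x)%E by move=> _; rewrite /= lee_fin.
pose v := nnsfun_approx mI0 mEu.
have v0 n x : 0 <= v n x by exact: fun_ge0.
have vu n x : I0 x -> v n x <= u x.
  by move=> Ix; rewrite -lee_fin nnsfun_approxE; exact: (le_approx n Eu0 Ix).
apply: (@rtrig_approx_lim u (fun n x => v n x) (fun x => (u x ^+ 2)%:E)).
- move=> n.
  pose r := fset_set (range (v n)).
  apply: (@eq_rtrig_approx (fun x => \sum_(y <- r) y * \1_(v n @^-1` [set y]) x)).
    move=> x _; rewrite [RHS]fimfunE fsbig_finite//.
  apply: rtrig_approx_sum => y; apply: rtrig_approxZ.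
  apply: trig_set_measurable.
  by rewrite -[X in measurable X]setTI; apply: measurable_funP.
- apply/integrableP; split.
    by apply/measurable_EFinP; exact: measurable_funX.
  by under eq_integral do rewrite gee0_abs ?lee_fin ?sqr_ge0//.
- move=> n x Ix; rewrite lee_fin.
  by have := v0 n x; have := vu n x Ix; nra.
move=> x Ix; rewrite -[u x]/(fine ((EFin \o u) x)).
under eq_fun do rewrite /v nnsfun_approxE.
by apply: (cvg_approx Eu0 Ix); rewrite /= ltry.
Qed.

Let sqr_int_lty (u : Rd R d -> R) f : measurable_fun I0 u -> cmeasurable I0 f ->
  (forall x, u x ^+ 2 <= sqn (f x)) -> (sqnormL2 I0 f < +oo)%E ->
  (\int[mu]_(x in I0) (u x ^+ 2)%:E < +oo)%E.
Proof.
move=> mX mf uf; apply: le_lt_trans.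
apply: (ge0_le_integral mu mI0 _ _ (measurable_sqnormc mf)).
- by move=> x _; rewrite lee_fin sqr_ge0.
- by apply/measurable_EFinP; exact: measurable_funX.
- by move=> x _; rewrite lee_fin uf.
Qed.

Lemma trig_approx_inL2 f : inL2 I0 f -> trig_approx f.
Proof.
move=> [mRe mIm foo].
have mf : cmeasurable I0 f by [].
have part (u : Rd R d -> R) : measurable_fun I0 u ->
    (forall x, u x ^+ 2 <= sqn (f x)) -> rtrig_approx u.
  move=> mX uf.
  pose up x := Num.max (u x) 0; pose un x := Num.max (- u x) 0.
  have mup : measurable_fun I0 up.
    by apply: measurable_maxr => //; exact: measurable_cst.
  have mun : measurable_fun I0 un.
    by apply: measurable_maxr; [exact: measurable_funN|exact: measurable_cst].
  have aup : rtrig_approx up.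
    apply: rtrig_approx_nonneg => //.
    - by move=> x; rewrite /up le_max lexx orbT.
    - apply: (sqr_int_lty mup mf _ foo) => x; apply: le_trans (uf x).
      by rewrite /up /Num.max; case: ifP => _; rewrite ?expr0n/= ?sqr_ge0.
  have aun : rtrig_approx un.
    apply: rtrig_approx_nonneg => //.
    - by move=> x; rewrite /un le_max lexx orbT.
    - apply: (sqr_int_lty mun mf _ foo) => x; apply: le_trans (uf x).
      by rewrite /un /Num.max; case: ifP => _; rewrite ?sqrrN ?expr0n/= ?sqr_ge0.
  apply: eq_rtrig_approx (rtrig_approxD aup (rtrig_approxZ (- 1) aun)) => x _.
  by rewrite /up /un; case: (ltP (u x) 0) => ?; case: (ltP (- u x) 0) => ?; lra.
have aRe : rtrig_approx (fun x => complex.Re (f x)).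
  by apply: part => // x; rewrite sqnormcE lerDl sqr_ge0.
have aIm : rtrig_approx (fun x => complex.Im (f x)).
  by apply: part => // x; rewrite sqnormcE lerDr sqr_ge0.
apply: eq_trig_approx (trig_approxD aRe (trig_approxZ 'i%C aIm)) => x _.
by rewrite -complexE.
Qed.

Local Notation H := (dual_lattice (lattice M)).

Lemma trig_sum_lincomb s : dual_freqs s ->
  exists (c : H -> R[i]) (F : {fset H}),
    forall x, trig_sum s x = lincomb (fun h : H => expo (val h)) c F x.
Proof.
elim: s => [_|[z a] s IH Hs].
  exists (fun=> 0), fset0 => x.
  by rewrite /trig_sum /lincomb big_nil big_seq_fset0.
have [|c [F cF]] := IH; first by move=> p ps; apply: Hs; rewrite in_cons ps orbT.
have Ha : H a by exact: (Hs (z, a) (mem_head _ _)).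
pose h0 : H := exist _ a (mem_set Ha).
(* The new coefficient is added to the one already present at [h0]; the guard [h \in F] discards a
   value of [c] at [h0] when [h0] is new. *)
exists (fun h => (if h == h0 then z else 0) + (if h \in F then c h else 0)).
exists (h0 |` F)%fset => x.
rewrite /trig_sum big_cons -/(trig_sum s x) cF /lincomb /=.
under [RHS]eq_bigr do rewrite mulrDl.
rewrite big_split /=; congr (_ + _).
  rewrite (bigD1_seq h0) ?fset_uniq ?fset1U1//= eqxx big1 ?addr0//.
  by move=> h /negbTE ->; rewrite mul0r.
rewrite [RHS](eq_bigr (fun h => if h \in F then c h * expo (val h) x else 0)).
  rewrite -[RHS]big_mkcond -[RHS]big_filter; apply: perm_big; apply: uniq_perm.
  - exact: fset_uniq.
  - by rewrite filter_uniq// fset_uniq.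
  - move=> h; rewrite mem_filter; case: (boolP (h \in F)) => //= hF.
    by rewrite in_fset1U hF orbT.
by move=> h _; case: ifP; rewrite ?mul0r.
Qed.

Theorem trigonometric_complete : completeL2 I0 (fun h : H => expo (val h)).
Proof.
move=> f fL2 e e0; have [mf af] := trig_approx_inL2 fL2.
have [s Hs fs] := af _ e0; have [c [F cF]] := trig_sum_lincomb Hs.
exists c, F; rewrite -(@eq_sqnormL2 _ _ _ (fun x => f x - trig_sum s x))//.
by move=> x _; rewrite cF.
Qed.

End trigonometric_density.

(** * Completeness of L2(Omega) *)

Lemma cvgn_geometric_increments (R : realType) (u : nat -> R) (C : R) :
  (forall n, `|u n.+1 - u n| <= C * 2^-1 ^+ n) -> cvgn u.
Proof.
move=> h.
have C0 : 0 <= C by have := h 0%N; rewrite expr0 mulr1; exact: le_trans.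
suff cs : cvgn (series (telescope u)).
  have -> : u = (fun n => u 0%N + series (telescope u) n).
    by apply/funext => n; exact: eq_sum_telescope.
  by apply: is_cvgD => //; exact: is_cvg_cst.
apply: normed_cvg.
apply: (@series_le_cvg _ _ (geometric C 2^-1)) => [n|n|n|].
- exact: normr_ge0.
- by rewrite /= mulr_ge0// exprn_ge0.
- exact: h.
- by apply: is_cvg_geometric_series; rewrite ger0_norm//; lra.
Qed.

Lemma limn_einf_le (R : realType) (u : nat -> \bar R) (c : \bar R) :
  (forall n, u n <= c)%E -> (limn_einf u <= c)%E.
Proof.
move=> uc; rewrite limn_einf_lim; apply: lime_le; first exact: is_cvg_einfs.
apply: nearW => n; apply: le_trans (uc n).
by apply: ereal_inf_lbound; exists n => //=.
Qed.

Section riesz_fischer.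
Context (R : realType) (d : nat) (Omega : set (Rd R d)) (mOmega : measurable Omega).
Local Notation mu := (lebesgue R d).
Local Notation normc := ComplexField.Normc.normc.
Local Notation sqn z := (normc z ^+ 2).
Local Notation Re := complex.Re.
Local Notation Im := complex.Im.

Lemma riesz_fischer (S : nat -> Rd R d -> R[i]) :
  (forall n, cmeasurable Omega (S n)) ->
  (forall n m, (n <= m)%N ->
     (sqnormL2 Omega (fun x => S m x - S n x)%R <= (16^-1 ^+ n)%:E)%E) ->
  exists2 f, cmeasurable Omega f &
    forall n, (sqnormL2 Omega (fun x => f x - S n x)%R <= (16^-1 ^+ n)%:E)%E.
Proof.
move=> mS hS.
pose D n x := S n.+1 x - S n x.
have mD n : cmeasurable Omega (D n) by exact: cmeasurableB.
(* The squared increments have integral at most 16^-n. The weight 4^n leaves the summable 4^-n, and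
   finiteness of the sum [s x] forces increments at [x] of order 2^-n. *)
pose w n x : \bar R := ((4 ^+ n)%:E * (sqn (D n x))%:E)%E.
have w0 n x : (0 <= w n x)%E by rewrite /w -EFinM lee_fin; apply: mulr_ge0; [exact: exprn_ge0|exact: sqnormc_ge0].
have mw n : measurable_fun Omega (w n).
  by apply: measurable_funeM; exact: measurable_sqnormc.
pose s x := (\sum_(n <oo) w n x)%E.
have ms : measurable_fun Omega s by apply: ge0_emeasurable_sum.
have s0 x : (0 <= s x)%E by apply: nneseries_ge0.
have geo N : \sum_(0 <= n < N) (4^-1 : R) ^+ n <= 2 - 2 * 4^-1 ^+ N.
  elim: N => [|N IH]; first by rewrite big_geq// expr0; lra.
  rewrite big_nat_recr//= exprS; have : 0 <= (4^-1 : R) ^+ N by rewrite exprn_ge0.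
  by lra.
have sint : (\int[mu]_(x in Omega) s x <= 2%:E)%E.
  rewrite integral_nneseries//.
  apply: lime_le; first by apply: is_cvg_nneseries => n _ _; exact: integral_ge0.
  apply: nearW => N.
  apply: (@le_trans _ _ (\sum_(0 <= n < N) ((4^-1 : R) ^+ n)%:E)%E).
    apply: lee_sum => n _; rewrite sqnormL2Z//.
    apply: (@le_trans _ _ ((4 ^+ n)%:E * (16^-1 ^+ n)%:E)%E).
      by apply: lee_wpmul2l; [rewrite lee_fin exprn_ge0|exact: hS].
    by rewrite -EFinM lee_fin -exprMn (_ : 4 * 16^-1 = 4^-1 :> R)//; field.
  rewrite sumEFin lee_fin; apply: (le_trans (geo N)).
  by rewrite lerBlDr lerDl mulr_ge0 ?exprn_ge0.
pose A : set (Rd R d) := Omega `&` [set x | (s x < +oo)%E].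
have mA : measurable A by exact: emeasurable_fun_infty_o.
have aeA : {ae mu, forall x, Omega x -> A x}.
  have is_ : mu.-integrable Omega s.
    apply/integrableP; split=> //.
    under eq_integral do rewrite gee0_abs//.
    exact: (le_lt_trans sint (ltry _)).
  have := integrable_ae mOmega is_; apply: filterS => x h Ox; split=> //=.
  by rewrite -ge0_fin_numE//; exact: h.
(* Setting the functions to zero where [s] is infinite makes them converge at every point, and
   changes them only on a null subset of [Omega]. *)
pose T n x := (\1_A x : R)%:C%C * S n x.
have mT n : cmeasurable Omega (T n).
  by apply: (cmeasurableM _ (mS n)); apply: cmeasurable_real; exact: measurable_indic.
(* [phi] stands for the real or the imaginary part. *)
have cvgT (phi : R[i] -> R) : (forall z w, phi (z - w) = phi z - phi w) ->
    (forall z, phi z ^+ 2 <= sqn z) -> forall x, cvgn (fun n => phi (T n x)).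
  move=> phiB phi2 x.
  have [Ax|nAx] := pselect (A x); last first.
    rewrite (_ : (fun n => _) = cst (phi 0)); first exact: is_cvg_cst.
    by apply/funext => n; rewrite /T indicE memNset// mul0r.
  have TE n : T n x = S n x by rewrite /T indicE mem_set// mul1r.
  have sfin : s x \is a fin_num by rewrite ge0_fin_numE//; exact: Ax.2.
  pose C := fine (s x).
  have C0 : 0 <= C by exact: fine_ge0.
  (* [1 + C] serves as a bound for the square root of [C]. *)
  apply: (@cvgn_geometric_increments _ _ (1 + C)) => n.
  rewrite -phiB !TE -/(D n x).
  have wC : 4 ^+ n * sqn (D n x) <= C.
    rewrite -lee_fin fineK// EFinM -/(w n x) /s (nneseriesD1 (n := n))//.
    by rewrite leeDl//; apply: nneseries_ge0.
  have q0 : 0 < (2^-1 : R) ^+ n by rewrite exprn_gt0.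
  have q4 : 4 ^+ n * (2^-1 ^+ n) ^+ 2 = 1 :> R.
    by rewrite -exprM mulnC exprM -exprMn (_ : 4 * 2^-1 ^+ 2 = 1) ?expr1n//; field.
  have h2 : phi (D n x) ^+ 2 <= C * (2^-1 ^+ n) ^+ 2.
    apply: (le_trans (phi2 _)).
    rewrite -(ler_pM2l (_ : 0 < 4 ^+ n :> R)) ?exprn_gt0//.
    by rewrite [leRHS]mulrCA q4 mulr1.
  rewrite -(@ler_pXn2r _ 2)// ?nnegrE ?mulr_ge0 ?addr_ge0 ?(ltW q0)//.
  rewrite real_normK ?num_real// exprMn (le_trans h2)// ler_wpM2r ?sqr_ge0//.
  nra.
pose f x : R[i] := (limn (fun n => Re (T n x)) +i* limn (fun n => Im (T n x)))%C.
have cRe x : (fun n => Re (T n x)) @ \oo --> Re (f x).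
  apply: (cvgT (@complex.Re R)) => [z v|z]; first by rewrite cReD cReN.
  by rewrite sqnormcE lerDl sqr_ge0.
have cIm x : (fun n => Im (T n x)) @ \oo --> Im (f x).
  apply: (cvgT (@complex.Im R)) => [z v|z]; first by rewrite cImD cImN.
  by rewrite sqnormcE lerDr sqr_ge0.
have mf : cmeasurable Omega f.
  split.
    by apply: (measurable_fun_cvg (fun n => (mT n).1)) => x _; exact: cRe.
  by apply: (measurable_fun_cvg (fun n => (mT n).2)) => x _; exact: cIm.
exists f => // n.
have ST m : {ae mu, forall x, Omega x -> T m x = S m x}.
  by apply: filterS aeA => x h /h Ax; rewrite /T indicE mem_set// mul1r.
(* Fatou's lemma along [m] transfers the bound between [S (n + m)] and [S n] to the limit [f]. *)
have step1 : (sqnormL2 Omega (fun x => f x - S n x)%R <=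
    \int[mu]_(x in Omega) limn_einf (fun m => (sqn (T (n + m)%N x - T n x))%:E))%E.
  have E x : (limn_einf (fun m => (sqn (T (n + m)%N x - T n x))%:E) =
              (sqn (f x - T n x))%:E)%E.
    have sq_cvg (phi : R[i] -> R) : (forall z w, phi (z - w) = phi z - phi w) ->
        (fun m => phi (T m x)) @ \oo --> phi (f x) ->
        (fun m => phi (T (n + m)%N x - T n x) ^+ 2) @ \oo --> phi (f x - T n x) ^+ 2.
      move=> phiB cphi; rewrite phiB.
      rewrite (_ : (fun m => _) =
        (fun m => (phi (T (m + n)%N x) - phi (T n x)) ^+ 2)); last first.
        by apply/funext => m; rewrite phiB addnC.
      have c1 : (fun m => phi (T (m + n)%N x) - phi (T n x)) @ \oo --> phi (f x) - phi (T n x).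
        apply: cvgB; last exact: cvg_cst.
        by rewrite (cvg_shiftn n (fun m => phi (T m x))).
      exact: (cvg_comp _ _ c1 (@exprn_continuous R 2 _)).
    apply: (cvg_limn_einf_sup _).1; apply: cvg_EFin; first exact: nearW.
    rewrite (_ : _ \o _ = (fun m => Re (T (n + m)%N x - T n x) ^+ 2 +
      Im (T (n + m)%N x - T n x) ^+ 2)); last first.
      by apply/funext => m /=; rewrite sqnormcE.
    rewrite sqnormcE; apply: cvgD.
      by apply: (sq_cvg (@complex.Re R)) (cRe x) => z v; rewrite cReD cReN.
    by apply: (sq_cvg (@complex.Im R)) (cIm x) => z v; rewrite cImD cImN.
  under [leRHS]eq_integral do rewrite E.
  apply: (ae_ge0_le_integral mOmega _ (measurable_sqnormc (cmeasurableB mf (mS n)))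
    _ (measurable_sqnormc (cmeasurableB mf (mT n)))).
  - by move=> x _; rewrite lee_fin sqnormc_ge0.
  - by move=> x _; rewrite lee_fin sqnormc_ge0.
  - by apply: filterS (ST n) => x h /h ->.
apply: (le_trans step1).
apply: (le_trans (fatou mu mOmega (fun m => measurable_sqnormc (cmeasurableB (mT _) (mT n))) _)).
  by move=> m x _; rewrite lee_fin sqnormc_ge0.
apply: limn_einf_le => m; apply: le_trans (hS n (n + m)%N (leq_addr _ _)).
apply: (ae_ge0_le_integral mOmega _ (measurable_sqnormc (cmeasurableB (mT _) (mT n)))
    _ (measurable_sqnormc (cmeasurableB (mS _) (mS n)))).
- by move=> x _; rewrite lee_fin sqnormc_ge0.
- by move=> x _; rewrite lee_fin sqnormc_ge0.
- by apply: filterS2 (ST n) (ST (n + m)%N) => x h1 h2 Ox; rewrite h1// h2.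
Qed.

End riesz_fischer.

(** * From bounds on finite sums to a Riesz basis *)

Lemma big_fset_subset (V : nmodType) (I : choiceType) (F G : {fset I}) (f : I -> V) :
  (F `<=` G)%fset ->
  \sum_(p <- G) f p = \sum_(p <- F) f p + \sum_(p <- (G `\` F)%fset) f p.
Proof.
move=> FG; rewrite -big_cat; apply: perm_big; apply: uniq_perm.
- exact: fset_uniq.
- rewrite cat_uniq !fset_uniq /= andbT; apply/hasPn => p.
  by rewrite in_fsetD => /andP[].
move=> p; rewrite mem_cat in_fsetD; case: (boolP (p \in F)) => //= pF.
exact: (fsubsetP FG).
Qed.

Section riesz_bounds.
Context (R : realType) (d : nat) (Omega : set (Rd R d)) (mOmega : measurable Omega).
Context (I : choiceType) (g : I -> Rd R d -> R[i]).
Hypothesis mg : forall p, cmeasurable Omega (g p).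
Local Notation mu := (lebesgue R d).
Local Notation normc := ComplexField.Normc.normc.
Local Notation sqn z := (normc z ^+ 2).
Implicit Types (c : I -> R[i]) (F G : {fset I}).

Lemma cmeasurable_lincomb c F : cmeasurable Omega (lincomb g c F).
Proof. by apply: cmeasurable_sum => p; exact: cmeasurableM (cmeasurable_cst _ _) _. Qed.

Definition fin_sqnorm c F : R := \sum_(p <- F) sqn (c p).

Lemma fin_sqnorm_ge0 c F : 0 <= fin_sqnorm c F.
Proof. by apply: sumr_ge0 => p _; exact: sqnormc_ge0. Qed.

Lemma fin_sqnorm_le c F : ((fin_sqnorm c F)%:E <= sqnorml2 c)%E.
Proof.
apply: esum_ge; exists [set` F]; first by split.
rewrite fsbig_finite; last exact: finite_fset.
by rewrite set_fsetK sumEFin.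
Qed.

Lemma fin_sqnorm_approx c (e : R) : (sqnorml2 c < +oo)%E -> 0 < e ->
  exists F, (sqnorml2 c < (fin_sqnorm c F)%:E + e%:E)%E.
Proof.
move=> coo e0.
have c0 : (0 <= sqnorml2 c)%E.
  by apply: esum_ge0 => p _; rewrite lee_fin sqnormc_ge0.
have cfin : sqnorml2 c \is a fin_num by rewrite ge0_fin_numE.
have [x [A [finA _] <-] h] := ub_ereal_sup_adherent e0 cfin.
exists (fset_set A); rewrite -lteBlDr//; apply: (lt_le_trans h).
by rewrite fsbig_finite//= /fin_sqnorm sumEFin.
Qed.

Hypothesis finite_bounds : exists A B : R, [/\ 0 < A, 0 < B & forall c F,
  ((A * fin_sqnorm c F)%:E <= sqnormL2 Omega (lincomb g c F) <= (B * fin_sqnorm c F)%:E)%E].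

(** The upper bound on finite sums dominates the L2 norm of a tail of the series by the tail of the
    coefficients, so partial sums over growing finite sets are Cauchy. *)
Lemma sumL2_exists c : (sqnorml2 c < +oo)%E -> exists f, sumL2 Omega g c f.
Proof.
move=> coo; have [A [B [A0 B0 AB]]] := finite_bounds.
have tail (e : R) F F1 F2 : (sqnorml2 c < (fin_sqnorm c F)%:E + (e / B)%:E)%E ->
    (F `<=` F1)%fset -> (F1 `<=` F2)%fset ->
    (sqnormL2 Omega (fun x => lincomb g c F2 x - lincomb g c F1 x)%R <= e%:E)%E.
  move=> Fe FF1 F12.
  rewrite (@eq_sqnormL2 _ _ _ _ (lincomb g c (F2 `\` F1)%fset)); last first.
    by move=> x _; rewrite /lincomb (big_fset_subset _ F12) addrC addKr.
  have [_ /andP[_ /le_trans]] := (erefl tt, AB c (F2 `\` F1)%fset); apply.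
  rewrite lee_fin mulrC -ler_pdivlMr//.
  have : ((fin_sqnorm c F)%:E + (fin_sqnorm c (F2 `\` F1)%fset)%:E <=
      (fin_sqnorm c F)%:E + (e / B)%:E)%E.
    apply: (le_trans _ (ltW Fe)); apply: (le_trans _ (fin_sqnorm_le c F2)).
    rewrite -EFinD lee_fin /fin_sqnorm (big_fset_subset _ F12) lerD2r.
    by rewrite (big_fset_subset _ FF1) lerDl; exact: fin_sqnorm_ge0.
  by rewrite -!EFinD lee_fin lerD2l.
have [G hG] : {G : nat -> {fset I} &
    forall n, (sqnorml2 c < (fin_sqnorm c (G n))%:E + (16^-1 ^+ n / B)%:E)%E}.
  apply: (@choice _ _ (fun n G => (sqnorml2 c < (fin_sqnorm c G)%:E + (16^-1 ^+ n / B)%:E)%E)) => n.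
  apply: fin_sqnorm_approx => //.
  by rewrite divr_gt0// exprn_gt0.
(* Unions make the sets increase while each keeps the small tail of [G n]. *)
pose F n := (\bigcup_(i <- iota 0 n.+1) G i)%fset.
have GF n : (G n `<=` F n)%fset.
  apply/fsubsetP => p pn; apply/bigfcupP; exists n => //.
  by rewrite mem_iota /= add0n ltnSn.
have FF n m : (n <= m)%N -> (F n `<=` F m)%fset.
  move=> nm; apply/fsubsetP => p /bigfcupP[i /andP[+ _] pi].
  rewrite mem_iota /= add0n ltnS => ni; apply/bigfcupP; exists i => //.
  by rewrite mem_iota /= add0n ltnS (leq_trans ni).
have [f mf hf] := riesz_fischer mOmega (fun n => cmeasurable_lincomb c (F n))
  (fun n m nm => tail _ _ _ _ (hG n) (GF n) (FF _ _ nm)).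
exists f; split.
  split; [exact: mf.1|exact: mf.2|].
  have := sqnormL2_le_triangle mOmega mf (cmeasurable_lincomb c (F 0%N)).
  move/le_lt_trans; apply.
  apply: (@le_lt_trans _ _ (2%:E * 1%:E + 2%:E * (B * fin_sqnorm c (F 0%N))%:E)%E).
    apply: leeD; (apply: lee_wpmul2l; first by rewrite lee_fin).
      exact: (hf 0%N).
    by have /andP[] := AB c (F 0%N).
  by rewrite -!EFinM -EFinD ltry.
move=> e e0.
(* Comparing with the sum over [F n] costs twice 16^-n on each side, hence the factor 4. *)
have [n ne] : exists n, 4 * 16^-1 ^+ n < e.
  have h : 4 * 16^-1 ^+ n @[n --> \oo] --> (0 : R).
    by apply: (@cvg_geometric R 4 16^-1); rewrite ger0_norm//; lra.
  have /(_ _)[] := cvgr_lt _ h e e0; move=> n _ hn; exists n; exact: hn (leqnn n).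
exists (F n) => F' FF'.
apply: (le_lt_trans (sqnormL2_triangle mOmega mf (cmeasurable_lincomb c (F n))
  (cmeasurable_lincomb c F'))).
rewrite (sqnormL2_subC Omega (lincomb g c (F n))).
apply: (@le_lt_trans _ _ (2%:E * (16^-1 ^+ n)%:E + 2%:E * (16^-1 ^+ n)%:E)%E).
  apply: leeD; (apply: lee_wpmul2l; first by rewrite lee_fin).
    exact: hf.
  exact: tail (hG n) (GF n) FF'.
by rewrite -!EFinM -EFinD lte_fin; lra.
Qed.

(** A finite sum close both to [f] and to the full coefficient norm carries the bounds over; the
    factors of 2 come from the squared triangle inequality. *)
Lemma sumL2_bounds c f (A B : R) : 0 < A -> 0 < B ->
  (forall F, ((A * fin_sqnorm c F)%:E <= sqnormL2 Omega (lincomb g c F)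
     <= (B * fin_sqnorm c F)%:E)%E) ->
  (sqnorml2 c < +oo)%E -> sumL2 Omega g c f ->
  ((A / 2)%:E * sqnorml2 c <= sqnormL2 Omega f <= (2 * B)%:E * sqnorml2 c)%E.
Proof.
move=> A0 B0 AB coo [[mf1 mf2 foo] hf].
have mf : cmeasurable Omega f by [].
have c0 : (0 <= sqnorml2 c)%E.
  by apply: esum_ge0 => p _; rewrite lee_fin sqnormc_ge0.
have cfin : sqnorml2 c \is a fin_num by rewrite ge0_fin_numE.
have ffin : sqnormL2 Omega f \is a fin_num by rewrite ge0_fin_numE// sqnormL2_ge0.
pose n2 := fine (sqnorml2 c); pose m2 := fine (sqnormL2 Omega f).
have key (e : R) : 0 < e -> m2 <= 2 * e + 2 * (B * n2) /\ A * (n2 - e) <= 2 * e + 2 * m2.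
  move=> e0; have [F0 hF0] := hf e e0; have [F1 hF1] := fin_sqnorm_approx coo e0.
  pose F := (F0 `|` F1)%fset.
  have fF : (sqnormL2 Omega (fun x => f x - lincomb g c F x)%R <= e%:E)%E.
    by apply/ltW/hF0; exact: fsubsetUl.
  have mS := cmeasurable_lincomb c F.
  have /andP[lo up] := AB F.
  have Fn2 : fin_sqnorm c F <= n2.
    by rewrite -lee_fin /n2 fineK//; exact: fin_sqnorm_le.
  have n2F : n2 - e <= fin_sqnorm c F.
    rewrite lerBlDr; apply: (@le_trans _ _ (fin_sqnorm c F1 + e)).
      by rewrite -lee_fin EFinD /n2 fineK// ltW.
    rewrite lerD2r /fin_sqnorm (big_fset_subset _ (fsubsetUr F0 F1)) lerDl.
    exact: fin_sqnorm_ge0.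
  split.
    rewrite -lee_fin /m2 fineK//.
    apply: (le_trans (sqnormL2_le_triangle mOmega mf mS)).
    rewrite (EFinD (2 * e)) (EFinM 2 e) (EFinM 2 (B * n2)).
    apply: leeD; (apply: lee_wpmul2l; first by rewrite lee_fin); first exact: fF.
    by apply: (le_trans up); rewrite lee_fin ler_wpM2l// ltW.
  apply: (@le_trans _ _ (A * fin_sqnorm c F)); first by rewrite ler_wpM2l// ltW.
  rewrite -lee_fin; apply: (le_trans lo).
  apply: (le_trans (sqnormL2_le_triangle mOmega mS mf)).
  rewrite (EFinD (2 * e)) (EFinM 2 e) (EFinM 2 m2).
  apply: leeD; (apply: lee_wpmul2l; first by rewrite lee_fin).
    by rewrite sqnormL2_subC.
  by rewrite /m2 fineK.
rewrite -(fineK cfin) -(fineK ffin) -/n2 -/m2 -!EFinM !lee_fin; apply/andP; split.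
  rewrite leNgt; apply/negP => h.
  (* Half of the value at which the second inequality of [key] becomes an equality. *)
  pose e := (A * n2 - 2 * m2) / (2 * (A + 2)).
  have e0 : 0 < e by rewrite divr_gt0; nra.
  have [_] := key e e0.
  have : e * (2 * (A + 2)) = A * n2 - 2 * m2 by rewrite divfK// gt_eqF//; nra.
  nra.
rewrite leNgt; apply/negP => h.
(* The error [2 * e] is then half of the positive gap [m2 - 2 * B * n2]. *)
pose e := (m2 - 2 * B * n2) / 4.
have e0 : 0 < e by rewrite divr_gt0; nra.
have [+ _] := key e e0; rewrite /e; nra.
Qed.

Lemma riesz_basis_of_finite_bounds : completeL2 Omega g -> riesz_basis Omega g.
Proof.
move=> gc; split=> //; have [A [B [A0 B0 AB]]] := finite_bounds.
exists (A / 2), (2 * B); split; [by rewrite divr_gt0|by rewrite mulr_gt0|].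
move=> c coo; have [f hf] := sumL2_exists coo; exists f => //.
exact: (sumL2_bounds A0 B0 (AB c) coo hf).
Qed.

End riesz_bounds.

(** * The closure among matrices with entries of modulus one, entrywise *)

Section torus_closure.
Context (R : realType) (k : nat).
Local Notation normc := ComplexField.Normc.normc.
Implicit Types (A Y : 'M[R[i]^o]_k).

Lemma ltr_normC (z : R[i]) (e : R) : (`|z| < e%:C%C) = (normc z < e).
Proof. by rewrite normc_def ltcR; case: z. Qed.

(** Radii of balls are elements of [R[i]] here; a positive one has zero imaginary part, so real
    radii suffice. *)
Lemma nbhs_mx_complexP A (B : set 'M[R[i]^o]_k) :
  nbhs A B <-> exists2 e : R, 0 < e &
    forall Y, (forall m j, normc (A m j - Y m j) < e) -> B Y.
Proof.
split=> [/nbhs_ballP[e /= e0 eB]|[e e0 eB]].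
  have : e = (complex.Re e)%:C%C.
    by case: e e0 {eB} => a b; rewrite ltcE /= => /andP[/eqP -> _].
  move=> eE; exists (complex.Re e); first by move: e0; rewrite ltcE => /andP[].
  move=> Y h; apply: eB; split=> // m j.
  by rewrite -ball_normE /ball_ /= eE ltr_normC.
apply/nbhs_ballP; exists e%:C%C => /=; first by rewrite ltcR.
move=> Y [_ h]; apply: eB => m j.
by have := h m j; rewrite -ball_normE /ball_ /= ltr_normC.
Qed.

Lemma closure_torus_sub (S : set 'M[R[i]^o]_k) A :
  closure (S : set (subspace (torus_mx R k))) A ->
  forall e : R, 0 < e -> exists2 Y, S Y & forall m j, normc (A m j - Y m j) < e.
Proof.
move=> clA e e0; pose B := [set Y : 'M[R[i]^o]_k | forall m j, normc (A m j - Y m j) < e].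
have BA : B A by move=> m j; rewrite subrr ComplexField.Normc.normc0.
have nB : nbhs (A : subspace (torus_mx R k)) B.
  suff : @nbhs_subspace _ (torus_mx R k) A B by [].
  have [TA|TA] := pselect (torus_mx R k A); last first.
    by rewrite -(nbhs_subspace_out TA) => _ ->.
  rewrite -(nbhs_subspace_in TA).
  have : nbhs A B by apply/nbhs_mx_complexP; exists e.
  by apply: filterS => Y BY _.
by have [Y [SY BY]] := clA _ nB; exists Y.
Qed.

Lemma closure_torus_sup (S : set 'M[R[i]^o]_k) A : torus_mx R k A ->
  (forall e : R, 0 < e -> exists2 Y, S Y & forall m j, normc (A m j - Y m j) < e) ->
  S `<=` torus_mx R k -> closure (S : set (subspace (torus_mx R k))) A.
Proof.
move=> TA h ST B nB; have {nB} : @nbhs_subspace _ (torus_mx R k) A B by [].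
rewrite -(nbhs_subspace_in TA) => /nbhs_mx_complexP[e e0 eB].
have [Y SY AY] := h e e0; exists Y; split=> //.
by apply: eB => //; exact: ST.
Qed.

End torus_closure.

(** * Lipschitz dependence of the determinant on bounded entries *)

Section det_perturbation.
Context (R : realType).
Local Notation normc := ComplexField.Normc.normc.

Lemma normc_ge0 (z : R[i]) : 0 <= normc z.
Proof. by case: z => a b; exact: sqrtr_ge0. Qed.

Lemma normc_prod_le1 (I : Type) (s : seq I) (x : I -> R[i]) :
  (forall i, normc (x i) <= 1) -> normc (\prod_(i <- s) x i) <= 1.
Proof.
move=> h; elim: s => [|i s IH]; first by rewrite big_nil ComplexField.Normc.normc1.
rewrite big_cons ComplexField.Normc.normcM -[leRHS]mulr1.
by apply: ler_pM => //; exact: normc_ge0.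
Qed.

(** Factors are exchanged one at a time, the others being at most 1 in modulus. *)
Lemma normc_prod_sub (I : Type) (s : seq I) (x y : I -> R[i]) (e : R) :
  (forall i, normc (x i) <= 1) -> (forall i, normc (y i) <= 1) ->
  (forall i, normc (x i - y i) <= e) ->
  normc (\prod_(i <- s) x i - \prod_(i <- s) y i) <= (size s)%:R * e.
Proof.
move=> hx hy hxy; elim: s => [|i s IH].
  by rewrite !big_nil subrr ComplexField.Normc.normc0 mul0r.
rewrite !big_cons.
set X := \prod_(j <- s) x j; set Y := \prod_(j <- s) y j.
rewrite (_ : _ - _ = x i * (X - Y) + (x i - y i) * Y); last by ring.
apply: (le_trans (le_normcD _ _)).
rewrite !ComplexField.Normc.normcM /= -natr1 mulrDl mul1r; apply: lerD.
  rewrite -[leRHS]mul1r; apply: ler_pM => //; exact: normc_ge0.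
rewrite -[leRHS]mulr1; apply: ler_pM => //; try exact: normc_ge0.
exact: normc_prod_le1.
Qed.

(** The Leibniz formula has [k!] terms, each a product of [k] factors whose variation is at most
    [k * e]. *)
Lemma normc_det_sub (k : nat) (A B : 'M[R[i]]_k) (e : R) :
  (forall m j, normc (A m j) <= 1) -> (forall m j, normc (B m j) <= 1) ->
  (forall m j, normc (A m j - B m j) <= e) ->
  normc (\det A - \det B) <= (k`! * k)%:R * e.
Proof.
move=> hA hB hAB; rewrite /determinant -sumrB.
have key (s : {perm 'I_k}) : normc ((-1) ^+ s * \prod_i A i (s i) -
    (-1) ^+ s * \prod_i B i (s i)) <= k%:R * e.
  rewrite -mulrBr ComplexField.Normc.normcM.
  rewrite (_ : normc ((-1) ^+ s) = 1) ?mul1r; last first.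
    by case: (odd_perm s); rewrite ?expr0 ?expr1 ?normcN ComplexField.Normc.normc1.
  have := @normc_prod_sub _ (index_enum 'I_k) (fun i => A i (s i)) (fun i => B i (s i)) e.
  rewrite -[size _]/(size (index_enum _)) /index_enum -enumT size_enum_ord; apply=> i.
  - exact: hA.
  - exact: hB.
  - exact: hAB.
have ncs (r : seq {perm 'I_k}) (F : {perm 'I_k} -> R[i]) :
    normc (\sum_(s <- r) F s) <= \sum_(s <- r) normc (F s).
  elim: r => [|s r IH]; first by rewrite !big_nil ComplexField.Normc.normc0.
  by rewrite !big_cons (le_trans (le_normcD _ _))// lerD2l.
apply: (le_trans (ncs _ _)); apply: (@le_trans _ _ (\sum_(s : {perm 'I_k}) k%:R * e)).
  by apply: ler_sum => s _; exact: key.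
by rewrite sumr_const card_Sn -[X in X <= _]mulr_natl mulrA -natrM.
Qed.

End det_perturbation.

(** * Compactness: a uniform lower bound for the determinants *)

Section det_lower_bound.
Context (R : realType) (d k : nat) (a : 'I_k -> 'cV[R]_d).
Local Notation normc := ComplexField.Normc.normc.
Implicit Types (V : set ('I_k -> 'cV[R]_d)).

Lemma normc_expi (t : R) : normc (expi t) = 1.
Proof. by apply/eqP; rewrite -sqrp_eq1 ?normc_ge0// sqnormc_expi. Qed.

Lemma phi_torus v : torus_mx R k (phi a v).
Proof.
by move=> m j; rewrite mxE normc_def -[Num.sqrt _]/(normc (expo (a j) (v m))) normc_expi.
Qed.

Lemma expi_frac (t : R) : expi (2 * pi * (t - (Num.floor t)%:~R)) = expi (2 * pi * t).
Proof. by rewrite mulrBr expiD expiN (@expi_int _ (Num.floor t)%:~R) ?intr_int// conjc1 mulr1. Qed.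

(* [phi a v] depends only on the fractional parts of the phases, which range over
   a compact cube. *)
Lemma det_lower_bound V :
  (forall A : 'M[R[i]]_k,
    closure (phi a @` V : set (subspace (torus_mx R k))) A -> \det A != 0) ->
  exists2 delta : R, 0 < delta & forall v, V v -> delta <= normc (\det (phi a v)).
Proof.
move=> detV; apply: contrapT => nd.
(* Without a uniform bound, determinants along some sequence tend to zero; a cluster point of the
   phases gives a singular matrix in the closure. *)
have hv n : exists v, V v /\ normc (\det (phi a v)) < n.+1%:R^-1.
  apply: contrapT => hn; apply: nd; exists n.+1%:R^-1 => // v Vv.
  by rewrite leNgt; apply/negP => vn; apply: hn; exists v.
have /choice[v_ v_P] := hv.
pose fr (t : R) := t - (Num.floor t)%:~R.
pose th n : 'rV[R]_(k * k) := mxvec (\matrix_(m, j) fr (dotv (a j) (v_ n m))).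
pose Psi (t : 'rV[R]_(k * k)) : 'M[R[i]^o]_k :=
  \matrix_(m, j) expi (2 * pi * t 0 (mxvec_index m j)).
have PsiE n : phi a (v_ n) = Psi (th n).
  by apply/matrixP => m j; rewrite !mxE mxvecE mxE expi_frac.
pose K := [set t : 'rV[R]_(k * k) | forall i, `[0, 1]%classic (t 0 i)].
have cK : compact K.
  by apply: (@rV_compact R _ (fun=> `[0, 1]%classic)) => i; exact: segment_compact.
have thK n : K (th n).
  move=> i; rewrite /th; case/mxvec_indexP: i => m j; rewrite mxvecE mxE /= in_itv/=.
  have /andP[h1 h2] := floor_itv (dotv (a j) (v_ n m)).
  by rewrite /fr subr_ge0 h1/= lerBlDl ltW// -intrD1.
have FK : (th @ \oo) K by exists 0%N => // n _; exact: thK.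
have [t0 [Kt0 clt0]] := cK (th @ \oo) _ FK.
have near_t0 e : 0 < e ->
    \forall t \near t0, forall m j, normc (Psi t0 m j - Psi t m j) < e.
  move=> e0; have e2 : 0 < e / 2 by rewrite divr_gt0.
  have FN : Filter (nbhs t0) by exact: nbhs_filter.
  apply: (filter_forall FN) => m; apply: (filter_forall FN) => j.
  pose i := mxvec_index m j.
  have c0 : (fun t : 'rV[R]_(k * k) => 2 * pi * t 0 i) @ nbhs t0 --> 2 * pi * t0 0 i.
    by apply: cvgM; [exact: cvg_cst|exact: coord_continuous].
  have cc : (fun t : 'rV[R]_(k * k) => cos (2 * pi * t 0 i)) @ nbhs t0 --> cos (2 * pi * t0 0 i).
    exact: (cvg_comp _ _ c0 (@continuous_cos R _)).
  have cs : (fun t : 'rV[R]_(k * k) => sin (2 * pi * t 0 i)) @ nbhs t0 --> sin (2 * pi * t0 0 i).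
    exact: (cvg_comp _ _ c0 (@continuous_sin R _)).
  move/cvgrPdist_lt: cc => /(_ _ e2) cc; move/cvgrPdist_lt: cs => /(_ _ e2) cs.
  near=> t; rewrite !mxE -/i.
  have h1 : `|cos (2 * pi * t0 0 i) - cos (2 * pi * t 0 i)| < e / 2 by near: t.
  have h2 : `|sin (2 * pi * t0 0 i) - sin (2 * pi * t 0 i)| < e / 2 by near: t.
  rewrite -(@ltr_pXn2r _ 2)// ?nnegrE ?normc_ge0 ?(ltW e0)//.
  rewrite sqnormcE /=; move: h1 h2.
  rewrite !ltr_norml => /andP[? ?] /andP[? ?].
  by nra.
have approx_t0 e N : 0 < e -> exists2 n, (N <= n)%N &
    forall m j, normc (Psi t0 m j - phi a (v_ n) m j) < e.
  move=> e0.
  have FN : (th @ \oo) [set x | exists2 n, (N <= n)%N & x = th n].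
    by exists N => // n /= Nn; exists n.
  have [_ [[n Nn ->] h]] := clt0 _ _ FN (near_t0 e e0).
  by exists n => // m j; rewrite PsiE.
have d0 : \det (Psi t0 : 'M[R[i]]_k) != 0.
  apply: detV; apply: closure_torus_sup.
  - by move=> m j; rewrite mxE normc_def -[Num.sqrt _]/(normc (expi _)) normc_expi.
  - move=> e /(approx_t0 _ 0%N)[n _ h]; exists (phi a (v_ n)) => //.
    by exists (v_ n) => //; exact: (v_P n).1.
  - by move=> _ [v _ <-]; exact: phi_torus.
pose dl := normc (\det (Psi t0 : 'M[R[i]]_k)).
have dl0 : 0 < dl.
  rewrite lt0r normc_ge0 andbT; apply: contra d0 => /eqP h; apply/eqP.
  exact: ComplexField.Normc.eq0_normc.
pose C : R := (k`! * k)%:R + 1.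
have C0 : 0 < C by rewrite ltr_wpDl.
(* Within this distance of the limit matrix the determinant moves by less than [dl / 2]; the bound
   [N] below makes the chosen determinant itself smaller than [dl / 2]. *)
have e0 : 0 < dl / 2 / C by rewrite !divr_gt0.
have [N] : exists N : nat, 2 / dl < N%:R.
  by exists (Num.bound (2 / dl)); apply: archi_boundP; rewrite divr_ge0// ltW.
rewrite ltr_pdivrMr// => hN.
have [n Nn hn] := approx_t0 _ N e0.
have P1 m j : normc (Psi t0 m j) <= 1 by rewrite mxE normc_expi.
have P2 m j : normc (phi a (v_ n) m j) <= 1 by rewrite mxE normc_expi.
have := normc_det_sub P1 P2 (fun m j => ltW (hn m j)).
apply/negP; rewrite -ltNge.
have [_ small] := v_P n.
have tri : dl <= normc (\det (Psi t0 : 'M[R[i]]_k) - \det (phi a (v_ n))) +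
    normc (\det (phi a (v_ n))).
  by rewrite /dl -[X in normc X <= _](subrK (\det (phi a (v_ n)))) le_normcD.
have s2 : normc (\det (phi a (v_ n))) < dl / 2.
  apply: (lt_le_trans small); rewrite invf_ple ?posrE ?divr_gt0//; last first.
  rewrite invf_div; apply: (@le_trans _ _ N%:R); last first.
    by rewrite ler_nat (leq_trans Nn).
  by rewrite ltW// ltr_pdivrMr.
apply: (@lt_le_trans _ _ (dl / 2)); last by lra.
rewrite mulrA ltr_pdivrMr// mulrC ltr_pM2l ?divr_gt0//.
by rewrite /C ltrDl.
Unshelve. all: by end_near.
Qed.

End det_lower_bound.

(** * The lower Riesz inequality on finite sums *)

Section riesz_lower.
Context (R : realType) (d : nat) (Omega : set (Rd R d)) (mOmega : measurable Omega).
Context (I : choiceType) (g : I -> Rd R d -> R[i]).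
Hypothesis mg : forall p, cmeasurable Omega (g p).
Local Notation normc := ComplexField.Normc.normc.
Local Notation sqn z := (normc z ^+ 2).

Lemma sqnorml2_finite_support (c : I -> R[i]) (F : {fset I}) :
  (forall p, p \notin F -> c p = 0) -> sqnorml2 c = (fin_sqnorm c F)%:E.
Proof.
move=> c0; rewrite /sqnorml2.
rewrite (_ : \esum_(p in setT) _ = \esum_(p in [set` F]) (sqn (c p))%:E)%E; last first.
  rewrite [RHS]esum_mkcond; apply: eq_esum => p _; case: ifPn => //.
  move=> /negP h; rewrite c0 ?ComplexField.Normc.normc0 ?expr0n//.
  by apply/negP => pF; apply: h; rewrite inE.
rewrite esum_fset; [|exact: finite_fset|by move=> p _; rewrite lee_fin sqnormc_ge0].
by rewrite fsbig_finite ?set_fsetK ?sumEFin//; exact: finite_fset.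
Qed.

(** The definition provides some [f] as the sum of a finitely supported series. It is arbitrarily
    close to the finite sum itself, and the factor 2 spares the proof that both have the same
    norm. *)
Lemma riesz_basis_lower_bound : riesz_basis Omega g -> exists2 A : R, 0 < A &
  forall c F, ((A * fin_sqnorm c F)%:E <= 2%:E * sqnormL2 Omega (lincomb g c F))%E.
Proof.
move=> [_ [A [B [A0 _ AB]]]]; exists A => // c F.
pose c' p := if p \in F then c p else 0.
have c'E : fin_sqnorm c' F = fin_sqnorm c F.
  by rewrite /fin_sqnorm !big_seq; apply: eq_bigr => p pF; rewrite /c' pF.
have n2 : sqnorml2 c' = (fin_sqnorm c F)%:E.
  by rewrite -c'E; apply: sqnorml2_finite_support => p /negPf pF; rewrite /c' pF.
have coo : (sqnorml2 c' < +oo)%E by rewrite n2 ltry.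
have [f [[mf1 mf2 foo] hf] /andP[lo _]] := AB c' coo.
rewrite n2 -EFinM in lo.
have mf : cmeasurable Omega f by [].
have mS : cmeasurable Omega (lincomb g c F) by exact: cmeasurable_lincomb.
apply/lee_addgt0Pr => e e0; apply: (le_trans lo).
have e2 : 0 < e / 2 by rewrite divr_gt0.
have [F0 hF0] := hf _ e2.
have := hF0 _ (fsubsetUl F0 F).
rewrite (@eq_sqnormL2 _ _ _ _ (fun x => f x - lincomb g c F x)); last first.
  move=> x _; congr (_ - _); rewrite /lincomb (big_fset_subset _ (fsubsetUr F0 F)).
  rewrite [X in _ + X]big1_seq ?addr0.
    by rewrite !big_seq; apply: eq_bigr => p pF; rewrite /c' pF.
  by move=> p /=; rewrite in_fsetD => /andP[/negPf pF _]; rewrite /c' pF mul0r.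
move=> h; apply: (le_trans (sqnormL2_le_triangle mOmega mf mS)).
rewrite addeC; apply: leeD => //.
apply: (@le_trans _ _ (2%:E * (e / 2)%:E)%E).
  by apply: lee_wpmul2l; [rewrite lee_fin|exact: ltW].
by rewrite -EFinM lee_fin; lra.
Qed.

End riesz_lower.

(** * Norm bounds for matrices and their inverses *)

Section matrix_bounds.
Context (R : realType).
Local Notation normc := ComplexField.Normc.normc.
Local Notation sqn z := (normc z ^+ 2).

Lemma sqnorm_mulmx_le k (A : 'M[R[i]]_k) (C : R) (u : 'I_k -> R[i]) :
  (forall i j, sqn (A i j) <= C) ->
  \sum_i sqn (\sum_j A i j * u j) <= (k%:R ^+ 2 * C) * \sum_j sqn (u j).
Proof.
move=> hA; apply: (@le_trans _ _ (\sum_(i < k) k%:R * (C * \sum_j sqn (u j)))).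
  apply: ler_sum => i _; apply: (le_trans (sqnormc_sum_le _)).
  rewrite ler_wpM2l// mulr_sumr; apply: ler_sum => j _.
  by rewrite sqnormcM ler_wpM2r ?sqnormc_ge0.
by rewrite sumr_const card_ord -[X in X <= _]mulr_natl expr2 !mulrA.
Qed.

(** Comparison with the zero matrix, whose determinant is 0 except in size zero, where it is 1;
    hence the added 1. *)
Lemma normc_det_le k (A : 'M[R[i]]_k) : (forall m j, normc (A m j) <= 1) ->
  normc (\det A) <= (k`! * k)%:R + 1.
Proof.
move=> hA; have := @normc_det_sub _ _ A 0 1 hA.
rewrite mulr1 => h; rewrite -[X in normc X](subrK (\det (0 : 'M[R[i]]_k))).
apply: (le_trans (le_normcD _ _)); apply: lerD.
  by apply: h => m j; rewrite mxE ?subr0 ?hA// ComplexField.Normc.normc0.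
case: (k) => [|n]; first by rewrite det_mx00 ComplexField.Normc.normc1.
by rewrite det0 ComplexField.Normc.normc0.
Qed.

(** The inverse is the adjugate over the determinant, and cofactors are determinants of size [k.-1]
    with entries in the unit disc. *)
Lemma invmx_bound k (delta : R) : 0 < delta -> exists2 C : R, 0 <= C &
  forall A : 'M[R[i]]_k, (forall m j, normc (A m j) <= 1) -> delta <= normc (\det A) ->
    A \in unitmx /\ forall i j, sqn (invmx A i j) <= C.
Proof.
move=> d0; pose N : R := (k.-1`! * k.-1)%:R + 1.
exists ((N / delta) ^+ 2) => [|A hA dA]; first exact: sqr_ge0.
have dA0 : \det A != 0.
  apply/eqP => h; move: dA; rewrite h ComplexField.Normc.normc0.
  by apply/negP; rewrite -ltNge.
have uA : A \in unitmx by rewrite unitmxE unitfE.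
split=> // i j; rewrite /invmx uA !mxE ComplexField.Normc.normcM.
have N0 : 0 <= N by rewrite addr_ge0.
rewrite lerXn2r ?nnegrE ?mulr_ge0 ?normc_ge0 ?invr_ge0 ?(ltW d0)//.
rewrite mulrC; apply: ler_pM; rewrite ?normc_ge0//.
  rewrite /cofactor ComplexField.Normc.normcM.
  rewrite (_ : normc ((-1) ^+ _) = 1) ?mul1r; last first.
    by rewrite -signr_odd; case: odd; rewrite ?expr0 ?expr1 ?normcN ComplexField.Normc.normc1.
  by apply: normc_det_le => m n; rewrite !mxE.
have : normc (\det A) * normc (\det A)^-1 = 1.
  by rewrite -ComplexField.Normc.normcM mulfV// ComplexField.Normc.normc1.
move: (normc_ge0 (\det A)^-1) => i0 e.
by rewrite -(ler_pM2l d0) mulfV ?gt_eqF// -e ler_wpM2r.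
Qed.

Lemma mulmx_invmx_fun k (A : 'M[R[i]]_k) u m : A \in unitmx ->
  \sum_j A m j * (\sum_n invmx A j n * u n) = u m.
Proof.
move=> uA; pose U : 'cV[R[i]]_k := \col_n u n.
have : (A *m (invmx A *m U)) m 0 = U m 0 by rewrite mulmxA mulmxV// mul1mx.
rewrite [in RHS]mxE => <-; rewrite mxE; apply: eq_bigr => j _; congr (_ * _).
by rewrite mxE; apply: eq_bigr => n _; rewrite mxE.
Qed.

End matrix_bounds.

(** * Comparison of norms on Omega and on the fundamental domain *)

Section slice_norms.
Context (R : realType) (d k : nat) (M : 'M[R]_d) (M_unit : M \in unitmx).
Context (Omega : set (Rd R d)) (mOmega : measurable Omega).
Hypothesis Omega_slices : forall w, fundamental_domain M w ->
  (lattice_slice (lattice M) Omega w #= `I_k)%card.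
Local Notation mu := (lebesgue R d).
Local Notation I0 := (fundamental_domain M : set (Rd R d)).
Local Notation svec := (slice_vec k (lattice M) Omega).
Local Notation normc := ComplexField.Normc.normc.
Local Notation sqn z := (normc z ^+ 2).
Let mI0 : measurable I0 := measurable_fundamental_domain M_unit.

Lemma cmeasurable_slice f m : cmeasurable Omega f ->
  cmeasurable I0 (fun w => f ((w : 'cV[R]_d) + svec w m)).
Proof.
have mshift (phi : Rd R d -> R) : measurable_fun Omega phi ->
    measurable_fun I0 (fun w => phi ((w : 'cV[R]_d) + svec w m)).
  move=> mphi; apply: (measurable_fun_slices M_unit mOmega Omega_slices
    (G := fun v w => phi ((w : 'cV[R]_d) + v m))) => v.
  apply: (measurable_comp (F := Omega) (f := phi) (g := shift_Rd (v m))) => //.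
    move=> _ [w [Iw <-] <-]; rewrite /shift_Rd addrC.
    exact: (slice_vecP Omega_slices m Iw).2.
  by apply: measurable_funTS; exact: measurable_shift.
by move=> [f1 f2]; split; [exact: (mshift _ f1)|exact: (mshift _ f2)].
Qed.

Let slice_sqnorm f (w : Rd R d) : \bar R :=
  (\sum_(m < k) (sqn (f ((w : 'cV[R]_d) + svec w m)%R))%:E)%E.

Lemma sqnormL2_slices f : cmeasurable Omega f ->
  sqnormL2 Omega f = (\int[mu]_(w in I0) slice_sqnorm f w)%E.
Proof.
move=> mf; apply: (integral_slices M_unit mOmega Omega_slices).
  exact: measurable_sqnormc.
by move=> x _; rewrite lee_fin sqnormc_ge0.
Qed.

Let measurable_slice_sqnorm f : cmeasurable Omega f ->
  measurable_fun I0 (slice_sqnorm f).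
Proof.
move=> mf; apply: emeasurable_sum => m.
exact: measurable_sqnormc (cmeasurable_slice m mf).
Qed.

Let slice_sqnorm_ge0 f w : (0 <= slice_sqnorm f w)%E.
Proof. by apply: sume_ge0 => m _; rewrite lee_fin sqnormc_ge0. Qed.

Section comparison.
Context (J : set (Rd R d)) (J_full : mu (I0 `\` J) = 0%E) (mJ : measurable J).
Context (T : finType) (q : T -> Rd R d -> R[i]) (f : Rd R d -> R[i]) (C : R).
Hypotheses (C0 : 0 <= C) (mf : cmeasurable Omega f).
Hypothesis mq : forall t, cmeasurable I0 (q t).

Let sum_sqn (w : Rd R d) : \bar R := (\sum_(t : T) (sqn (q t w))%:E)%E.

Let measurable_sum_sqn : measurable_fun I0 sum_sqn.
Proof. by apply: emeasurable_sum => t; exact: measurable_sqnormc. Qed.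

Let sum_sqn_ge0 w : (0 <= sum_sqn w)%E.
Proof. by apply: sume_ge0 => t _; rewrite lee_fin sqnormc_ge0. Qed.

Let lee_fin_sqn (z : R[i]) : (0 <= (sqn z)%:E)%E.
Proof. by rewrite lee_fin sqnormc_ge0. Qed.

Let integral_sum_sqn :
  (\int[mu]_(w in I0) sum_sqn w = \sum_(t : T) sqnormL2 I0 (q t))%E.
Proof.
exact: (ge0_integral_sum mu mI0 (fun t => measurable_sqnormc (mq t))
  (fun t x _ => lee_fin_sqn _)).
Qed.

Let aeJ : {ae mu, forall w, I0 w -> J w}.
Proof.
exists (I0 `\` J); split=> //; first exact: measurableD.
by move=> w /= h; apply: contrapT => h'; apply: h => Iw; apply: contrapT => Jw; exact: h'.
Qed.

(** Almost every point of [I0] lies in [J], so the inequality on slices can be integrated. The index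
    type [T] is left open: it is used with ['I_k] and with ['I_k + 'I_k]. *)
Lemma sqnormL2_slices_le :
  (forall w, I0 w -> J w -> \sum_(m < k) sqn (f ((w : 'cV[R]_d) + svec w m)) <=
     C * \sum_(t : T) sqn (q t w)) ->
  (sqnormL2 Omega f <= C%:E * \sum_(t : T) sqnormL2 I0 (q t))%E.
Proof.
move=> h; rewrite sqnormL2_slices// -integral_sum_sqn.
rewrite -(ge0_integralZl_EFin mu mI0 (fun w _ => sum_sqn_ge0 w) measurable_sum_sqn C0).
apply: (ae_ge0_le_integral mI0 (fun w _ => slice_sqnorm_ge0 f w)
  (measurable_slice_sqnorm mf) _ (measurable_funeM _ measurable_sum_sqn)).
  by move=> w _; apply: mule_ge0; rewrite ?lee_fin.
apply: filterS aeJ => w Jw Iw; rewrite /slice_sqnorm /sum_sqn !sumEFin -EFinM lee_fin.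
exact: h Iw (Jw Iw).
Qed.

Lemma sqnormL2_slices_ge :
  (forall w, I0 w -> J w -> \sum_(t : T) sqn (q t w) <=
     C * \sum_(m < k) sqn (f ((w : 'cV[R]_d) + svec w m))) ->
  (\sum_(t : T) sqnormL2 I0 (q t) <= C%:E * sqnormL2 Omega f)%E.
Proof.
move=> h; rewrite sqnormL2_slices// -integral_sum_sqn.
rewrite -(ge0_integralZl_EFin mu mI0 (fun w _ => slice_sqnorm_ge0 f w)
  (measurable_slice_sqnorm mf) C0).
apply: (ae_ge0_le_integral mI0 (fun w _ => sum_sqn_ge0 w) measurable_sum_sqn
  _ (measurable_funeM _ (measurable_slice_sqnorm mf))).
  by move=> w _; apply: mule_ge0; rewrite ?lee_fin.
apply: filterS aeJ => w Jw Iw; rewrite /slice_sqnorm /sum_sqn !sumEFin -EFinM lee_fin.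
exact: h Iw (Jw Iw).
Qed.

End comparison.
End slice_norms.

(** * The structured system along slices *)

Section structured_system.
Context (R : realType) (d k : nat) (M : 'M[R]_d) (M_unit : M \in unitmx).
Context (a : 'I_k -> 'cV[R]_d).
Local Notation mu := (lebesgue R d).
Local Notation I0 := (fundamental_domain M : set (Rd R d)).
Local Notation H := (dual_lattice (lattice M)).
Local Notation g := (exponential_system (H := H) a).
Local Notation normc := ComplexField.Normc.normc.
Local Notation sqn z := (normc z ^+ 2).
Implicit Types (c : 'I_k * H -> R[i]) (F : {fset 'I_k * H}).
Let mI0 : measurable I0 := measurable_fundamental_domain M_unit.

Definition component c F (j : 'I_k) (w : Rd R d) : R[i] :=
  \sum_(p <- F | p.1 == j) c p * expo (val p.2) w.

Lemma cmeasurable_component D c F j : cmeasurable D (component c F j).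
Proof.
apply: cmeasurable_sum => p.
exact: cmeasurableM (cmeasurable_cst _ _) (cmeasurable_expo _ _).
Qed.

Lemma cmeasurable_exponential_system D p : cmeasurable D (g p).
Proof. exact: cmeasurable_expo. Qed.

(** Exponentials with frequency in [H] are trivial on the lattice, so [l] enters only through the
    factors [expo (a j) l]. *)
Lemma lincomb_translate c F (w l : 'cV[R]_d) : lattice M l ->
  lincomb g c F (w + l) =
  \sum_j expo (a j) l * (expo (a j) w * component c F j w).
Proof.
move=> Ll; rewrite /lincomb (partition_big (fun p => p.1) xpredT)//=.
apply: eq_bigr => j _; rewrite /component !mulr_sumr; apply: eq_bigr => p /eqP <-.
rewrite /exponential_system expoDr !expoDl (expo_dual (set_valP p.2) Ll) mulr1.
by ring.
Qed.

Lemma sum_sqnormL2_component c F :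
  (\sum_(j < k) sqnormL2 I0 (component c F j) = mu I0 * (fin_sqnorm c F)%:E)%E.
Proof.
have -> : fin_sqnorm c F = \sum_(j < k) \sum_(p <- F | p.1 == j) sqn (c p).
  by rewrite /fin_sqnorm (partition_big (fun p => p.1) xpredT).
rewrite -sumEFin ge0_sume_distrr; last first.
  by move=> j _; rewrite lee_fin sumr_ge0// => p _; exact: sqnormc_ge0.
apply: eq_bigr => j _; rewrite -big_filter.
have := @sqnormL2_trig R d M M_unit _ [seq p <- F | p.1 == j] c (fun p : 'I_k * H => val p.2).
move=> <-.
- by apply: eq_sqnormL2 => w _; rewrite /component -big_filter.
- rewrite map_inj_in_uniq ?filter_uniq ?fset_uniq// => p q.
  rewrite !mem_filter => /andP[/eqP pj _] /andP[/eqP qj _] /val_inj pq.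
  by rewrite (surjective_pairing p) (surjective_pairing q) pj qj pq.
- by move=> p _; exact: (set_valP p.2).
Qed.

(** The components of a finite sum can be prescribed independently, which lets [k] approximation
    problems on [I0] be solved separately. *)
Lemma component_lincomb (c_ : 'I_k -> H -> R[i]) (F_ : 'I_k -> {fset H}) :
  exists c F, forall j, component c F j =
    lincomb (fun h : H => expo (val h)) (c_ j) (F_ j).
Proof.
exists (fun p => c_ p.1 p.2),
  [fset p in [seq (j, h) | j <- enum 'I_k, h <- enum_fset (F_ j)]]%fset => j.
apply/funext => w; rewrite /component /lincomb -big_filter.
rewrite -(big_map (fun h => (j, h)) xpredT (fun p => c_ p.1 p.2 * expo (val p.2) w)).
apply: perm_big; apply: uniq_perm.
- by rewrite filter_uniq ?fset_uniq.
- by rewrite map_inj_uniq ?fset_uniq// => h h' [].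
move=> [i h]; rewrite mem_filter in_fset /=; apply/andP/mapP => [[/eqP -> /allpairsPdep]|].
  by move=> [j' [h' [_ hh' [-> ->]]]]; exists h'.
move=> [h' hh' [-> ->]]; split=> //; apply/allpairsPdep; exists j, h'; split=> //.
by rewrite mem_enum.
Qed.

End structured_system.

(** * The two implications *)

Section determinant_criterion.
Context (R : realType) (d k : nat) (M : 'M[R]_d) (M_unit : M \in unitmx).
Context (Omega : set (Rd R d)) (mOmega : measurable Omega).
Hypothesis Omega_slices : forall w, fundamental_domain M w ->
  (lattice_slice (lattice M) Omega w #= `I_k)%card.
Context (a : 'I_k -> 'cV[R]_d) (J : set (Rd R d)) (mJ : measurable J).
Hypothesis J_full : lebesgue R d (fundamental_domain M `\` J) = 0%E.
Local Notation mu := (lebesgue R d).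
Local Notation I0 := (fundamental_domain M : set (Rd R d)).
Local Notation H := (dual_lattice (lattice M)).
Local Notation g := (exponential_system (H := H) a).
Local Notation svec := (slice_vec k (lattice M) Omega).
Local Notation normc := ComplexField.Normc.normc.
Local Notation sqn z := (normc z ^+ 2).
Let mI0 : measurable I0 := measurable_fundamental_domain M_unit.
Let Phi w : 'M[R[i]]_k := phi a (svec w).

Let PhiE w m j : Phi w m j = expo (a j) (svec w m).
Proof. by rewrite mxE. Qed.

Let sqn_Phi w m j : sqn (Phi w m j) <= 1.
Proof. by rewrite PhiE sqnormc_expo. Qed.

Let lincomb_slice c F w m : I0 w ->
  lincomb g c F ((w : 'cV[R]_d) + svec w m) =
  \sum_j Phi w m j * (expo (a j) w * component c F j w).
Proof.
move=> Iw; rewrite (lincomb_translate _ _ _ _ (slice_vecP Omega_slices m Iw).1).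
by apply: eq_bigr => j _; rewrite PhiE.
Qed.

Let sqn_expoM (b w : 'cV[R]_d) z : sqn (expo b w * z) = sqn z.
Proof. by rewrite sqnormcM sqnormc_expo mul1r. Qed.

Let I0_fin : mu I0 = (fine (mu I0))%:E.
Proof. by rewrite fineK// ge0_fin_numE// fundamental_domain_lty. Qed.

Let I0_gt0 : 0 < fine (mu I0).
Proof. by rewrite -lte_fin -I0_fin fundamental_domain_gt0. Qed.

Section det_bounded_below.
Context (K : R) (K0 : 0 <= K).
Hypothesis Phi_inv : forall w, J w ->
  Phi w \in unitmx /\ forall i j, sqn (invmx (Phi w) i j) <= K.

Lemma structured_finite_bounds : exists A B : R, [/\ 0 < A, 0 < B & forall c F,
  ((A * fin_sqnorm c F)%:E <= sqnormL2 Omega (lincomb g c F) <= (B * fin_sqnorm c F)%:E)%E].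
Proof.
(* The added 1 keeps the constants positive even if [K] is zero. *)
pose C := k%:R ^+ 2 * K + 1 : R; pose D := k%:R ^+ 2 * 1 + 1 : R.
have C0 : 0 < C by rewrite ltr_wpDl// mulr_ge0 ?sqr_ge0.
have D0 : 0 < D by rewrite ltr_wpDl// mulr_ge0 ?sqr_ge0.
exists (fine (mu I0) / C), (D * fine (mu I0)).
split; [exact: divr_gt0|exact: mulr_gt0|] => c F.
have mS : cmeasurable Omega (lincomb g c F).
  by apply: cmeasurable_lincomb => p; exact: cmeasurable_exponential_system.
have mq j : cmeasurable I0 (component c F j) by exact: cmeasurable_component.
apply/andP; split.
  have -> : ((fine (mu I0) / C * fin_sqnorm c F)%:E = (C^-1)%:E * (mu I0 * (fin_sqnorm c F)%:E))%E.
    by rewrite [X in (_ * (X * _))%E]I0_fin -!EFinM mulrA [_^-1 * _]mulrC.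
  rewrite lee_pdivrMl// -sum_sqnormL2_component//.
  apply: (sqnormL2_slices_ge M_unit mOmega Omega_slices J_full mJ (ltW C0) mS mq).
  move=> w Iw Jw.
  apply: (@le_trans _ _ ((k%:R ^+ 2 * K) * \sum_(m < k)
      sqn (lincomb g c F ((w : 'cV[R]_d) + svec w m)))); last first.
    by rewrite ler_wpM2r ?lerDl// sumr_ge0// => m _; exact: sqnormc_ge0.
  apply: le_trans (sqnorm_mulmx_le _ (Phi_inv Jw).2).
  apply: ler_sum => j _; under eq_bigr do rewrite lincomb_slice//.
  have uI : invmx (Phi w) \in unitmx by rewrite unitmx_inv (Phi_inv Jw).1.
  have := mulmx_invmx_fun (fun i => expo (a i) w * component c F i w) j uI.
  by rewrite invmxK => ->; rewrite sqn_expoM.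
rewrite -mulrA EFinM (EFinM (fine _)) -I0_fin -sum_sqnormL2_component//.
apply: (sqnormL2_slices_le M_unit mOmega Omega_slices J_full mJ (ltW D0) mS mq).
move=> w Iw Jw; under eq_bigr do rewrite lincomb_slice//.
apply: (le_trans (sqnorm_mulmx_le _ (sqn_Phi w))).
under eq_bigr do rewrite sqn_expoM.
by rewrite ler_wpM2r ?lerDl// sumr_ge0// => m _; exact: sqnormc_ge0.
Qed.

(** Inverting the matrix on each slice of [f] gives functions [y j] in L2 of [I0]. Approximating
    each of them by a trigonometric polynomial approximates [f], since the matrix has bounded
    entries. *)
Lemma structured_complete : completeL2 Omega g.
Proof.
move=> f [mf1 mf2 foo] e e0; have mf : cmeasurable Omega f by [].
pose y j (w : Rd R d) := (expo (a j) w)^*%C *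
  \sum_n invmx (Phi w) j n * f ((w : 'cV[R]_d) + svec w n).
have my j : cmeasurable I0 (y j).
  apply: cmeasurableM.
    by under eq_fun do rewrite -expoN; exact: cmeasurable_expo.
  apply: cmeasurable_sum => n; apply: cmeasurableM; last exact: cmeasurable_slice.
  (* Entries of the inverse depend on the slice vector alone, so they are constant on each cell. *)
  have minv (psi : R[i] -> R) : measurable_fun I0 (fun w => psi (invmx (Phi w) j n)).
    apply: (measurable_fun_slices M_unit mOmega Omega_slices
      (G := fun v _ => psi (invmx (phi a v : 'M[R[i]]_k) j n))) => v.
    exact: measurable_cst.
  by split; exact: minv.
have y_slice w m : I0 w -> J w -> f ((w : 'cV[R]_d) + svec w m) =
    \sum_j Phi w m j * (expo (a j) w * y j w).
  move=> Iw Jw; rewrite -[LHS](mulmx_invmx_fun (fun n => f ((w : 'cV[R]_d) + svec w n)) m (Phi_inv Jw).1).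
  apply: eq_bigr => j _; congr (_ * _); rewrite /y mulrA -expoN -expoDl subrr expo0.
  by rewrite mul1r.
pose C := k%:R ^+ 2 * K : R; pose D := k%:R ^+ 2 * 1 : R.
have C0 : 0 <= C by rewrite mulr_ge0 ?sqr_ge0.
have D0 : 0 <= D by rewrite mulr_ge0 ?sqr_ge0.
have yL2 : (\sum_(j < k) sqnormL2 I0 (y j) <= C%:E * sqnormL2 Omega f)%E.
  apply: (sqnormL2_slices_ge M_unit mOmega Omega_slices J_full mJ C0 mf my).
  move=> w Iw Jw; apply: le_trans (sqnorm_mulmx_le _ (Phi_inv Jw).2).
  by apply: ler_sum => j _; rewrite sqnormcM sqnormcJ sqnormc_expo mul1r.
have yin j : inL2 I0 (y j).
  split; [exact: (my j).1|exact: (my j).2|].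
  apply: (@le_lt_trans _ _ (\sum_(j < k) sqnormL2 I0 (y j))%E).
    by rewrite (bigD1 j)//= leeDl// sume_ge0// => i _; exact: sqnormL2_ge0.
  apply: (le_lt_trans yL2); rewrite lte_mul_pinfty// ?lee_fin//.
pose eta := e / (D * k%:R + 1).
have Dk0 : 0 < D * k%:R + 1 by rewrite ltr_wpDl// mulr_ge0.
have eta0 : 0 < eta by exact: divr_gt0.
have approx j := trigonometric_complete M_unit (yin j) eta0.
have /choice[cF hcF] : forall j, exists cF : (H -> R[i]) * {fset H},
    (sqnormL2 I0 (fun x => y j x - lincomb (fun h : H => expo (val h)) cF.1 cF.2 x)%R < eta%:E)%E.
  by move=> j; have [c [F h]] := approx j; exists (c, F).
have [c [F hc]] := component_lincomb (fun j => (cF j).1) (fun j => (cF j).2).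
exists c, F.
have mS : cmeasurable Omega (lincomb g c F).
  by apply: cmeasurable_lincomb => p; exact: cmeasurable_exponential_system.
have mq j : cmeasurable I0 (fun w => y j w - component c F j w).
  by apply: (cmeasurableB (my j)); exact: cmeasurable_component.
apply: (@le_lt_trans _ _ (D%:E * \sum_(j < k) sqnormL2 I0 (fun w => y j w - component c F j w)%R)%E).
  apply: (sqnormL2_slices_le M_unit mOmega Omega_slices J_full mJ D0 (cmeasurableB mf mS) mq).
  move=> w Iw Jw; under eq_bigr do rewrite y_slice// lincomb_slice// -sumrB.
  under eq_bigr do under eq_bigr do rewrite -!mulrBr.
  apply: (le_trans (sqnorm_mulmx_le _ (sqn_Phi w))).
  by under eq_bigr do rewrite sqn_expoM.
apply: (@le_lt_trans _ _ (D%:E * \sum_(j < k) eta%:E)%E).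
  apply: lee_wpmul2l; first by rewrite lee_fin.
  apply: lee_sum => j _; rewrite hc; exact: ltW (hcF j).
rewrite sumEFin -EFinM lte_fin sumr_const card_ord -[X in _ * X]mulr_natl.
by rewrite /eta mulrA mulrA ltr_pdivrMr// mulrC ltr_pM2l// ltrDl.
Qed.

End det_bounded_below.

Hypothesis J_sub : J `<=` essential_domain k M Omega.

(* If [B x = 0] and the exponential matrix on a cell is close to [B], the
   functions [cell_fun x j] form a vector of norm comparable to [x] which the
   synthesis operator maps to an almost null function. *)
Let cell_fun (v : 'I_k -> 'cV[R]_d) (x : 'I_k -> R[i]) j (w : Rd R d) : R[i] :=
  (\1_(slice_cell M Omega v) w : R)%:C%C * ((expo (a j) w)^*%C * x j).

Let cmeasurable_cell_fun v x j : cmeasurable I0 (cell_fun v x j).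
Proof.
apply: cmeasurableM.
  apply: cmeasurable_real; apply: measurable_indic.
  exact: (measurable_slice_cell M_unit mOmega Omega_slices).
apply: cmeasurableM; last exact: cmeasurable_cst.
by under eq_fun do rewrite -expoN; exact: cmeasurable_expo.
Qed.

Let sqn_cell_fun v x j w :
  sqn (cell_fun v x j w) = \1_(slice_cell M Omega v) w * sqn (x j).
Proof.
rewrite sqnormcM sqnormcM sqnormcJ sqnormc_expo mul1r; congr (_ * _).
by rewrite sqnormc_real indicE; case: (_ \in _); rewrite ?expr1n ?expr0n.
Qed.

Let sqnormL2_cell_fun v x j :
  sqnormL2 I0 (cell_fun v x j) = ((sqn (x j))%:E * mu (slice_cell M Omega v))%E.
Proof.
have mcell := measurable_slice_cell M_unit mOmega Omega_slices v.
have cellI : slice_cell M Omega v `<=` I0 by move=> w [].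
rewrite -(setIidl cellI) -(integral_indic mu mI0 mcell).
rewrite -(ge0_integralZl_EFin mu mI0)//.
- by apply: eq_integral => w _; rewrite sqn_cell_fun EFinM muleC.
- by apply/measurable_EFinP; exact: measurable_indic.
- exact: sqnormc_ge0.
Qed.

(** Trigonometric polynomials [p j] close to the cell functions have total norm about [X * m0]. By
    Parseval this is the coefficient norm times [mu0], which the lower Riesz bound controls by the
    norm of the sum on [Omega]; that norm is only of order eta + eps^2 X m0. *)
Lemma riesz_basis_det_neq0 (B : 'M[R[i]]_k) : riesz_basis Omega g ->
  closure (phi a @` (svec @` J) : set (subspace (torus_mx R k))) B -> \det B != 0.
Proof.
move=> rb clB.
have [A A0 lowA] := riesz_basis_lower_bound mOmega
  (fun p => @cmeasurable_exponential_system _ _ _ _ a Omega p) rb.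
rewrite -det_tr; apply/negP => /det0P[v v0 vB].
pose x j := v 0 j.
have Bx m : \sum_j B m j * x j = 0.
  transitivity ((v *m B^T) 0 m); last by rewrite vB mxE.
  by rewrite mxE; apply: eq_bigr => j _; rewrite mxE mulrC.
pose X := \sum_j sqn (x j).
have X0 : 0 < X.
  rewrite lt0r sumr_ge0 ?andbT => [|j _]; last exact: sqnormc_ge0.
  apply: contra v0 => /eqP h; apply/eqP/rowP => j; rewrite mxE; apply/eqP.
  rewrite -[v 0 j]/(x j) -sqnormc_eq0; apply/eqP.
  by have /(_ j erefl) := psumr_eq0P (fun j _ => sqnormc_ge0 (x j)) h.
(* [Q] collects the losses: 2 from replacing [y] by [p], 2 from the lower bound, [D] = 2 k^2 from
   the slices, and the factor mu0 / A. *)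
pose mu0 := fine (mu I0); pose Q := 8 * mu0 * k%:R ^+ 2 / A.
have Q0 : 0 <= Q by rewrite !mulr_ge0 ?invr_ge0 ?sqr_ge0 ?(ltW A0) ?(ltW I0_gt0).
(* [eps] is fixed before the cell and must not depend on its measure; [eta], chosen afterwards,
   may. *)
pose eps := (2 * Q + 1)^-1.
have eps0 : 0 < eps by rewrite invr_gt0; lra.
have epsQ : eps ^+ 2 * Q <= 2^-1.
  have e1 : eps * (2 * Q + 1) = 1 by rewrite mulVf// gt_eqF//; lra.
  by have e2 : eps <= 1; nra.
have [_ [u [w0 Jw0 <-{u}] <-] BPhi] := closure_torus_sub clB eps0.
pose vw := svec w0.
(* The inclusion of [J] in the essential domain enters here: the cell of the chosen point is not
   null. *)
have m_gt0 : (0 < mu (slice_cell M Omega vw))%E.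
  by have [v' [_ v'0] [_ ]] := J_sub Jw0; rewrite /vw => ->.
have mcell := measurable_slice_cell M_unit mOmega Omega_slices vw.
pose m0 := fine (mu (slice_cell M Omega vw)).
have m_fin : mu (slice_cell M Omega vw) = m0%:E.
  rewrite fineK// ge0_fin_numE//; apply: le_lt_trans (fundamental_domain_lty M).
  by apply: le_measure; rewrite ?inE// => w [].
have m00 : 0 < m0 by rewrite -lte_fin -m_fin.
have Xm0 : 0 < X * m0 by exact: mulr_gt0.
(* Chosen so that all the approximation errors together stay below half of [X * m0]. *)
pose eta := X * m0 / (2 * (k%:R * (2 + Q) + 1)).
have kQ : 0 <= k%:R * (2 + Q) by rewrite mulr_ge0 ?addr_ge0.
have eta0 : 0 < eta by rewrite divr_gt0// mulr_gt0// ltr_wpDl.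
have etaE : k%:R * eta * (2 + Q) < X * m0 / 2.
  rewrite (_ : _ * _ = (k%:R * (2 + Q)) * (X * m0) / (2 * (k%:R * (2 + Q) + 1))); last first.
    by rewrite /eta; ring.
  rewrite ltr_pdivrMr ?mulr_gt0 ?ltr_wpDl//.
  by rewrite (_ : X * m0 / 2 * _ = X * m0 * (k%:R * (2 + Q) + 1)); [nra|field].
pose y := cell_fun vw x.
have my j : cmeasurable I0 (y j) by exact: cmeasurable_cell_fun.
have yL2 j : sqnormL2 I0 (y j) = (sqn (x j) * m0)%:E.
  by rewrite sqnormL2_cell_fun m_fin.
have yin j : inL2 I0 (y j).
  by split; [exact: (my j).1|exact: (my j).2|rewrite yL2 ltry].
have approx j := trigonometric_complete M_unit (yin j) eta0.
have /choice[cF hcF] : forall j, exists cF : (H -> R[i]) * {fset H},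
    (sqnormL2 I0 (fun w => y j w - lincomb (fun h : H => expo (val h)) cF.1 cF.2 w)%R < eta%:E)%E.
  by move=> j; have [c [F h]] := approx j; exists (c, F).
have [c [F hc]] := component_lincomb (fun j => (cF j).1) (fun j => (cF j).2).
pose p := component c F.
have mp j : cmeasurable I0 (p j) by exact: cmeasurable_component.
have mS : cmeasurable Omega (lincomb g c F).
  by apply: cmeasurable_lincomb => i; exact: cmeasurable_exponential_system.
have yp j : (sqnormL2 I0 (fun w => y j w - p j w)%R <= eta%:E)%E.
  by rewrite /p hc; exact: ltW (hcF j).
have sqn_eps : sqn eps%:C%C = eps ^+ 2 by exact: sqnormc_real.
(* The cell functions scaled by [eps] dominate the slice values of the main part, so that both error
   sources fit in one family [q] of functions on [I0]. *)
pose z j := cell_fun vw (fun i => eps%:C%C * x i) j.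
have zL2 j : sqnormL2 I0 (z j) = (eps ^+ 2 * (sqn (x j) * m0))%:E.
  have -> : z j = cell_fun vw (fun i => eps%:C%C * x i) j by [].
  rewrite sqnormL2_cell_fun.
  have -> : sqn (eps%:C%C * x j) = eps ^+ 2 * sqn (x j) by rewrite sqnormcM sqn_eps.
  by rewrite m_fin -EFinM -mulrA.
pose q (t : 'I_k + 'I_k) := match t with
  | inl j => fun w => y j w - p j w | inr j => z j end.
have mq t : cmeasurable I0 (q t).
  by case: t => j /=; [exact: (cmeasurableB (my j) (mp j))|exact: cmeasurable_cell_fun].
pose D := 2 * k%:R ^+ 2 : R.
have D0 : 0 <= D by rewrite mulr_ge0 ?sqr_ge0.
have upper : (sqnormL2 Omega (lincomb g c F) <= D%:E * \sum_t sqnormL2 I0 (q t))%E.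
  apply: (sqnormL2_slices_le M_unit mOmega Omega_slices J_full mJ D0 mS mq).
  move=> w Iw Jw; rewrite big_sumType/= mulrDr.
  (* [P1] is the contribution of the approximation error and [P2] that of the exact cell
     functions. *)
  pose P1 m := \sum_j Phi w m j * (expo (a j) w * (y j w - p j w)).
  pose P2 m := \sum_j Phi w m j * (expo (a j) w * y j w).
  have E m : lincomb g c F ((w : 'cV[R]_d) + svec w m) = P2 m - P1 m.
    rewrite lincomb_slice// /P2 /P1 -sumrB; apply: eq_bigr => j _.
    by rewrite -/(p j w); ring.
  have h1 : \sum_m sqn (P1 m) <= k%:R ^+ 2 * \sum_j sqn (y j w - p j w).
    apply: (le_trans (sqnorm_mulmx_le _ (sqn_Phi w))).
    by rewrite mulr1; under eq_bigr do rewrite sqn_expoM.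
  have h2 : \sum_m sqn (P2 m) <= k%:R ^+ 2 * \sum_j sqn (z j w).
    have [cw|cw] := pselect (slice_cell M Omega vw w); last first.
      rewrite big1; last first.
        move=> m _; rewrite /P2 big1 ?ComplexField.Normc.normc0 ?expr0n// => j _.
        by rewrite /y /cell_fun indicE memNset// mul0r !mulr0.
      by rewrite mulr_ge0 ?sqr_ge0// sumr_ge0// => j _; exact: sqnormc_ge0.
    have subE m j : (Phi w0 - B) m j = Phi w0 m j - B m j by rewrite !mxE.
    (* On the cell the slice vector is that of [w0], so the matrix is [Phi w0], and [B] may be
       subtracted because it kills [x]. *)
    have P2E m : P2 m = \sum_j (Phi w0 - B) m j * x j.
      rewrite -[LHS]subr0 -[X in _ - X](Bx m) /P2 -sumrB; apply: eq_bigr => j _.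
      rewrite subE mulrBl; congr (_ - _).
      rewrite /y /cell_fun indicE mem_set// mul1r !mulrA -[_ * expo (a j) w * _]mulrA.
      by rewrite -expoN -expoDl subrr expo0 mulr1 /Phi cw.2.
    under eq_bigr do rewrite P2E.
    apply: (@le_trans _ _ (k%:R ^+ 2 * eps ^+ 2 * \sum_j sqn (x j))).
      apply: sqnorm_mulmx_le => m j; rewrite subE -normcN opprB.
      by rewrite lerXn2r ?nnegrE ?normc_ge0 ?(ltW eps0)// ltW.
    rewrite -mulrA ler_wpM2l ?sqr_ge0// mulr_sumr; apply: ler_sum => j _.
    by rewrite /z sqn_cell_fun indicE mem_set// mul1r sqnormcM sqn_eps.
  apply: (@le_trans _ _ (2 * \sum_m sqn (P2 m) + 2 * \sum_m sqn (P1 m))).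
    rewrite !mulr_sumr -big_split; apply: ler_sum => m _.
    by rewrite E; exact: sqnormcB_le.
  by rewrite /D; lra.
have upper' : (sqnormL2 Omega (lincomb g c F) <= (D * (k%:R * eta + eps ^+ 2 * (X * m0)))%:E)%E.
  apply: (le_trans upper); rewrite [leRHS]EFinM; apply: lee_wpmul2l; first by rewrite lee_fin.
  rewrite big_sumType EFinD; apply: leeD.
    apply: (@le_trans _ _ (\sum_(j < k) eta%:E)%E); first by apply: lee_sum => j _; exact: yp.
    by rewrite sumEFin sumr_const card_ord -[X in (X%:E <= _)%E]mulr_natl.
  by rewrite /= (eq_bigr _ (fun j _ => zL2 j)) sumEFin -mulr_sumr /X mulr_suml.
pose fs := fin_sqnorm c F.
have h1 : A * fs <= 2 * (D * (k%:R * eta + eps ^+ 2 * (X * m0))).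
  rewrite -lee_fin; apply: (le_trans (lowA c F)); rewrite EFinM.
  by apply: lee_wpmul2l; rewrite ?lee_fin.
have h2 : X * m0 <= 2 * (k%:R * eta) + 2 * (mu0 * fs).
  have : (\sum_j sqnormL2 I0 (y j) <=
      \sum_j (2%:E * eta%:E + 2%:E * sqnormL2 I0 (p j)))%E.
    apply: lee_sum => j _; apply: (le_trans (sqnormL2_le_triangle mI0 (my j) (mp j))).
    by apply: leeD => //; apply: lee_wpmul2l; rewrite ?lee_fin//; exact: yp.
  rewrite [X in (_ <= X)%E -> _]big_split/=.
  rewrite -[X in (_ <= _ + X)%E -> _]ge0_sume_distrr => [|j _]; last exact: sqnormL2_ge0.
  rewrite (sum_sqnormL2_component M_unit) (eq_bigr _ (fun j _ => yL2 j)) I0_fin.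
  rewrite -/mu0 -/fs -!EFinM !sumEFin -EFinD lee_fin -mulr_suml -/X.
  by rewrite sumr_const card_ord -[X in _ <= X + _ -> _]mulr_natl mulrCA.
have QE : Q * A = 8 * mu0 * k%:R ^+ 2 by rewrite /Q divfK// gt_eqF.
have h3 : 2 * (mu0 * fs) <= Q * (k%:R * eta + eps ^+ 2 * (X * m0)).
  rewrite -(ler_pM2l A0) [leRHS]mulrA [A * Q]mulrC QE.
  apply: (@le_trans _ _ (2 * mu0 * (A * fs))); first lra.
  have m02 : 0 <= 2 * mu0 by rewrite mulr_ge0// ltW.
  by apply: (le_trans (ler_wpM2l m02 h1)); rewrite /D; lra.
have h4 : Q * (eps ^+ 2 * (X * m0)) <= X * m0 / 2.
  by rewrite mulrA [Q * _]mulrC [leRHS]mulrC ler_wpM2r// ltW.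
have : X * m0 < X * m0; last by rewrite ltxx.
by apply: (le_lt_trans h2); lra.
Qed.

End determinant_criterion.

Theorem theorem4p10 (R : realType) (d k : nat) (d_gt0 : (0 < d)%N)
    (k_gt0 : (0 < k)%N) (M : 'M[R]_d) (M_unit : M \in unitmx)
    (Omega : set (Rd R d)) (mOmega : measurable Omega)
    (Omega_tiles : tiles k (lattice M) Omega)
    (Omega_slices : forall w, fundamental_domain M w ->
      (lattice_slice (lattice M) Omega w #= `I_k)%card)
    (a : 'I_k -> 'cV[R]_d) (J : set (Rd R d)) (mJ : measurable J)
    (J_sub : J `<=` essential_domain k M Omega)
    (J_full : lebesgue R d (fundamental_domain M `\` J) = 0%E) :
  riesz_basis Omega (exponential_system (H := dual_lattice (lattice M)) a)
  <->
  (forall A : 'M[R[i]]_k,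
    closure (phi a @` (slice_vec k (lattice M) Omega @` J)
             : set (subspace (torus_mx R k))) A ->
    \det A != 0).
Proof.
split=> [rb A|det_neq0].
  exact: (riesz_basis_det_neq0 M_unit mOmega Omega_slices mJ J_full J_sub rb).
have [delta delta0 lower] := det_lower_bound det_neq0.
have [K K0 hK] := invmx_bound k delta0.
have Phi_inv w : J w -> (phi a (slice_vec k (lattice M) Omega w) : 'M[R[i]]_k) \in unitmx /\
    forall i j, ComplexField.Normc.normc
      (invmx (phi a (slice_vec k (lattice M) Omega w) : 'M[R[i]]_k) i j) ^+ 2 <= K.
  move=> Jw; apply: hK; last by apply: lower; exists w.
  by move=> m j; rewrite mxE normc_expi.
apply: riesz_basis_of_finite_bounds => //.
- by move=> p; exact: cmeasurable_exponential_system.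
- exact: (structured_finite_bounds M_unit mOmega Omega_slices mJ J_full K0 Phi_inv).
- exact: (structured_complete M_unit mOmega Omega_slices mJ J_full K0 Phi_inv).
Qed.
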